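(* Let $0<\alpha<2$ and let $(n_k)$ be an increasing sequence of positive integers. A stationary $\alpha$-stable process $(\mathbb{R}^{\mathbb{Z}},\mathcal{B}^{\otimes\mathbb{Z}},\mathbb{P},S)$ with associated system $(\Omega,\mathcal{F},\mu,T)$ is rigid for the sequence $n_{k}$ if and only if $(\Omega,\mathcal{F},\mu,T)$ is rigid for the sequence $n_{k}$.
   Context: Measure spaces are $\sigma$-finite Lebesgue (standard) spaces and statements are modulo null sets. A nonsingular system $(\Omega,\mathcal{F},\mu,T)$ consists of such a space and a bijective bi-measurable map $T$ such that the image of $\mu$ under $T$ is equivalent to $\mu$; $T_*^{-n}\mu$ is the image of $\mu$ under $T^{-n}$, i.e. $B\mapsto\mu(T^nB)$. A nonsingular (in particular, measure-preserving) system $(\Omega,\mathcal{F},\mu,T)$ is rigid for the sequence $n_k$ if $T^{n_k}\to\mathrm{Id}$ in the group of nonsingular automorphisms of $(\Omega,\mathcal{F},\mu)$, i.e. if the unitary operators $U_{T^{n_k}}:f\mapsto\sqrt{\frac{\mathrm{d}T_{*}^{-n_k}\mu}{\mathrm{d}\mu}}\;f\circ T^{n_k}$ on $L^2(\mu)$ converge weakly to the identity. A process is identified with its distribution $\mathbb{P}$ on $\mathbb{R}^{\mathbb{Z}}$, and $S$ is the shift on $\mathbb{R}^{\mathbb{Z}}$. An IDp process is an infinitely divisible process $X=\{X_n\}_{n\in\mathbb{Z}}$ without Gaussian part. The Lévy measure of a stationary IDp process $X$ is the shift-invariant $\sigma$-finite measure $Q$ on $\mathbb{R}^{\mathbb{Z}}$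 with $Q(\{0_{\mathbb{R}^{\mathbb{Z}}}\})=0$, $\int(x_0^2\wedge 1)\,Q(\mathrm{d}\{x_n\}_{n\in\mathbb{Z}})<\infty$ and $$\mathbb{E}\Big[\exp\Big(i\sum_{k=n_1}^{n_2}a_kX_k\Big)\Big]=\exp\Big[\int_{\mathbb{R}^{\mathbb{Z}}}\Big(\exp\Big(i\sum_{k=n_1}^{n_2}a_kx_k\Big)-1-i\sum_{k=n_1}^{n_2}a_kc(x_k)\Big)Q(\mathrm{d}\{x_n\}_{n\in\mathbb{Z}})\Big]$$ for all $n_1\le n_2$ in $\mathbb{Z}$ and real $a_k$, where $c(x)=-1$ if $x<-1$, $c(x)=x$ if $-1\le x\le 1$, $c(x)=1$ if $x>1$. The Lévy measure system is $(\mathbb{R}^{\mathbb{Z}},\mathcal{B}^{\otimes\mathbb{Z}},Q,S)$. The $\alpha$-stable stationary processes are the stationary IDp processes whose Lévy measure $Q$ is nonzero and satisfies $(R_t)_*Q=t^{\alpha}Q$ for all $t>0$, where $R_t:\{x_n\}_{n\in\mathbb{Z}}\mapsto\{tx_n\}_{n\in\mathbb{Z}}$ and $(R_t)_*Q$ is the image measure $B\mapsto Q(R_t^{-1}B)$. A nonsingular system $(\Omega,\mathcal{F},\mu,T)$ is associated with the $\alpha$-stable process if there is $f\in L^\alpha(\mu)$ such that, with $M(\omega,t)=tf(\omega)$ and $\widetilde{T}_{\alpha}(\omega,s)=\big(T\omega,s(\frac{\mathrm{d}T_{*}^{-1}\mu}{\mathrm{d}\mu}(\omega))^{1/\alpha}\big)$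 on $\Omega\times\mathbb{R}_+^*$, the map $(\omega,t)\mapsto\{M\circ\widetilde{T}_{\alpha}^{n}(\omega,t)\}_{n\in\mathbb{Z}}$ is an isomorphism of the measure-preserving system $(\Omega\times\mathbb{R}_{+}^{*},\mathcal{F}\otimes\mathcal{B}_{+},\mu\otimes\frac{1}{s^{1+\alpha}}\,\mathrm{d}s,\widetilde{T}_{\alpha})$ (the Maharam extension) with the Lévy measure system. Such a system always exists, and $\mu$ may be taken to be a probability measure. *)

(* Defs.v *)
From HB Require Import structures.
From mathcomp Require Import all_boot all_order all_algebra.
From mathcomp Require Import all_classical all_reals all_analysis.
From mathcomp Require Import measurable_realfun complex.
Set Implicit Arguments.
Unset Strict Implicit.
Unset Printing Implicit Defensive.
Import Order.TTheory GRing.Theory Num.Theory.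
Import numFieldNormedType.Exports.
Local Open Scope classical_set_scope.
Local Open Scope ring_scope.

(* Measurability with respect to the completion of [m]. *)
Definition ae_measurable_fun d1 d2 (X : measurableType d1)
    (Y : measurableType d2) (R : realType) (m : {measure set X -> \bar R})
    (f : X -> Y) : Prop :=
  forall A, measurable A ->
    exists2 B, measurable B & {ae m, forall x, A (f x) <-> B x}.

(* [phi] is an isomorphism modulo null sets of the measure spaces ([X], [m1])
   and ([Y], [m2]). The inverse is only asked to be measurable for the
   completed sigma-algebras, so that complete sigma-algebras on [X] are
   covered. *)
Definition measure_isomorphism d1 d2 (X : measurableType d1)
    (Y : measurableType d2) (R : realType) (m1 : {measure set X -> \bar R})
    (m2 : {measure set Y -> \bar R}) (phi : X -> Y) : Prop :=
  [/\ measurable_fun setT phi,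
      forall A, measurable A -> pushforward m1 phi A = m2 A &
      exists psi : Y -> X,
        [/\ ae_measurable_fun m2 psi,
            {ae m1, forall x, psi (phi x) = x} &
            {ae m2, forall y, phi (psi y) = y}]].

Definition system_isomorphism d1 d2 (X : measurableType d1)
    (Y : measurableType d2) (R : realType) (m1 : {measure set X -> \bar R})
    (T1 : X -> X) (m2 : {measure set Y -> \bar R}) (T2 : Y -> Y)
    (phi : X -> Y) : Prop :=
  measure_isomorphism m1 m2 phi /\ {ae m1, forall x, phi (T1 x) = T2 (phi x)}.

(* A sigma-finite Lebesgue space: isomorphic modulo null sets to the real line
   with some sigma-finite Borel measure. Atoms are allowed. *)
Definition lebesgue_space d (X : measurableType d) (R : realType)
    (mu : {sigma_finite_measure set X -> \bar R}) : Prop :=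
  exists (nu : {sigma_finite_measure set R -> \bar R}) (phi : X -> R),
    measure_isomorphism mu nu phi.

Record bimeasurable d (X : measurableType d) := Bimeasurable {
  bim_fun :> X -> X;
  bim_inv : X -> X;
  bim_funK : cancel bim_fun bim_inv;
  bim_invK : cancel bim_inv bim_fun;
  measurable_bim_fun : measurable_fun setT bim_fun;
  measurable_bim_inv : measurable_fun setT bim_inv }.

Definition nonsingular d (X : measurableType d) (R : realType)
    (mu : {measure set X -> \bar R}) (T : bimeasurable X) : Prop :=
  pushforward mu T `<< mu /\ mu `<< pushforward mu T.

Definition is_RN_derivative d (X : measurableType d) (R : realType)
    (nu mu : set X -> \bar R) (w : X -> R) : Prop :=
  [/\ measurable_fun setT w, forall x, 0 <= w x &
      forall A, measurable A -> nu A = (\int[mu]_(x in A) (w x)%:E)%E].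

(* A version of d nu / d mu, junk if there is none. The Radon-Nikodym
   derivative of the library requires [nu] to be finite. *)
Definition RN_derivative d (X : measurableType d) (R : realType)
    (nu mu : set X -> \bar R) : X -> R :=
  xget (cst 0) [set w | is_RN_derivative nu mu w].

(* d T_*^{-n} mu / d mu, where T_*^{-n} mu is the image of [mu] under the
   [n]-th iterate of the inverse of [T]. *)
Definition RN_iter d (X : measurableType d) (R : realType)
    (mu : {measure set X -> \bar R}) (T : bimeasurable X) (n : nat) : X -> R :=
  RN_derivative (pushforward mu (iter n (bim_inv T))) mu.

Definition koopman d (X : measurableType d) (R : realType)
    (mu : {measure set X -> \bar R}) (T : bimeasurable X) (n : nat)
    (f : X -> R) (x : X) : R :=
  Num.sqrt (RN_iter mu T n x) * f (iter n T x).

(* Weak convergence to the identity on the real Hilbert space L^2(mu). As the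
   operators preserve real functions, this is also weak convergence on its
   complexification. *)
Definition rigid d (X : measurableType d) (R : realType)
    (mu : {measure set X -> \bar R}) (T : bimeasurable X)
    (n : nat -> nat) : Prop :=
  forall f g : X -> R, f \in Lfun mu 2%:E -> g \in Lfun mu 2%:E ->
    (\int[mu]_x (koopman mu T (n k) f x * g x)) @[k --> \oo]
      --> \int[mu]_x (f x * g x).

Definition coordinate_sets (R : realType) : set (set (int -> R)) :=
  [set A | exists n : int, exists2 B : set R, measurable B &
    A = [set x | B (x n)]].

(* R^Z with its product sigma-algebra. *)
Definition paths (R : realType) := g_sigma_algebraType (@coordinate_sets R).

HB.instance Definition _ (R : realType) := Measurable.on (paths R).

Section shift.
Variable R : realType.

Lemma measurable_paths d (X : measurableType d) (f : X -> paths R) :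
  (forall n : int, measurable_fun setT (fun x => f x n)) ->
  measurable_fun setT f.
Proof.
move=> mf.
apply: (@measurability _ _ X (paths R) setT f (@coordinate_sets R)) => //.
move=> _ [_ [n [B mB ->]] <-].
exact: mf.
Qed.

Lemma measurable_coordinate (n : int) :
  measurable_fun setT (fun x : paths R => x n).
Proof.
move=> _ B mB; rewrite setTI; apply: sub_sigma_algebra.
by exists n, B.
Qed.

Definition shift_fun (x : paths R) : paths R := fun n => x (n + 1).
Definition shift_inv (x : paths R) : paths R := fun n => x (n - 1).

Lemma shift_funK : cancel shift_fun shift_inv.
Proof. by move=> x; apply/funext => n; rewrite /shift_inv /shift_fun subrK. Qed.

Lemma shift_invK : cancel shift_inv shift_fun.
Proof. by move=> x; apply/funext => n; rewrite /shift_inv /shift_fun addrK. Qed.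

Lemma measurable_shift_fun : measurable_fun setT shift_fun.
Proof. apply: measurable_paths => n; exact: measurable_coordinate. Qed.

Lemma measurable_shift_inv : measurable_fun setT shift_inv.
Proof. apply: measurable_paths => n; exact: measurable_coordinate. Qed.

Definition path_shift : bimeasurable (paths R) :=
  Bimeasurable shift_funK shift_invK measurable_shift_fun measurable_shift_inv.

End shift.
Arguments path_shift {R}.

Definition zero_path (R : realType) : paths R := fun=> 0.

Definition add_paths (R : realType) (x y : paths R) : paths R :=
  fun n => x n + y n.

Definition shift_invariant (R : realType)
    (m : {measure set (paths R) -> \bar R}) : Prop :=
  forall A, measurable A -> pushforward m path_shift A = m A.

(* The law of the sum of [N] independent processes of law [rho]. *)
Fixpoint convolution_power (R : realType) (rho : set (paths R) -> \bar R)
    (N : nat) (A : set (paths R)) : \bar R :=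
  if N is N'.+1 then
    (\int[rho]_x
       convolution_power rho N' (add_paths x @^-1` A))%E
  else \d_(@zero_path R) A.

Definition infinitely_divisible (R : realType)
    (P : probability (paths R) R) : Prop :=
  forall N, (0 < N)%N -> exists rho : probability (paths R) R,
    forall A, measurable A -> P A = convolution_power rho N A.

Definition cexp (R : realType) (z : R[i]) : R[i] :=
  let: Complex x y := z in Complex (expR x * cos y) (expR x * sin y).

Definition cintegral d (X : measurableType d) (R : realType)
    (mu : {measure set X -> \bar R}) (f : X -> R[i]) : R[i] :=
  Complex (\int[mu]_x complex.Re (f x)) (\int[mu]_x complex.Im (f x)).

Definition clip (R : realType) (x : R) : R :=
  if x < -1 then -1 else if x <= 1 then x else 1.

(* The sum of [u k] over the integers [n1 <= k <= n2], for [n1 <= n2]. *)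
Definition int_sum (R : realType) (n1 n2 : int) (u : int -> R) : R :=
  \sum_(j < `|n2 - n1|%N.+1) u (n1 + j%:Z).

Local Open Scope complex_scope.

Definition levy_khintchine (R : realType) (P : probability (paths R) R)
    (Q : {sigma_finite_measure set (paths R) -> \bar R}) : Prop :=
  forall (n1 n2 : int) (a : int -> R), n1 <= n2 ->
    cintegral P (fun x =>
      cexp ('i * (int_sum n1 n2 (fun k => a k * x k))%:C)) =
    cexp (cintegral Q (fun x =>
      cexp ('i * (int_sum n1 n2 (fun k => a k * x k))%:C) - 1
      - 'i * (int_sum n1 n2 (fun k => a k * clip (x k)))%:C)).

Local Close Scope complex_scope.

(* [P] is the law of a stationary infinitely divisible process without Gaussian
   part and [Q] is its Levy measure: the absence of a Gaussian part (and the
   normalisation of the drift) is the absence of the corresponding terms in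
   the exponent of [levy_khintchine]. *)
Record stationary_IDp (R : realType) (P : probability (paths R) R)
    (Q : {sigma_finite_measure set (paths R) -> \bar R}) : Prop := {
  IDp_stationary : shift_invariant P;
  IDp_infinitely_divisible : infinitely_divisible P;
  levy_shift_invariant : shift_invariant Q;
  levy_zero : Q [set @zero_path R] = 0%E;
  levy_integrable :
    (\int[Q]_x (Num.min ((x : paths R) 0 ^+ 2) 1)%:E < +oo)%E;
  levy_formula : levy_khintchine P Q }.

Definition scaling (R : realType) (t : R) (x : paths R) : paths R :=
  fun n => t * x n.

(* [Q] is the Levy measure of the stationary alpha-stable process [P]. *)
Definition stationary_stable (R : realType) (alpha : R)
    (P : probability (paths R) R)
    (Q : {sigma_finite_measure set (paths R) -> \bar R}) : Prop :=
  [/\ stationary_IDp P Q,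
      Q setT != 0%E &
      forall t : R, 0 < t -> forall A, measurable A ->
        pushforward Q (scaling t) A = ((t `^ alpha)%:E * Q A)%E].

(* The measure s^(-1-alpha) ds of ]0, +oo[, as a measure on the real line
   that gives no mass to ]-oo, 0]. *)
Definition stable_measure (R : realType) (alpha : R) (A : set R) : \bar R :=
  (\int[lebesgue_measure]_(s in A)
     (\1_(`]0, +oo[%classic) s * s `^ (- (1 + alpha)))%:E)%E.

Section stable_measure.
Context {R : realType}.
Variable alpha : R.
Local Open Scope ereal_scope.

Let density (s : R) : R :=
  (\1_(`]0%R, +oo[%classic) s * s `^ (- (1 + alpha)))%R.

Let density_ge0 s : (0 <= density s)%R.
Proof. by rewrite mulr_ge0// powR_ge0. Qed.

Let measurable_density : measurable_fun setT density.
Proof.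
apply: measurable_funM; first exact: measurable_indic.
exact: measurable_powR.
Qed.

Let stable_measure0 : stable_measure alpha set0 = 0.
Proof. by rewrite /stable_measure integral_set0. Qed.

Let stable_measure_ge0 A : 0 <= stable_measure alpha A.
Proof. by apply: integral_ge0 => s _; rewrite lee_fin; exact: density_ge0. Qed.

Let stable_measure_sigma_additive : semi_sigma_additive (stable_measure alpha).
Proof.
move=> /= F mF tF mUF; rewrite /stable_measure; apply: cvg_toP.
  apply: ereal_nondecreasing_is_cvgn => m n mn.
  apply: lee_sum_nneg_natr => // k _ _; apply: integral_ge0 => /= x Fkx.
  by rewrite lee_fin; exact: density_ge0.
rewrite ge0_integral_bigcup//=.
- by apply/measurable_funTS/measurableT_comp => //; exact: measurable_density.
- by move=> x _; rewrite lee_fin; exact: density_ge0.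
Qed.

HB.instance Definition _ := isMeasure.Build _ _ _ (stable_measure alpha)
  stable_measure0 stable_measure_ge0 stable_measure_sigma_additive.

Let stable_measure_sigma_finite : sigma_finite setT (stable_measure alpha).
Proof.
pose F (n : nat) : set R :=
  `[(- n%:R)%R, n%:R%R]%classic `&` density @^-1` `]-oo, n%:R%R]%classic.
have mF n : measurable (F n).
  apply: measurableI; first exact: measurable_itv.
  by rewrite -[X in measurable X]setTI; exact: measurable_density.
exists F.
  apply/esym/seteqP; split => // s _.
  exists (Num.truncn (Num.max `|s| (density s)))%R.+1 => //.
  have := Num.Theory.truncnS_gt (Num.max `|s| (density s))%R.
  rewrite gt_max => /andP[/ltW sn /ltW dn].
  by split; rewrite /= in_itv/= -?ler_norml.
move=> n; split; first exact: mF.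
apply: (@le_lt_trans _ _ (\int[lebesgue_measure]_(s in F n) (cst n%:R%R%:E) s)).
  apply: ge0_le_integral => //.
  - exact: mF.
  - by move=> s _; rewrite lee_fin; exact: density_ge0.
  - by apply/measurable_funTS/measurableT_comp => //; exact: measurable_density.
  - by move=> s [_]; rewrite /= in_itv/= lee_fin.
rewrite integral_cst; last exact: mF.
apply: lte_mul_pinfty; rewrite ?lee_fin//.
apply: (@le_lt_trans _ _ (lebesgue_measure `[(- n%:R)%R, n%:R : R]%classic)).
  by apply: le_measure; rewrite ?inE;
    [exact: mF|exact: measurable_itv|exact: subIsetl].
by rewrite lebesgue_measure_itv/=; case: ifP => _; rewrite -?EFinD ltry.
Qed.

HB.instance Definition _ := Measure_isSigmaFinite.Build _ _ _
  (stable_measure alpha) stable_measure_sigma_finite.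

End stable_measure.

(* The Maharam extension, on [X * R] with the measure [mu \x stable_measure
   alpha], which is carried by X * ]0, +oo[. *)
Definition maharam d (X : measurableType d) (R : realType) (alpha : R)
    (mu : {measure set X -> \bar R}) (T : bimeasurable X) (x : X * R) : X * R :=
  (T x.1, x.2 * RN_iter mu T 1 x.1 `^ alpha^-1).

(* The inverse of [maharam] off a null set, the derivative being almost
   everywhere positive. *)
Definition maharam_inv d (X : measurableType d) (R : realType) (alpha : R)
    (mu : {measure set X -> \bar R}) (T : bimeasurable X) (x : X * R) : X * R :=
  (bim_inv T x.1, x.2 * RN_iter mu T 1 (bim_inv T x.1) `^ (- alpha^-1)).

Definition maharam_iter d (X : measurableType d) (R : realType) (alpha : R)
    (mu : {measure set X -> \bar R}) (T : bimeasurable X) (n : int) :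
    X * R -> X * R :=
  match n with
  | Posz k => iter k (maharam alpha mu T)
  | Negz k => iter k.+1 (maharam_inv alpha mu T)
  end.

Definition maharam_process d (X : measurableType d) (R : realType) (alpha : R)
    (mu : {measure set X -> \bar R}) (T : bimeasurable X) (f : X -> R)
    (x : X * R) : paths R :=
  fun n => let y := maharam_iter alpha mu T n x in y.2 * f y.1.

(* [mu], [T] is associated with the alpha-stable process of Levy measure [Q]. *)
Definition associated d (X : measurableType d) (R : realType) (alpha : R)
    (mu : {sigma_finite_measure set X -> \bar R}) (T : bimeasurable X)
    (Q : {sigma_finite_measure set (paths R) -> \bar R}) : Prop :=
  exists2 f : X -> R, f \in Lfun mu alpha%:E &
    system_isomorphism (mu \x stable_measure alpha)%E (maharam alpha mu T)
      Q path_shift (maharam_process alpha mu T f).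

(* Main.v *)
Require Import Defs.
From HB Require Import structures.
From mathcomp Require Import all_boot all_order all_algebra.
From mathcomp Require Import all_classical all_reals all_analysis.
From mathcomp Require Import measurable_realfun complex ring lra.
Set Implicit Arguments.
Unset Strict Implicit.
Unset Printing Implicit Defensive.
Import Order.TTheory GRing.Theory Num.Theory.
Import numFieldNormedType.Exports HBNNSimple.
Local Open Scope classical_set_scope.
Local Open Scope ring_scope.

(** Writing the Levy measure system as the Maharam extension, the process is
    [x_n = s * (d T_*^{-n} mu / d mu)^(1/alpha) * f o T^n], and for every
    nondecreasing [h >= 0] on [0, +oo[ with [h 0 = 0] and every [g >= 0] on
    [Omega], the scaling of [s^(-1-alpha) ds] turns the [Q]-integral of
    [|h (s g) o S^n - h (s g)|] into a constant multiple of the [mu]-integral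
    of [|(U^n u)^2 - u^2|], where [u = g^(alpha/2)] and [U] is the Koopman
    operator of [T]. Hence [U^{n_k} -> Id] is equivalent to the convergence of
    [x_{n_k} - x_0] to [0] in [Q]-measure: one implication takes [g] to be the
    positive and negative parts of [f], the other takes [h] to be the indicator
    of [1 < s] and uses that the sets [B] for which multiplication by [1_B]
    preserves almost invariance form a sigma-algebra, so that the convergence of
    the coordinates propagates to every set of finite [Q]-measure. Finally, by
    the Levy-Khintchine formula, [E exp (i a (X_{n_k} - X_0)) -> 1] for all [a]
    if and only if [x_{n_k} - x_0 -> 0] in [Q]-measure, and the same
    sigma-algebra argument shows that the former is the rigidity of [P]. *)

(** * Integrals of nonnegative real functions *)

(** Two obstacles shape the argument. First, [Q] may be infinite, so constants and many indicators
    lie outside [L^2(Q)]. Convergence of coordinates is therefore expressed by the truncations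
    [clamp L (x j)], and a set is first shown to preserve almost invariance under multiplication,
    before its own indicator is known to be almost invariant. The first indicators come from the
    sets where [x_j] or [- x_j] exceeds [1 / (M + 1)], which cover every nonzero path. Second, the
    real part of the characteristic function of an increment is [exp (- r) * cos v], with [r] the
    integral of [1 - cos] and [v] a phase. From [P] to [Q] the phase is harmless because
    [cos v <= 1]. From [Q] to [P] it must be shown to vanish, although its integrand is only of
    first order in the increment once a coordinate exceeds 1; the finite mass of such paths
    compensates. The monotonicity of [h] is what makes the link with the Koopman operator an
    equality: the difference has a constant sign in [s], so the scaling applies to each term
    separately. *)

Lemma cvge0P (R : realType) (u : nat -> \bar R) : (forall k, (0 <= u k)%E) ->
  (u k @[k --> \oo] --> 0%E) <->
  (forall e : R, 0 < e -> \forall k \near \oo, (u k <= e%:E)%E).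
Proof.
move=> u0; split=> [/fine_cvgP[uf /cvgrPdist_lt u_0] e e0|ue].
  near=> k.
  have ufk : u k \is a fin_num by near: k; exact: uf.
  rewrite -(fineK ufk) lee_fin.
  have : `|0 - (fine \o u) k| < e by near: k; exact: u_0.
  by rewrite sub0r normrN => /ltW; apply: le_trans; rewrite ler_norm.
apply/fine_cvgP; split.
  near=> k; rewrite ge0_fin_numE//.
  apply: (@le_lt_trans _ _ 1%:E); last exact: ltry.
  by near: k; apply: ue.
apply/cvgrPdist_le => e e0; near=> k.
have uk : (u k <= e%:E)%E by near: k; exact: ue.
rewrite sub0r normrN /= ger0_norm ?fine_ge0//.
rewrite -lee_fin fineK// ge0_fin_numE//.
exact: le_lt_trans uk (ltry _).
Unshelve. all: by end_near. Qed.

(** The form in which most limits below are proved: [C] and [v] may depend on [e] but not on [k], so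
    the precision is fixed before [k] tends to infinity. *)
Lemma cvge0_approx (R : realType) (u : nat -> \bar R) :
  (forall k, (0 <= u k)%E) ->
  (forall e : R, 0 < e -> exists (C : R) (v : nat -> \bar R),
    [/\ 0 <= C, forall k, (0 <= v k)%E, v k @[k --> \oo] --> 0%E &
        forall k, (u k <= C%:E * v k + e%:E)%E]) ->
  u k @[k --> \oo] --> 0%E.
Proof.
move=> u0 uv; apply/cvge0P => // e e0.
have e20 : 0 < e / 2 by rewrite divr_gt0.
have [C [v [C0 v0 v_0 uCv]]] := uv _ e20.
have Ce : 0 < e / 2 / (C + 1) by rewrite divr_gt0// ltr_wpDl.
move/(cvge0P v0) : v_0 => /(_ _ Ce); apply: filterS => k vk.
apply: (le_trans (uCv k)).
apply: (@le_trans _ _ (C%:E * (e / 2 / (C + 1))%:E + (e / 2)%:E)%E).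
  by apply: leeD => //; apply: lee_wpmul2l.
rewrite -EFinM -EFinD lee_fin.
rewrite [leRHS](splitr e) lerD2r mulrA ler_pdivrMr ?ltr_wpDl//.
by rewrite mulrDr mulr1 mulrC lerDl ltW.
Qed.

Lemma cvge0_le (R : realType) (C : R) (u v : nat -> \bar R) :
  0 <= C -> (forall k, (0 <= u k)%E) -> (forall k, (0 <= v k)%E) ->
  v k @[k --> \oo] --> 0%E -> (forall k, (u k <= C%:E * v k)%E) ->
  u k @[k --> \oo] --> 0%E.
Proof.
move=> C0 u0 v0 v_0 uv; apply: cvge0_approx => // e e0.
exists C, v; split => // k; apply: (le_trans (uv k)).
by rewrite leeDl// lee_fin ltW.
Qed.

Section nonneg_integral.
Context d (X : measurableType d) (R : realType) (m : {measure set X -> \bar R}).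
Implicit Types f g h : X -> R.

Lemma nint_ge0 f : (forall x, 0 <= f x) -> (0 <= \int[m]_x (f x)%:E)%E.
Proof. by move=> f0; apply: integral_ge0 => x _; rewrite lee_fin. Qed.

Lemma ae_nint_le f g : measurable_fun setT f -> measurable_fun setT g ->
  (forall x, 0 <= f x) -> (forall x, 0 <= g x) ->
  {ae m, forall x, f x <= g x} ->
  (\int[m]_x (f x)%:E <= \int[m]_x (g x)%:E)%E.
Proof.
move=> mf mg f0 g0 fg; apply: ae_ge0_le_integral => //.
- by move=> x _; rewrite lee_fin.
- exact/measurable_EFinP.
- by move=> x _; rewrite lee_fin.
- exact/measurable_EFinP.
- by apply: filterS fg => x fgx _; rewrite lee_fin.
Qed.

Lemma nint_le f g : measurable_fun setT f -> measurable_fun setT g ->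
  (forall x, 0 <= f x) -> (forall x, f x <= g x) ->
  (\int[m]_x (f x)%:E <= \int[m]_x (g x)%:E)%E.
Proof.
move=> mf mg f0 fg; apply: ae_nint_le => //.
- by move=> x; exact: le_trans (f0 x) (fg x).
- exact: aeW.
Qed.

Lemma ae_nint_eq f g : measurable_fun setT f -> measurable_fun setT g ->
  {ae m, forall x, f x = g x} ->
  (\int[m]_x (f x)%:E = \int[m]_x (g x)%:E)%E.
Proof.
move=> mf mg fg; apply: ae_eq_integral => //.
- exact/measurable_EFinP.
- exact/measurable_EFinP.
- by apply: filterS fg => x fgx _; rewrite fgx.
Qed.

Lemma nintZ f (c : R) : 0 <= c -> measurable_fun setT f ->
  (forall x, 0 <= f x) ->
  (\int[m]_x (c * f x)%:E = c%:E * \int[m]_x (f x)%:E)%E.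
Proof.
move=> c0 mf f0.
under eq_integral do rewrite EFinM.
rewrite ge0_integralZl_EFin//; first by move=> x _; rewrite lee_fin.
exact/measurable_EFinP.
Qed.

Lemma nintD f g : measurable_fun setT f -> measurable_fun setT g ->
  (forall x, 0 <= f x) -> (forall x, 0 <= g x) ->
  (\int[m]_x (f x + g x)%:E = \int[m]_x (f x)%:E + \int[m]_x (g x)%:E)%E.
Proof.
move=> mf mg f0 g0.
under eq_integral do rewrite EFinD.
rewrite ge0_integralD//; try exact/measurable_EFinP.
  by move=> x _; rewrite lee_fin.
by move=> x _; rewrite lee_fin.
Qed.

Lemma nint_le2 f g h (C D : R) : 0 <= C -> 0 <= D -> measurable_fun setT f ->
  measurable_fun setT g -> measurable_fun setT h ->
  (forall x, 0 <= f x) -> (forall x, 0 <= g x) -> (forall x, 0 <= h x) ->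
  (forall x, f x <= C * g x + D * h x) ->
  (\int[m]_x (f x)%:E <=
    C%:E * \int[m]_x (g x)%:E + D%:E * \int[m]_x (h x)%:E)%E.
Proof.
move=> C0 D0 mf mg mh f0 g0 h0 fgh.
have mCg : measurable_fun setT (fun x => C * g x) by exact: measurable_funM.
have mDh : measurable_fun setT (fun x => D * h x) by exact: measurable_funM.
rewrite -nintZ// -nintZ// -nintD//.
- by apply: nint_le => //; exact: measurable_funD.
- by move=> x; rewrite mulr_ge0.
- by move=> x; rewrite mulr_ge0.
Qed.

Lemma nint_dominated_cvg0 (F : nat -> X -> R) g :
  (forall i, measurable_fun setT (F i)) -> measurable_fun setT g ->
  (forall i x, 0 <= F i x) -> (forall i x, F i x <= g x) ->
  (\int[m]_x (g x)%:E < +oo)%E ->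
  (forall x, F i x @[i --> \oo] --> (0 : R)) ->
  (\int[m]_x (F i x)%:E @[i --> \oo] --> 0)%E.
Proof.
move=> mF mg F0 Fg goo F_0; rewrite -(integral0 m setT).
have g0 x : 0 <= g x by exact: le_trans (F0 0 x) (Fg 0 x).
apply: (@dominated_cvg _ _ _ m setT measurableT
    (fun i x => (F i x)%:E) (cst 0%E) (fun x => (g x)%:E)) => //.
- by move=> i; exact/measurable_EFinP.
- by move=> x _; apply/fine_cvgP; split; [exact: nearW|exact: F_0].
- apply/integrableP; split; first exact/measurable_EFinP.
  rewrite (eq_integral (fun x => (g x)%:E))// => x _.
  by rewrite gee0_abs// lee_fin.
- by move=> i x _ /=; rewrite ger0_norm// lee_fin.
Qed.

Definition square_integrable f :=
  measurable_fun setT f /\ (\int[m]_x (f x ^+ 2)%:E < +oo)%E.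

Lemma square_integrable_le f g (C : R) : 0 <= C -> measurable_fun setT f ->
  square_integrable g -> (forall x, f x ^+ 2 <= C * g x ^+ 2) ->
  square_integrable f.
Proof.
move=> C0 mf [mg g2] fg; split => //.
apply: (@le_lt_trans _ _ (\int[m]_x (C * g x ^+ 2)%:E)%E).
  apply: nint_le => //.
  - exact: measurable_funX.
  - apply: measurable_funM => //; exact: measurable_funX.
  - by move=> x; exact: sqr_ge0.
rewrite nintZ//; last 2 first.
- exact: measurable_funX.
- by move=> x; exact: sqr_ge0.
by apply: lte_mul_pinfty; rewrite ?lee_fin.
Qed.

End nonneg_integral.

(** * Almost invariant functions *)

Section almost_invariant.
Context d (X : measurableType d) (R : realType) (m : {measure set X -> \bar R}).
Variable tau : nat -> X -> X.
Hypothesis mtau : forall k, measurable_fun setT (tau k).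
Hypothesis tau_m : forall k A, measurable A -> pushforward m (tau k) A = m A.
Implicit Types F G H Y : X -> R.

Lemma nint_comp k F : measurable_fun setT F -> (forall x, 0 <= F x) ->
  (\int[m]_x (F (tau k x))%:E = \int[m]_x (F x)%:E)%E.
Proof.
move=> mF F0.
transitivity (\int[pushforward m (tau k)]_x (F x)%:E)%E.
  rewrite ge0_integral_pushforward//.
    exact/measurable_EFinP.
  by move=> x _; rewrite lee_fin.
by apply: eq_measure_integral => A mA _; exact: tau_m.
Qed.

Lemma measurable_comp_tau k F : measurable_fun setT F ->
  measurable_fun setT (fun x => F (tau k x)).
Proof. by move=> mF; apply: measurableT_comp (mtau k). Qed.

(** Kept in the extended reals, because it also serves for bounded functions that need not be square
    integrable. *)
Definition drift G k : \bar R := (\int[m]_x ((G (tau k x) - G x) ^+ 2)%:E)%E.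

Lemma drift_ge0 G k : (0 <= drift G k)%E.
Proof. by apply: nint_ge0 => x; exact: sqr_ge0. Qed.

Lemma measurable_drift G k : measurable_fun setT G ->
  measurable_fun setT (fun x => (G (tau k x) - G x) ^+ 2).
Proof.
move=> mG; apply: measurable_funX; apply: measurable_funB => //.
exact: measurable_comp_tau.
Qed.

Definition almost_invariant G :=
  square_integrable m G /\ drift G k @[k --> \oo] --> 0%E.

Lemma measurable_sqr G : measurable_fun setT G ->
  measurable_fun setT (fun x => G x ^+ 2).
Proof. exact: measurable_funX. Qed.

Lemma square_integrableD F G :
  square_integrable m F -> square_integrable m G ->
  square_integrable m (fun x => F x + G x).
Proof.
move=> [mF F2] [mG G2]; split; first exact: measurable_funD.
apply: (@le_lt_trans _ _ (2%:E * \int[m]_x (F x ^+ 2)%:E +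
    2%:E * \int[m]_x (G x ^+ 2)%:E)%E).
  apply: nint_le2 => //; try by move=> x; exact: sqr_ge0.
  - by apply: measurable_sqr; exact: measurable_funD.
  - exact: measurable_sqr.
  - exact: measurable_sqr.
  - by move=> x; have := sqr_ge0 (F x - G x); nra.
by apply: lte_add_pinfty; apply: lte_mul_pinfty.
Qed.

Lemma almost_invariantD F G : almost_invariant F -> almost_invariant G ->
  almost_invariant (fun x => F x + G x).
Proof.
move=> [F2 dF] [G2 dG]; split; first exact: square_integrableD.
have [[mF _] [mG _]] := (F2, G2).
apply: (@cvge0_le _ 2 _ (fun k => drift F k + drift G k)%E) => //.
- by move=> k; exact: drift_ge0.
- by move=> k; apply: adde_ge0; exact: drift_ge0.
- by rewrite -[0%E]adde0; exact: cvgeD.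
move=> k; rewrite ge0_muleDr ?drift_ge0//.
apply: nint_le2 => //; try by move=> x; exact: sqr_ge0.
- by apply: measurable_drift; exact: measurable_funD.
- exact: measurable_drift.
- exact: measurable_drift.
- move=> x.
  have := sqr_ge0 ((F (tau k x) - F x) - (G (tau k x) - G x)); nra.
Qed.

Lemma almost_invariantZ (c : R) F : almost_invariant F ->
  almost_invariant (fun x => c * F x).
Proof.
move=> [[mF F2] dF].
have c20 : 0 <= c ^+ 2 by exact: sqr_ge0.
split.
  apply: (@square_integrable_le _ _ _ _ _ F (c ^+ 2)) => //.
    exact: measurable_funM.
  by move=> x; rewrite exprMn.
apply: (@cvge0_le _ (c ^+ 2) _ (drift F)) => //.
- by move=> k; exact: drift_ge0.
- by move=> k; exact: drift_ge0.
move=> k; rewrite -nintZ//.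
- apply: nint_le => //.
  + by apply: measurable_drift; exact: measurable_funM.
  + by apply: measurable_funM => //; exact: measurable_drift.
  + by move=> x; exact: sqr_ge0.
  + by move=> x; rewrite -mulrBr exprMn.
- exact: measurable_drift.
- by move=> x; exact: sqr_ge0.
Qed.

Lemma almost_invariantB F G : almost_invariant F -> almost_invariant G ->
  almost_invariant (fun x => F x - G x).
Proof.
move=> aF aG; have := almost_invariantD aF (almost_invariantZ (-1) aG).
by under eq_fun do rewrite mulN1r.
Qed.

(** Composition with [tau k] is an isometry of [L^2(m)], so replacing [G] by [F] costs the same
    error at both ends of the difference, uniformly in [k]. *)
Lemma almost_invariant_closed G : square_integrable m G ->
  (forall e : R, 0 < e -> exists2 F, almost_invariant F &
    (\int[m]_x ((G x - F x) ^+ 2)%:E <= e%:E)%E) ->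
  almost_invariant G.
Proof.
move=> G2 GF; split => //; have [mG _] := G2.
apply: cvge0_approx => [k|e e0]; first exact: drift_ge0.
have e60 : 0 < e / 6 by rewrite divr_gt0.
have [F [[mF F2] dF] GFe] := GF _ e60.
(* From [(a + b + c)^2 <= 3 (a^2 + b^2 + c^2)]: the two errors of [e / 6], multiplied by 3, add up
   to [e]. *)
exists 3, (drift F); split => //; first by move=> k; exact: drift_ge0.
move=> k.
have mD : measurable_fun setT (fun x => (G x - F x) ^+ 2).
  by apply: measurable_sqr; exact: measurable_funB.
have mDk : measurable_fun setT (fun x => (G (tau k x) - F (tau k x)) ^+ 2).
  exact: (@measurable_comp_tau k (fun x => (G x - F x) ^+ 2)).
apply: (@le_trans _ _ (3%:E * drift F k + 3%:E *
    \int[m]_x ((G (tau k x) - F (tau k x)) ^+ 2 + (G x - F x) ^+ 2)%:E)%E).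
  apply: nint_le2 => //; try by move=> x; exact: sqr_ge0.
  - exact: measurable_drift.
  - exact: measurable_drift.
  - exact: measurable_funD.
  - by move=> x; apply: addr_ge0; exact: sqr_ge0.
  - move=> x.
    pose a := G (tau k x) - F (tau k x); pose b := F (tau k x) - F x.
    pose c := F x - G x.
    have -> : G (tau k x) - G x = a + b + c by rewrite /a /b /c; ring.
    have -> : (G x - F x) ^+ 2 = c ^+ 2 by rewrite /c; ring.
    rewrite -/a -/b.
    have := sqr_ge0 (a - b); have := sqr_ge0 (a - c); have := sqr_ge0 (b - c).
    nra.
rewrite leeD2l// nintD//; try by move=> x; exact: sqr_ge0.
rewrite (@nint_comp k (fun x => (G x - F x) ^+ 2))//; last first.
  by move=> x; exact: sqr_ge0.
apply: (@le_trans _ _ (3%:E * ((e / 6)%:E + (e / 6)%:E))%E).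
  by apply: lee_wpmul2l => //; apply: leeD.
by rewrite -EFinD -EFinM lee_fin; lra.
Qed.

(** Since [(G - F i)^2 <= 4 G^2], dominated convergence turns the pointwise limit into a limit in
    [L^2(m)]. *)
Lemma almost_invariant_lim G (F : nat -> X -> R) : square_integrable m G ->
  (forall i, almost_invariant (F i)) -> (forall i x, `|F i x| <= `|G x|) ->
  (forall x, F i x @[i --> \oo] --> G x) -> almost_invariant G.
Proof.
move=> G2 aF FG cF; apply: almost_invariant_closed => // e e0.
have [mG G2oo] := G2.
have mF i : measurable_fun setT (F i) by have [[]] := aF i.
have mS i : measurable_fun setT (fun x => (G x - F i x) ^+ 2).
  by apply: measurable_sqr; exact: measurable_funB.
have : (\int[m]_x ((G x - F i x) ^+ 2)%:E @[i --> \oo] --> 0)%E.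
  apply: (@nint_dominated_cvg0 _ _ _ _ _ (fun x => 4 * G x ^+ 2)) => //.
  - by apply: measurable_funM => //; exact: measurable_sqr.
  - by move=> i x; exact: sqr_ge0.
  - move=> i x.
    have := FG i x; rewrite -[_ ^+ 2]real_normK ?num_real//.
    rewrite -(real_normK (num_real (G x))).
    have := ler_normB (G x) (F i x).
    have := normr_ge0 (G x); have := normr_ge0 (F i x).
    have := normr_ge0 (G x - F i x).
    nra.
  - rewrite nintZ//; first exact: lte_mul_pinfty.
      exact: measurable_sqr.
    by move=> x; exact: sqr_ge0.
  - move=> x.
    rewrite [X in _ --> X](_ : _ = (G x - G x) ^+ 2 :> R); last first.
      by rewrite subrr expr0n.
    rewrite expr2.
    by apply: cvgM; (apply: cvgB => //; exact: cvg_cst).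
move=> /cvge0P h.
have /h[//|N _ /(_ N (leqnn N)) hN] := e0; first by move=> i;
  apply: nint_ge0 => x; exact: sqr_ge0.
by exists (F N).
Qed.

End almost_invariant.

(** * Truncations, ramps and indicators *)

Definition clamp (R : realDomainType) (L x : R) : R := Num.min L (Num.max (- L)
  x).

Lemma clamp_gt (R : realDomainType) (L x : R) : L < x -> clamp L x = L.
Proof. by move=> Lx; rewrite /clamp min_l// le_max (ltW Lx) orbT. Qed.

Lemma clamp_ltN (R : realFieldType) (L x : R) : 0 < L -> L < - x ->
  clamp L x = - L.
Proof. by move=> L0 Lx; rewrite /clamp max_l ?min_r//; lra. Qed.

Lemma ler_norm_clip (R : realFieldType) (a b x y : R) : a <= b ->
  `|Num.min b (Num.max a x) - Num.min b (Num.max a y)| <= `|x - y|.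
Proof.
move=> ab; case: (leP a x) => ax; case: (leP a y) => ay;
  rewrite ?(min_r ab) ?(max_l (ltW ax)) ?(max_l (ltW ay));
  (try case: (leP b x) => bx); (try case: (leP b y) => bY);
  rewrite ?subrr ?normr0 ?normr_ge0//;
  rewrite ler_norml; have := ler_norm (x - y); have := ler_norm (y - x);
  rewrite (distrC y x); lra.
Qed.

(** The ramp varies only on [[a, a + 1/c]], which lies inside [[-(|a| + 1), |a| + 1]] because
    [1 <= c]. Hence it factors through the truncation at [|a| + 1], and it is [c]-Lipschitz. *)
Lemma ler_norm_ramp (R : realFieldType) (c a x y : R) : 1 <= c ->
  `|Num.min 1 (Num.max 0 (c * (x - a))) - Num.min 1 (Num.max 0 (c * (y - a)))|
  <= c * `|clamp (`|a| + 1) x - clamp (`|a| + 1) y|.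
Proof.
move=> c1; have c0 : 0 <= c by exact: le_trans c1.
have ramp_clamp z : Num.min 1 (Num.max 0 (c * (z - a))) =
    Num.min 1 (Num.max 0 (c * (clamp (`|a| + 1) z - a))).
  rewrite /clamp; have := ler_norm a; have := ler_norm (- a); rewrite normrN.
  move=> Na Pa; case: (leP (- (`|a| + 1)) z) => z1.
    case: (leP (`|a| + 1) z) => z2 //.
    have c_ge1 u : 1 <= u -> 1 <= c * u by move=> u1; rewrite -[1]mulr1 ler_pM.
    by rewrite !min_l// le_max; apply/orP; right; apply: c_ge1; lra.
  rewrite (@min_r _ _ (`|a| + 1)); last by have := normr_ge0 a; lra.
  by rewrite !max_l// mulr_ge0_le0//; lra.
rewrite (ramp_clamp x) (ramp_clamp y).
apply: (le_trans (ler_norm_clip _ _ _)) => //.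
by rewrite -mulrBr opprB addrA subrK normrM (ger0_norm c0).
Qed.

Lemma sqr_indic_le1 (T : Type) (R : realDomainType) (B : set T) x :
  (\1_B x : R) ^+ 2 <= 1.
Proof. by rewrite indicE; case: (_ \in B); rewrite ?expr1n ?expr0n. Qed.

Lemma indic_bigsetU_le (T : Type) (R : realType) (A : nat -> set T) N x :
  (\1_(\big[setU/set0]_(i < N) A i) x : R) <= \1_(\bigcup_i A i) x.
Proof.
rewrite !indicE ler_nat.
case: (boolP (x \in \big[setU/set0]_(i < N) A i)) => // xA.
rewrite mem_set//; move: xA; rewrite inE -bigcup_mkord => -[i _ Ai].
by exists i.
Qed.

Lemma cvg_indic_bigsetU (T : Type) (R : realType) (A : nat -> set T) x :
  (\1_(\big[setU/set0]_(i < N) A i) x : R) @[N --> \oo] -->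
  (\1_(\bigcup_i A i) x : R).
Proof.
apply: (@cvg_trans _ (cst (\1_(\bigcup_i A i) x : R) @ \oo)); last first.
  exact: cvg_cst.
apply: near_eq_cvg.
have [[i _ Ai]|nA] := pselect ((\bigcup_i A i) x).
  near=> N; rewrite /cst !indicE mem_set; last by exists i.
  rewrite mem_set// -bigcup_mkord; exists i => //=.
  by near: N; exact: nbhs_infty_gt.
apply: nearW => N; rewrite /cst !indicE memNset// memNset//.
by apply: contra_not nA; rewrite -bigcup_mkord => -[i _ Ai]; exists i.
Unshelve. all: by end_near. Qed.

Lemma measurable_clamp d (X : measurableType d) (R : realType) L (F : X -> R) :
  measurable_fun setT F -> measurable_fun setT (fun x => clamp L (F x)).
Proof. by move=> mF; apply: measurable_minr => //; apply: measurable_maxr. Qed.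

(** * Sets that preserve almost invariance *)

Section multiplier.
Context d (X : measurableType d) (R : realType) (m : {measure set X -> \bar R}).
Variable tau : nat -> X -> X.
Hypothesis mtau : forall k, measurable_fun setT (tau k).
Hypothesis tau_m : forall k A, measurable A -> pushforward m (tau k) A = m A.
Implicit Types F G H Y : X -> R.
Local Notation drift := (drift m tau).
Local Notation almost_invariant := (almost_invariant m tau).

Lemma nint_tail_cvg0 (g : X -> R) : measurable_fun setT g ->
  (forall x, 0 <= g x) -> (\int[m]_x (g x)%:E < +oo)%E ->
  (\int[m]_x (if g x <= i%:R then 0 else g x)%:E @[i --> \oo] --> 0)%E.
Proof.
move=> mg g0 goo.
apply: (@nint_dominated_cvg0 _ _ _ m (fun i x => if g x <= i%:R then 0 else g x)
  g) => //.
- move=> i; apply: measurable_fun_ifT => //.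
  exact: measurable_fun_ler.
- by move=> i x; case: ifPn.
- by move=> i x; case: ifPn.
- move=> x; apply: (@cvg_trans _ (cst (0 : R) @ \oo)); last exact: cvg_cst.
  apply: near_eq_cvg; near=> i.
  suff -> : g x <= i%:R by [].
  apply: (le_trans (ltW (truncnS_gt (g x)))).
  rewrite ler_nat; near: i; exact: nbhs_infty_ge.
Unshelve. all: by end_near. Qed.

(** The increment of [H G] is [H' (G' - G) + (H' - H) G], primes denoting composition with [tau k].
    The second term is cut according to the size of [G^2]: where it is at most [N] the drift of [H]
    controls the term, and the rest is small by integrability of [G^2]. Only boundedness is asked of
    [H], which may lie outside [L^2(m)]. *)
Lemma almost_invariantM H G : measurable_fun setT H ->
  (forall x, `|H x| <= 1) -> drift H k @[k --> \oo] --> 0%E ->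
  almost_invariant G -> almost_invariant (fun x => H x * G x).
Proof.
move=> mH H1 dH [G2 dG]; have [mG G2oo] := G2.
have H21 x : H x ^+ 2 <= 1.
  by rewrite -real_normK ?num_real// expr_le1.
split.
  apply: (@square_integrable_le _ _ _ _ _ G 1) => //.
    exact: measurable_funM.
  by move=> x; rewrite exprMn ler_wpM2r ?sqr_ge0.
have mS : measurable_fun setT (fun x => G x ^+ 2) by exact: measurable_sqr.
have S0 x : 0 <= G x ^+ 2 by exact: sqr_ge0.
apply: cvge0_approx => [k|e e0]; first exact: drift_ge0.
have := @nint_tail_cvg0 _ mS S0 G2oo.
pose t i x := if G x ^+ 2 <= i%:R then 0 else G x ^+ 2.
have t0 i x : 0 <= t i x by rewrite /t; case: ifPn.
have e80 : 0 < e / 8 by rewrite divr_gt0.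
have t0' i : (0 <= \int[m]_x (t i x)%:E)%E by exact: nint_ge0.
move=> /(cvge0P t0') /(_ _ e80) [N _ /(_ N (leqnn N)) /= tN].
(* The square of a sum of two terms brings a factor 2. The tail of [G^2] is then weighted by
   [2 * 4], as [(H' - H)^2 <= 4], whence the earlier choice of [e / 8]. *)
exists (2 * N%:R + 2), (fun k => drift G k + drift H k)%E; split => //.
- by move=> k; apply: adde_ge0; exact: drift_ge0.
- by rewrite -[0%E]adde0; exact: cvgeD.
have mt : measurable_fun setT (t N).
  by apply: measurable_fun_ifT => //; exact: measurable_fun_ler.
move=> k.
apply: (@le_trans _ _ ((2 * N%:R + 2)%:E * \int[m]_x
  ((G (tau k x) - G x) ^+ 2 + (H (tau k x) - H x) ^+ 2)%:E +
  8%:E * \int[m]_x (t N x)%:E)%E); last first.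
  rewrite nintD//; [|exact: measurable_drift|exact: measurable_drift|by move=>
    x; exact: sqr_ge0|by move=> x; exact: sqr_ge0].
  apply: leeD => //.
  apply: (@le_trans _ _ (8%:E * (e / 8)%:E)%E).
    by apply: lee_wpmul2l.
  by rewrite -EFinM lee_fin; lra.
apply: nint_le2 => //.
- by apply: measurable_drift => //; exact: measurable_funM.
- by apply: measurable_funD; exact: measurable_drift.
- by move=> x; exact: sqr_ge0.
- by move=> x; apply: addr_ge0; exact: sqr_ge0.
move=> x.
have N0 : 0 <= N%:R :> R by [].
have hN : G x ^+ 2 <= N%:R + t N x.
  by rewrite /t; case: ifPn => h; rewrite ?addr0// lerDr.
have := H21 (tau k x); have := H21 x; have := t0 N x.
set g' := G (tau k x); set g := G x in hN *; set h' := H (tau k x);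
  set h := H x.
move: hN N0; set T := t N x; set n := N%:R => hN n0 T0 h1 h'1.
have hh : (h' - h) ^+ 2 <= 4 by have := sqr_ge0 (h' + h); nra.
have A : (h' * g' - h * g) ^+ 2 <= 2 * (h' * (g' - g)) ^+ 2 + 2 * ((h' - h) * g)
  ^+ 2.
  by have := sqr_ge0 (h' * (g' - g) - (h' - h) * g); nra.
have B : (h' * (g' - g)) ^+ 2 <= (g' - g) ^+ 2.
  by rewrite exprMn ler_piMl ?sqr_ge0.
have C : ((h' - h) * g) ^+ 2 <= n * (h' - h) ^+ 2 + 4 * T.
  rewrite exprMn; have := sqr_ge0 (h' - h).
  by nra.
have := sqr_ge0 (h' - h); have := sqr_ge0 (g' - g).
nra.
Qed.

(** Testing [B] against almost invariant functions, instead of asking that its indicator be one,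
    admits sets of infinite measure; the class can thus be closed under complement. *)
Definition multiplier (B : set X) :=
  measurable B /\
  forall G, almost_invariant G -> almost_invariant (fun x => \1_B x * G x).

Lemma eq_almost_invariant F G : F =1 G -> almost_invariant F ->
  almost_invariant G.
Proof. by move=> /funext ->. Qed.

Lemma multiplier0 : multiplier set0.
Proof.
split => // G aG; apply: eq_almost_invariant (almost_invariantZ mtau 0 aG).
by move=> x; rewrite indic0 !mul0r.
Qed.

Lemma multiplierC B : multiplier B -> multiplier (~` B).
Proof.
move=> [mB hB]; split; first exact: measurableC.
move=> G aG; apply: eq_almost_invariant (almost_invariantB mtau aG (hB _ aG)).
by move=> x; rewrite !indicE in_setC; case: (x \in B) => /=; ring.
Qed.

Lemma multiplierU A B : multiplier A -> multiplier B -> multiplier (A `|` B).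
Proof.
move=> [mA hA] [mB hB]; split; first exact: measurableU.
move=> G aG.
have := almost_invariantB mtau (almost_invariantD mtau (hA _ aG) (hB _ aG)) (hA
  _ (hB _ aG)).
apply: eq_almost_invariant => x; rewrite !indicE in_setU.
by case: (x \in A); case: (x \in B) => /=; ring.
Qed.

(** The finite unions are multipliers, and their products with [G] converge while staying dominated
    by [G]. *)
Lemma multiplier_bigcup (A : nat -> set X) : (forall i, multiplier (A i)) ->
  multiplier (\bigcup_i A i).
Proof.
move=> hA; have mA : measurable (\bigcup_i A i).
  by apply: bigcup_measurable => i _; case: (hA i).
split => // G aG.
have hN N : multiplier (\big[setU/set0]_(i < N) A i).
  elim: N => [|N IH]; first by rewrite big_ord0; exact: multiplier0.
  by rewrite big_ord_recr; exact: multiplierU.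
have [[mG _] _] := aG.
apply: (@almost_invariant_lim _ _ _ _ tau mtau tau_m _
  (fun N x => \1_(\big[setU/set0]_(i < N) A i) x * G x)).
- apply: (@square_integrable_le _ _ _ _ _ G 1) => //.
  + by apply: measurable_funM => //; exact: measurable_indic.
  + by case: aG.
  + by move=> x; rewrite exprMn; apply: ler_wpM2r;
      [exact: sqr_ge0|exact: sqr_indic_le1].
- by move=> N; have [_] := hN N; apply.
- move=> N x; rewrite !normrM ler_wpM2r// !indicE.
  by rewrite -!indicE !ger0_norm// indic_bigsetU_le.
- by move=> x; apply: cvgM; [exact: cvg_indic_bigsetU|exact: cvg_cst].
Qed.

(** The indicator of [a < Y] is the increasing limit of the ramps [h i]. Each ramp is a bounded
    Lipschitz function of one truncation of [Y], so its drift vanishes and [almost_invariantM]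
    applies. *)
Lemma multiplier_superlevel Y a : measurable_fun setT Y ->
  (forall L, 0 < L -> drift (fun x => clamp L (Y x)) k @[k --> \oo] --> 0%E) ->
  multiplier (Y @^-1` `]a, +oo[).
Proof.
move=> mY dY.
have mB : measurable (Y @^-1` `]a, +oo[).
  by rewrite -[X in measurable X]setTI; exact: mY.
split => // G aG.
have [[mG _] _] := aG.
pose h i y : R := Num.min 1 (Num.max 0 (i.+1%:R * (y - a))).
have h0 i y : 0 <= h i y by rewrite /h le_min ler01 le_max lexx.
have h1 i y : h i y <= 1 by rewrite /h ge_min lexx.
have mh i : measurable_fun setT (fun x => h i (Y x)).
  apply: measurable_minr => //; apply: measurable_maxr => //.
  by apply: measurable_funM => //; exact: measurable_funB.
apply: (@almost_invariant_lim _ _ _ _ tau mtau tau_m _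
  (fun i x => h i (Y x) * G x)).
- apply: (@square_integrable_le _ _ _ _ _ G 1) => //.
  + by apply: measurable_funM => //; exact: measurable_indic.
  + by case: aG.
  + by move=> x; rewrite exprMn; apply: ler_wpM2r;
      [exact: sqr_ge0|exact: sqr_indic_le1].
- move=> i; apply: almost_invariantM => //.
    by move=> x; rewrite ger0_norm.
  have L0 : 0 < `|a| + 1 by rewrite ltr_wpDl.
  apply: (@cvge0_le _ (i.+1%:R ^+ 2) _ (drift (fun x => clamp (`|a| + 1) (Y
    x)))) => //.
  + by move=> k; exact: drift_ge0.
  + by move=> k; exact: drift_ge0.
  + exact: dY.
  have mc : measurable_fun setT (fun x => clamp (`|a| + 1) (Y x)).
    exact: measurable_clamp.
  move=> k; rewrite -nintZ ?sqr_ge0//; last 2 first.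
    exact: measurable_drift.
    by move=> x; exact: sqr_ge0.
  apply: nint_le => //.
  + exact: measurable_drift.
  + by apply: measurable_funM => //; exact: measurable_drift.
  + by move=> x; exact: sqr_ge0.
  + move=> x; rewrite -exprMn -[leLHS]real_normK ?num_real//.
    rewrite -[leRHS]real_normK ?num_real// lerXn2r ?nnegrE//.
    rewrite normrM (ger0_norm (_ : 0 <= i.+1%:R :> R))//.
    by apply: ler_norm_ramp; rewrite ler1n.
- move=> i x; rewrite !normrM ler_wpM2r// indicE (ger0_norm (h0 _ _)).
  have [yx|yx] := boolP (x \in _); first by rewrite normr1.
  rewrite normr0 /h.
  move/negP : yx; rewrite inE /= in_itv/= andbT => /negP; rewrite -leNgt => yx.
  by rewrite ge_min ge_max lexx pmulr_rle0// subr_le0 yx orbT.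
- move=> x; apply: cvgM; last exact: cvg_cst.
  apply: (@cvg_trans _ (cst (\1_(Y @^-1` `]a, +oo[) x : R) @ \oo));
    last exact: cvg_cst.
  apply: near_eq_cvg.
  rewrite indicE; have [yx|yx] := boolP (x \in _).
    move: yx; rewrite inE /= in_itv/= andbT => yx.
    have ya : 0 < Y x - a by rewrite subr_gt0.
    near=> i; rewrite /cst /h min_l// le_max; apply/orP; right.
    rewrite -ler_pdivrMr// div1r (le_trans (ltW (truncnS_gt _)))// ler_nat.
    by near: i; exists (Num.truncn (Y x - a)^-1) => // j /=; rewrite ltnS.
  move/negP : yx; rewrite inE /= in_itv/= andbT => /negP; rewrite -leNgt => yx.
  apply: nearW => i; rewrite /cst /h.
  by rewrite max_l ?min_r// pmulr_rle0// subr_le0.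
Unshelve. all: by end_near. Qed.

(** When [m] is infinite the constant 1 cannot be multiplied by the indicator of [B]. The indicators
    of finite unions of the [D i] replace it, and the finite measure of [B] gives the domination in
    the limit. *)
Lemma almost_invariant_indic (B : set X) (D : nat -> set X) : multiplier B ->
  (m B < +oo)%E ->
  (forall i, multiplier (D i) /\ almost_invariant (\1_(D i) : X -> R)) ->
  m (B `\` \bigcup_i D i) = 0%E -> almost_invariant (\1_B : X -> R).
Proof.
move=> [mB hB] Boo hD BD0.
have mDi i : measurable (D i) by have [[]] := hD i.
have mD : measurable (\bigcup_i D i) by exact: bigcup_measurable.
have sqr1 A x : (\1_A x : R) ^+ 2 = \1_A x.
  by rewrite indicE; case: (_ \in A); rewrite ?expr1n ?expr0n.
have int1 A : measurable A -> (\int[m]_x ((\1_A x : R) ^+ 2)%:E = m A)%E.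
  by move=> mA; under eq_integral do rewrite sqr1;
    rewrite integral_indic// setIT.
have sqB A : measurable A -> A `<=` B -> square_integrable m (\1_A : X -> R).
  move=> mA AB; split; first exact: measurable_indic.
  by rewrite int1//; apply: le_lt_trans Boo; apply: le_measure; rewrite ?inE.
have hN N : multiplier (\big[setU/set0]_(i < N) D i) /\
    almost_invariant (\1_(\big[setU/set0]_(i < N) D i) : X -> R).
  elim: N => [|N [mIH aIH]].
    rewrite big_ord0; split; first exact: multiplier0.
    have [[_ _] a0] := hD 0%N.
    apply: eq_almost_invariant (almost_invariantZ mtau 0 a0) => x.
    by rewrite indic0 mul0r.
  have [mDN aDN] := hD N.
  rewrite big_ord_recr; split; first exact: multiplierU.
  have := almost_invariantB mtau (almost_invariantD mtau aIH aDN) (mIH.2 _ aDN).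
  apply: eq_almost_invariant => x; rewrite !indicE in_setU.
  by case: (x \in _); case: (x \in D N) => /=; ring.
have aBD : almost_invariant (\1_(B `&` \bigcup_i D i) : X -> R).
  apply: (@almost_invariant_lim _ _ _ _ tau mtau tau_m _
    (fun N x => \1_B x * \1_(\big[setU/set0]_(i < N) D i) x)).
  - by apply: sqB => //; exact: measurableI.
  - by move=> N; apply: hB; have [] := hN N.
  - move=> N x; rewrite indicI normrM [leRHS]normrM !ger0_norm//.
    by apply: ler_wpM2l => //; exact: indic_bigsetU_le.
  - move=> x; rewrite indicI.
    by apply: cvgM; [exact: cvg_cst|exact: cvg_indic_bigsetU].
apply: almost_invariant_closed => // [|e e0]; first exact: sqB.
(* The approximation is exact in [L^2(m)]: the two indicators differ on the null part of [B] outside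
   the [D i]. *)
exists (\1_(B `&` \bigcup_i D i)) => //.
rewrite (eq_integral (fun x => ((\1_(B `\` \bigcup_i D i) x : R) ^+ 2)%:E)).
  by rewrite int1 ?BD0 ?lee_fin ?ltW//; exact: measurableD.
move=> x _; rewrite !indicE in_setI in_setD.
by case: (x \in B); case: (x \in \bigcup_i D i); rewrite /= ?subrr ?subr0.
Qed.

End multiplier.

(** * Path spaces *)

Lemma invS_truncn_lt (R : archiRealFieldType) (y : R) : 0 < y ->
  (Num.truncn y^-1).+1%:R^-1 < y.
Proof.
move=> y0; rewrite -[ltRHS]invrK ltf_pV2 ?posrE ?invr_gt0//.
exact: truncnS_gt.
Qed.

Section paths.
Variable R : realType.
Implicit Types (x : paths R) (A : set (paths R)).

Definition translate (j : int) (x : paths R) : paths R := fun i => x (i + j).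

Lemma measurable_translate j : measurable_fun setT (translate j).
Proof. by apply: measurable_paths => i; exact: measurable_coordinate. Qed.

Lemma iter_shiftE N x : iter N path_shift x = translate N%:Z x.
Proof.
elim: N => [|N IH]; first by apply/funext => i; rewrite /translate addr0.
by rewrite iterS IH; apply/funext => i;
  rewrite /= /shift_fun /translate -addrA -intS.
Qed.

Lemma measurable_zero_path : measurable [set @zero_path R].
Proof.
rewrite (_ : [set _] = \bigcap_(i in [set: nat])
  (fun x : paths R => if unpickle i is Some j then x (j : int) else 0) @^-1`
    [set 0]).
  apply: bigcap_measurable => // i _.
  rewrite -[X in measurable X]setTI.
  case: unpickle => [j|]; last exact: measurable_cst.
  exact: measurable_coordinate.
apply/seteqP; split => [_ -> i _|x x0]; first by rewrite /=; case: unpickle.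
by apply/funext => j; have := x0 (pickle j) I; rewrite /= pickleK.
Qed.

Variable nu : {measure set (paths R) -> \bar R}.
Hypothesis nu_shift : shift_invariant nu.

Lemma iter_shift_invariant N A : measurable A ->
  pushforward nu (iter N path_shift) A = nu A.
Proof.
elim: N A => [|N IH] A mA; first by [].
rewrite -[RHS](nu_shift mA) -[RHS]IH//.
rewrite -[X in measurable X]setTI; apply: measurable_shift_fun => //.
Qed.

Lemma translate_invariant (j : int) A : measurable A ->
  pushforward nu (translate j) A = nu A.
Proof.
have nat_inv N B : measurable B -> pushforward nu (translate N%:Z) B = nu B.
  move=> mB; rewrite -(iter_shift_invariant N)//; congr (nu _).
  by apply/seteqP; split => x /=; rewrite iter_shiftE.
move=> mA; case: j => N; first exact: nat_inv.
have mB : measurable (translate (Negz N) @^-1` A).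
  by rewrite -[X in measurable X]setTI; exact: measurable_translate.
rewrite /pushforward -(nat_inv N.+1)//; congr (nu _).
apply/seteqP; split => x /=; rewrite (_ : translate _ _ = x)//;
  by apply/funext => i; rewrite /translate NegzE addrK.
Qed.

Lemma nint_translate (j : int) (F : paths R -> R) : measurable_fun setT F ->
  (forall x, 0 <= F x) ->
  (\int[nu]_x (F (translate j x))%:E = \int[nu]_x (F x)%:E)%E.
Proof.
move=> mF F0.
apply: (@nint_comp _ _ _ nu (fun=> translate j) _ _ 0%N) => //.
- by move=> _; exact: measurable_translate.
- by move=> _ A mA; exact: translate_invariant.
Qed.

Variable n : nat -> nat.
Let tau k : paths R -> paths R := translate (n k)%:Z.
Let mtau k : measurable_fun setT (tau k).
Proof. exact: measurable_translate. Qed.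
Let tau_nu k A : measurable A -> pushforward nu (tau k) A = nu A.
Proof. by move=> mA; exact: translate_invariant. Qed.

(** [translate j] preserves [nu] and commutes with [tau k]. What is assumed of coordinate 0 thus
    holds for every coordinate. *)
Lemma drift_translate (j : int) (F : paths R -> R) k : measurable_fun setT F ->
  drift nu tau (F \o translate j) k = drift nu tau F k.
Proof.
move=> mF; rewrite /drift -[RHS](nint_translate j); last 2 first.
- by apply: measurable_drift => //.
- by move=> x; exact: sqr_ge0.
apply: eq_integral => x _ /=.
have -> // : translate j (tau k x) = tau k (translate j x).
by apply/funext => i; rewrite /tau /translate addrAC.
Qed.

Hypothesis clamp_cvg0 : forall L, 0 < L ->
  drift nu tau (fun x => clamp L (x 0)) k @[k --> \oo] --> 0%E.

Lemma drift_clamp_coordinate (j : int) L : 0 < L ->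
  drift nu tau (fun x => clamp L (x j)) k @[k --> \oo] --> 0%E.
Proof.
move=> L0.
have -> : (fun x : paths R => clamp L (x j)) =
    (fun x : paths R => clamp L (x 0)) \o translate j.
  by apply/funext => x; rewrite /= /translate add0r.
rewrite (_ : drift _ _ _ = drift nu tau (fun x => clamp L (x 0))).
  exact: clamp_cvg0.
apply/funext => k; apply: drift_translate.
by apply: measurable_clamp; exact: measurable_coordinate.
Qed.

(** Multipliers form a sigma-algebra, so only generators have to be examined: first the coordinate
    sets, then, for a fixed coordinate, the rays that generate the Borel sets. *)
Lemma multiplier_measurable A : measurable A -> multiplier nu tau A.
Proof.
move: A; apply: smallest_sub.
  split.
  - exact: multiplier0.
  - by move=> A hA; rewrite setTD; exact: multiplierC.
  - exact: (multiplier_bigcup mtau tau_nu).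
move=> _ [j [B mB ->]].
pose C := [set B : set R | multiplier nu tau [set x | B (x j)]].
suff : (@ocitv R).-sigma.-measurable `<=` C by apply.
rewrite RGenOInfty.measurableE; apply: smallest_sub.
  split.
  - exact: multiplier0.
  - move=> D hD; rewrite setTD; exact: (multiplierC mtau hD).
  - move=> D hD.
    have := multiplier_bigcup mtau tau_nu hD; rewrite /C /=.
    by congr multiplier; apply/seteqP; split => x.
move=> _ [a ->].
apply: (@multiplier_superlevel _ _ _ _ tau mtau tau_nu (fun x => x j)).
  exact: measurable_coordinate.
by move=> L L0; exact: drift_clamp_coordinate.
Qed.

Hypothesis levy_nu : (\int[nu]_x (Num.min (x 0 ^+ 2) 1)%:E < +oo)%E.

Lemma clamp_sqr_le (L y : R) : 0 < L -> L <= 1 -> clamp L y ^+ 2 <= Num.min (y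
  ^+ 2) 1.
Proof.
move=> L0 L1; rewrite /clamp; case: (leP (- L) y) => y1.
  case: (leP L y) => y2; rewrite le_min; apply/andP; split; nra.
by rewrite min_r ?le_min; [apply/andP; split; nra|lra].
Qed.

(** The bound [L <= 1] makes the square of the truncation at most [min(x_j^2, 1)], whose integral is
    that of coordinate 0 by shift invariance. *)
Lemma almost_invariant_clamp j L : 0 < L -> L <= 1 ->
  almost_invariant nu tau (fun x => clamp L (x j)).
Proof.
move=> L0 L1; split; last exact: drift_clamp_coordinate.
have mj i : measurable_fun setT (fun x : paths R => x i).
  exact: measurable_coordinate.
have mm i : measurable_fun setT (fun x : paths R => Num.min (x i ^+ 2) 1).
  apply: measurable_minr => //; exact: measurable_funX.
split; first exact: measurable_clamp.
apply: le_lt_trans levy_nu.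
rewrite -(nint_translate j (mm 0)); last first.
  by move=> x; rewrite le_min sqr_ge0/=.
apply: nint_le => //.
- by apply: measurable_funX; exact: measurable_clamp.
- exact: (measurableT_comp (mm 0) (measurable_translate j)).
- by move=> x; exact: sqr_ge0.
- by move=> x; rewrite /translate add0r; exact: clamp_sqr_le.
Qed.

(** On this set the truncation of [x_j] at [1 / (M + 1)] is constant, equal to plus or minus that
    level. The indicator is therefore a multiple of its own product with an almost invariant
    function. *)
Lemma almost_invariant_indic_far j M (b : bool) :
  almost_invariant nu tau
    \1_[set x : paths R | M.+1%:R^-1 < (-1) ^+ b * x j].
Proof.
have M0 : 0 < M.+1%:R^-1 :> R by rewrite invr_gt0.
have M1 : M.+1%:R^-1 <= 1 :> R by rewrite invf_le1// ler1n.
have mD : measurable [set x : paths R | M.+1%:R^-1 < (-1) ^+ b * x j].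
  rewrite (_ : [set _ | _] =
      (fun x : paths R => (-1) ^+ b * x j) @^-1` `]M.+1%:R^-1, +oo[);
        last first.
    by apply/seteqP; split => x; rewrite /= in_itv/= andbT.
  rewrite -[X in measurable X]setTI.
  suff : measurable_fun setT (fun x : paths R => (-1) ^+ b * x j) by apply.
  by apply: measurable_funM => //; exact: measurable_coordinate.
have [_ h] := multiplier_measurable mD.
have := almost_invariantZ mtau ((-1) ^+ b * M.+1%:R) (h _
  (almost_invariant_clamp j M0 M1)).
apply: eq_almost_invariant => x.
rewrite indicE; have [|] := boolP (x \in _); last by rewrite mul0r mulr0.
rewrite inE /= mul1r => xj.
suff -> : clamp M.+1%:R^-1 (x j) = (-1) ^+ b * M.+1%:R^-1.
  by rewrite mulrACA -expr2 sqrr_sign mul1r divff// pnatr_eq0.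
case: b xj {mD h} => /=; rewrite ?expr1 ?expr0 ?mulN1r ?mul1r => xj.
  by apply: clamp_ltN.
exact: clamp_gt.
Qed.

Lemma almost_invariant_indic_paths B : nu [set @zero_path R] = 0%E ->
  measurable B -> (nu B < +oo)%E -> almost_invariant nu tau \1_B.
Proof.
move=> nu0 mB Boo.
(* A countable family indexed by coordinate, level and sign: each nonzero coordinate of a path
   exceeds some level with some sign, so only the zero path escapes. Invalid codes give the empty
   set. *)
pose D i := if unpickle i is Some (j, M, b)
  then [set x : paths R | M.+1%:R^-1 < (-1) ^+ (b : bool) * x (j : int)] else
    set0.
have aD i : multiplier nu tau (D i) /\ almost_invariant nu tau (\1_(D i)).
  rewrite /D; case: unpickle => [[[j M] b]|].
    have aF := almost_invariant_indic_far j M b.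
    split => //; apply: multiplier_measurable.
    (* The measurability of the set is read off that of its indicator, as the preimage of [{1}]. *)
    have [[+ _] _] := aF.
    move=> /(_ measurableT [set 1] (measurable_set1 _)).
    rewrite setTI; congr measurable; apply/seteqP; split => x /=.
      by rewrite indicE; case: (boolP (x \in _)) => [|_ /eqP];
        [rewrite inE|rewrite eq_sym oner_eq0].
    by move=> xD; rewrite indicE mem_set.
  split; first exact: multiplier0.
  have L1 : 0 < 1 :> R by [].
  apply: eq_almost_invariant
    (almost_invariantZ mtau 0 (almost_invariant_clamp 0 L1 (lexx _))) => x.
  by rewrite indic0 mul0r.
apply: (@almost_invariant_indic _ _ _ _ tau mtau tau_nu B D) => //.
  exact: multiplier_measurable.
have mBD : measurable (B `\` \bigcup_i D i).
  by apply: measurableD => //; apply: bigcup_measurable => i _;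
    have [[]] := aD i.
apply: (subset_measure0 mBD measurable_zero_path _ nu0) => x [_ xD].
apply/funext => j; rewrite /zero_path; apply: contrapT => /eqP xj0.
apply: xD; pose b := x j < 0.
have bx : 0 < (-1) ^+ b * x j.
  by rewrite /b; case: (ltP (x j) 0) => h; rewrite ?expr1 ?expr0 ?mulN1r ?mul1r;
    lra.
exists (pickle (j, Num.truncn ((-1) ^+ b * x j)^-1, b)); first exact: I.
rewrite /D pickleK; exact: invS_truncn_lt.
Qed.

End paths.

(** * Radon-Nikodym derivatives *)

Section RN_derivative.
Context d (X : measurableType d) (R : realType).
Local Open Scope ereal_scope.

(** The identity on sets extends to simple functions by linearity, then to [g] by monotone
    convergence on both sides. *)
Lemma integral_density (mu nu : {measure set X -> \bar R}) (w : X -> R)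
    (g : X -> \bar R) : is_RN_derivative nu mu w ->
  measurable_fun setT g -> (forall x, 0 <= g x) ->
  \int[nu]_x g x = \int[mu]_x ((w x)%:E * g x).
Proof.
move=> [mw w0 nuE] mg g0.
pose h := nnsfun_approx measurableT mg.
have hg x : (h n x)%:E @[n --> \oo] --> g x by exact: cvg_nnsfun_approx.
have ndh x a b : (a <= b)%N -> (h a x)%:E <= (h b x)%:E.
  by move=> ab; rewrite lee_fin; exact/lefP/nd_nnsfun_approx.
have mh n : measurable_fun setT (fun x => (h n x)%:E) by exact/measurable_EFinP.
have mwE : measurable_fun setT (fun x => (w x)%:E) by exact/measurable_EFinP.
transitivity (lim (\int[nu]_x (h n x)%:E @[n --> \oo])).
  rewrite -monotone_convergence//.
  - by apply: eq_integral => x _; apply/esym/cvg_lim => //; exact: hg.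
  - by move=> n x _; rewrite lee_fin.
  - by move=> x _ a b; exact: ndh.
transitivity (lim (\int[mu]_x ((w x)%:E * (h n x)%:E) @[n --> \oo]));
  last first.
  rewrite -monotone_convergence//.
  - apply: eq_integral => x _; apply/cvg_lim => //.
    by apply: cvgeZl; [|exact: hg].
  - by move=> n; exact: emeasurable_funM.
  - by move=> n x _; rewrite mule_ge0// lee_fin.
  - by move=> x _ a b ab; apply: lee_wpmul2l; [rewrite lee_fin|exact: ndh].
apply: (congr1 (fun u : nat -> \bar R => lim (u n @[n --> \oo]))).
apply/funext => n.
have fE x : (h n x)%:E =
    \sum_(y \in range (h n)) (y * \1_(h n @^-1` [set y]) x)%:E.
  by rewrite fsumEFin// -fimfunE.
under eq_integral do rewrite fE.
rewrite ge0_integral_fsum//; last 2 first.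
- by move=> y; apply/measurable_EFinP; apply: measurable_funM => //;
    exact: measurable_indic.
- by move=> y x _; exact: nnfun_muleindic_ge0.
under [in RHS]eq_integral => x _.
  rewrite fE ge0_mule_fsumr; last by move=> y; exact: nnfun_muleindic_ge0.
  over.
rewrite ge0_integral_fsum//; last 2 first.
- move=> y; apply: emeasurable_funM => //.
  by apply/measurable_EFinP; apply: measurable_funM => //;
    exact: measurable_indic.
- by move=> y x _; apply: mule_ge0;
    [rewrite lee_fin|exact: nnfun_muleindic_ge0].
apply: eq_fsbigr => y /[!inE] -[t _ <-].
have mA : measurable (h n @^-1` [set h n t]) by exact: measurable_sfunP.
under eq_integral do rewrite EFinM.
rewrite ge0_integralZl; first last.
- by rewrite lee_fin.
- by move=> x _; rewrite lee_fin.
- by apply/measurable_EFinP; exact: measurable_indic.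
- exact: measurableT.
rewrite integral_indic// setIT nuE//.
under [in RHS]eq_integral do rewrite EFinM muleCA.
rewrite ge0_integralZl; first last.
- by rewrite lee_fin.
- by move=> x _; rewrite mule_ge0// lee_fin.
- by apply: emeasurable_funM => //; apply/measurable_EFinP;
    exact: measurable_indic.
- exact: measurableT.
congr (_ * _); rewrite integral_mkcond; apply: eq_integral => x _.
by rewrite epatch_indic.
Qed.

(** On a set of finite [nu]-measure both densities are integrable, hence determined by their
    integrals; countably many such sets cover the space. *)
Lemma RN_derivative_unique (mu nu : {measure set X -> \bar R}) (w w' : X -> R) :
  sigma_finite setT nu -> is_RN_derivative nu mu w ->
  is_RN_derivative nu mu w' -> {ae mu, forall x, w x = w' x}.
Proof.
move=> [F FT /all_and2[mF Foo]] [mw w0 nuw] [mw' w'0 nuw'].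
have Fww' i : ae_eq mu (F i) (EFin \o w) (EFin \o w').
  apply: integral_ae_eq => //.
  - apply/integrableP; split; first exact/measurable_EFinP/measurable_funTS.
    under eq_integral do rewrite /= ger0_norm//.
    by rewrite -nuw.
  - exact/measurable_EFinP/measurable_funTS.
  - by move=> E _ mE; rewrite -nuw// nuw'.
have := ae_foralln Fww'; apply: filterS => x Fx.
have : (\bigcup_i F i) x by rewrite -FT.
by move=> [i _ /(Fx i)] [].
Qed.

(** The space is cut into disjoint pieces of finite [nu]-measure; the derivatives of the
    restrictions of [nu] are glued together. *)
Lemma RN_derivative_exists (mu : {sigma_finite_measure set X -> \bar R})
  (nu : {measure set X -> \bar R}) : sigma_finite setT nu -> nu `<< mu ->
  exists w, is_RN_derivative nu mu w.
Proof.
move=> [F FT /all_and2[mF Foo]] numu.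
pose E := seqDU F.
have mE k : measurable (E k).
  by apply: measurableD => //; exact: bigsetU_measurable.
have Eoo k : nu (E k) < +oo.
  by rewrite (le_lt_trans _ (Foo k))// le_measure ?inE//; exact: subDsetl.
have ET : \bigcup_i E i = [set: X] by rewrite FT [RHS]seqDU_bigcup_eq.
have tE := trivIset_seqDU F.
pose nu_ j : {finite_measure set X -> \bar R} := mfrestr (mE j) (Eoo j).
have nu_mu k : nu_ k `<< mu.
  apply/null_content_dominatesP => S mS muS0.
  move/null_content_dominatesP : numu => numu.
  apply/eqP; rewrite eq_le measure_ge0 andbT -(numu _ mS muS0).
  by apply: le_measure; rewrite ?inE//; exact: measurableI.
have [g] := choice (fun j => radon_nikodym_sigma_finite (nu_mu j)).
move=> /all_and4[g0 gfin ig gE].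
have mg k : measurable_fun setT (fine \o g k).
  by apply: measurableT_comp => //; exact: measurable_int (ig k).
(* The index of the piece containing [x]. The default 0 never occurs, as the pieces cover the
   space. *)
pose idx x := xget 0%N [set k | E k x].
have Eidx x : E (idx x) x.
  have : [set: X] x by [].
  by rewrite -ET => -[i _ Eix]; apply: (@xgetPex _ 0%N [set k | E k x]);
    exists i.
have idxE k x : E k x -> idx x = k.
  by move=> Ekx; apply: (tE _ _ I I); exists x; split; [exact: Eidx|exact: Ekx].
pose w x := fine (g (idx x) x).
have mw : measurable_fun setT w.
  move=> _ B mB; rewrite setTI.
  rewrite (_ : w @^-1` B = \bigcup_k (E k `&` (fine \o g k) @^-1` B)).
    apply: bigcup_measurable => k _; apply: measurableI => //.
    by rewrite -[X in measurable X]setTI; exact: mg.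
  apply/seteqP; split => [x wB|x [k _ [Ekx]]]; first by exists (idx x).
  by rewrite /= /w (idxE _ _ Ekx).
exists w; split => // [x|A mA]; first exact: fine_ge0.
rewrite -[A in RHS](setIT A) -ET setI_bigcupr ge0_integral_bigcup//;
  last 4 first.
- by move=> i; exact: measurableI.
- exact/measurable_EFinP/measurable_funTS.
- by move=> x _; rewrite lee_fin fine_ge0.
- exact: trivIset_setIl.
rewrite -[A in LHS](setIT A) -ET setI_bigcupr measure_bigcup//; last 2 first.
- by move=> i _; exact: measurableI.
- exact: trivIset_setIl.
transitivity (\sum_(i <oo) nu (A `&` E i)).
  by apply: eq_eseriesl => i; rewrite in_setT.
apply: eq_eseriesr => i _.
transitivity (nu_ i (A `&` E i)).
  by rewrite /nu_ /= /mfrestr /mrestr -setIA setIid.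
rewrite gE; last exact: measurableI.
apply: eq_integral => x /[!inE] -[_ Eix].
by rewrite /w (idxE _ _ Eix) fineK.
Qed.

End RN_derivative.

Lemma measurable_preimageT d1 d2 (X : measurableType d1) (Y : measurableType d2)
  (f : X -> Y) A : measurable_fun setT f -> measurable A ->
  measurable (f @^-1` A).
Proof. by move=> mf mA; rewrite -[X in measurable X]setTI; exact: mf. Qed.

Section RN_iter.
Context d (X : measurableType d) (R : realType).
Variable mu : {sigma_finite_measure set X -> \bar R}.
Variable T : bimeasurable X.
Hypothesis T_ns : nonsingular mu T.
Local Notation Ti := (bim_inv T).

Lemma measurable_iter (f : X -> X) N : measurable_fun setT f ->
  measurable_fun setT (iter N f).
Proof.
move=> mf; elim: N => [|N IH]; first exact: measurable_id.
exact: (measurableT_comp mf IH).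
Qed.

Let mT := measurable_bim_fun T.
Let mTi := measurable_bim_inv T.

Lemma iter_bim_funK N : cancel (iter N T) (iter N Ti).
Proof.
elim: N => // N IH x; rewrite iterSr iterS.
by rewrite (bim_funK T) IH.
Qed.

Lemma iter_bim_invK N : cancel (iter N Ti) (iter N T).
Proof.
elim: N => // N IH x; rewrite iterSr iterS.
by rewrite (bim_invK T) IH.
Qed.

Lemma nonsingular_null A : measurable A -> mu A = 0%E -> mu (T @^-1` A) = 0%E.
Proof.
move=> mA muA; have [h _] := T_ns.
have /h hA : mu.-null_set A.
  move=> B mB BA; apply/eqP; rewrite eq_le measure_ge0 andbT -muA.
  by apply: le_measure; rewrite ?inE.
exact: (hA _ mA).
Qed.

Lemma nonsingular_inv_null A : measurable A -> mu A = 0%E ->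
  mu (Ti @^-1` A) = 0%E.
Proof.
move=> mA muA; have [_ h] := T_ns.
have mB : measurable (Ti @^-1` A) by exact: measurable_preimageT.
have /h hB : (pushforward mu T).-null_set (Ti @^-1` A).
  move=> B mB' BA; rewrite /pushforward; apply/eqP;
    rewrite eq_le measure_ge0 andbT -muA.
  apply: le_measure; rewrite ?inE//.
    exact: measurable_preimageT.
  by move=> x /= /BA /=; rewrite (bim_funK T).
exact: (hB _ mB).
Qed.

Lemma sigma_finite_iter N : sigma_finite setT (pushforward mu (iter N Ti)).
Proof.
have [F FT /all_and2[mF Foo]] := sigma_finiteT mu.
exists (fun i => iter N T @^-1` F i).
  by rewrite -preimage_bigcup -FT preimage_setT.
move=> i; split; first by apply: measurable_preimageT => //;
  exact: measurable_iter.
suff E : iter N Ti @^-1` (iter N T @^-1` F i) = F i by rewrite /pushforward E;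
  exact: Foo.
by apply/seteqP; split => x /=; rewrite iter_bim_invK.
Qed.

(** Shows that the default value in [RN_derivative] is never taken: nonsingularity passes to the
    iterates, and the image measures stay sigma-finite because [T] is a bijection. *)
Lemma RN_iterP N :
  is_RN_derivative (pushforward mu (iter N Ti)) mu (RN_iter mu T N).
Proof.
have mI := measurable_iter N mTi.
suff [w hw] : exists w, is_RN_derivative (pushforward mu (iter N Ti)) mu w.
  by apply: (@xgetPex _ (cst 0) [set w | is_RN_derivative (pushforward mu (iter
    N Ti)) mu w]); exists w.
have iter_null A : measurable A -> mu A = 0%E -> mu (iter N Ti @^-1` A) = 0%E.
  elim: N {mI} A => [|N IH] A mA muA //.
  have mB := measurable_preimageT mTi mA.
  exact: (IH _ mB (nonsingular_inv_null mA muA)).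
apply: RN_derivative_exists => //; last first.
  by apply/null_content_dominatesP.
exact: sigma_finite_iter.
Qed.

(** The density [RN_iter mu T N] turns [mu] into its image under [T^-N], and integrating [g o T^N]
    against that image gives back the integral of [g]. *)
Lemma nint_RN_iter N (g : X -> R) : measurable_fun setT g ->
  (forall x, 0 <= g x) ->
  (\int[mu]_x (RN_iter mu T N x * g (iter N T x))%:E = \int[mu]_x (g x)%:E)%E.
Proof.
move=> mg g0; have mI := measurable_iter N mT;
  have mIi := measurable_iter N mTi.
under eq_integral do rewrite EFinM.
rewrite -(integral_density (RN_iterP N) (g := fun x => (g (iter N T x))%:E)).
- rewrite ge0_integral_pushforward//.
  + by apply: eq_integral => x _ /=; rewrite iter_bim_invK.
  + by apply/measurable_EFinP; exact: measurableT_comp.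
  + by move=> x _; rewrite lee_fin.
- by apply/measurable_EFinP; exact: measurableT_comp.
- by move=> x; rewrite lee_fin.
Qed.

Lemma RN_iter_ge0 N x : 0 <= RN_iter mu T N x.
Proof. by have [] := RN_iterP N. Qed.

Lemma measurable_RN_iter N : measurable_fun setT (RN_iter mu T N).
Proof. by have [] := RN_iterP N. Qed.

(** If [Z] is the zero set of the derivative, then [mu (T Z)] is the integral of 0 over [Z];
    nonsingularity carries this null set back to [Z]. *)
Lemma RN_iter_gt0 : {ae mu, forall x, 0 < RN_iter mu T 1 x}.
Proof.
pose Z := RN_iter mu T 1 @^-1` [set 0].
have mZ : measurable Z.
  apply: measurable_preimageT => //; exact: measurable_RN_iter.
have : mu (T @^-1` (Ti @^-1` Z)) = 0%E.
  apply: nonsingular_null; first exact: measurable_preimageT.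
  have [_ _ h] := RN_iterP 1; rewrite -[LHS]/(pushforward mu (iter 1 Ti) Z) h//.
  by apply: integral0_eq => x ->.
rewrite (_ : T @^-1` (Ti @^-1` Z) = Z); last first.
  by apply/seteqP; split => x; rewrite /= (bim_funK T).
move=> Z0; exists Z; split => // x /= /negP; rewrite -leNgt => w0.
by apply/eqP; rewrite eq_le w0 RN_iter_ge0.
Qed.

(** The chain rule. It holds only almost everywhere, each derivative being an arbitrarily chosen
    version; it follows from uniqueness, since the product is also a density. *)
Lemma RN_iterS N : {ae mu, forall x,
  RN_iter mu T N.+1 x = RN_iter mu T N x * RN_iter mu T 1 (iter N T x)}.
Proof.
have mIi := measurable_iter N.+1 mTi.
apply: (@RN_derivative_unique _ _ _ mu (pushforward mu (iter N.+1 Ti))).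
- exact: sigma_finite_iter.
- exact: RN_iterP.
split.
- apply: measurable_funM; first exact: measurable_RN_iter.
  by apply: (measurableT_comp (measurable_RN_iter 1)); exact: measurable_iter.
- by move=> x; rewrite mulr_ge0// RN_iter_ge0.
move=> A mA.
pose B := iter N Ti @^-1` A.
have mB : measurable B by apply: measurable_preimageT => //;
  exact: measurable_iter.
(* The indicator of [A] at [x] is that of [B] at [T^N x], so that all but the first factor is a
   function of [T^N x] and [nint_RN_iter] applies. *)
transitivity (\int[mu]_x (RN_iter mu T N x *
    (RN_iter mu T 1 (iter N T x) * \1_B (iter N T x)))%:E)%E.
  rewrite (nint_RN_iter N (g := fun x => RN_iter mu T 1 x * \1_B x)).
  - have [_ _ h] := RN_iterP 1.
    transitivity (pushforward mu (iter 1 Ti) B).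
      by congr (mu _); apply/seteqP; split => x; rewrite /B /= -iterSr.
    rewrite h// integral_mkcond.
    by apply: eq_integral => x _; rewrite epatch_indic EFinM.
  - apply: measurable_funM; first exact: measurable_RN_iter.
    exact: measurable_indic.
  - by move=> x; rewrite mulr_ge0// RN_iter_ge0.
rewrite [RHS]integral_mkcond; apply: eq_integral => x _.
rewrite epatch_indic mulrA EFinM; congr (_ * _%:E)%E.
rewrite !indicE; suff -> : (iter N T x \in B) = (x \in A) by [].
by apply/idP/idP; rewrite !inE /B /= iter_bim_funK.
Qed.

Lemma nint_sqr_koopman N (f : X -> R) : measurable_fun setT f ->
  (\int[mu]_x (koopman mu T N f x ^+ 2)%:E = \int[mu]_x (f x ^+ 2)%:E)%E.
Proof.
move=> mf; rewrite -(nint_RN_iter N (g := fun x => f x ^+ 2)).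
- by apply: eq_integral => x _; rewrite /koopman exprMn sqr_sqrtr// RN_iter_ge0.
- exact: measurable_funX.
- by move=> x; exact: sqr_ge0.
Qed.

Lemma measurable_koopman N (f : X -> R) : measurable_fun setT f ->
  measurable_fun setT (koopman mu T N f).
Proof.
move=> mf; apply: measurable_funM.
  apply: (@measurableT_comp _ _ _ _ _ _ (@Num.sqrt R)).
    by apply: continuous_measurable_fun; exact: sqrt_continuous.
  exact: measurable_RN_iter.
by apply: (measurableT_comp mf); exact: measurable_iter.
Qed.

End RN_iter.

(** * The Maharam extension *)

Section stable_measure.
Context {R : realType}.
Implicit Types (c : R) (A : set R).

Lemma measurable_scale c : measurable_fun setT (fun s : R => c * s).
Proof. exact: measurable_funM. Qed.

Lemma lebesgue_measure_scale c A : 0 < c -> measurable A ->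
  lebesgue_measure A =
  (c%:E * lebesgue_measure ((fun s => (c * s)%R) @^-1` A))%E.
Proof.
move=> c0 mA; have mc := measurable_scale c.
pose c' := NngNum (ltW c0).
have := @lebesgue_measure_unique R
  (mscale c' (pushforward lebesgue_measure ( *%R c : _ -> measurableTypeR R))).
rewrite /mscale /pushforward /= => -> // _ [[a b]] _ <- /=.
transitivity (c%:E * lebesgue_measure (( *%R c) @^-1` `]a, b]%classic))%E;
  last by [].
rewrite (_ : _ @^-1` _ = `]c^-1 * a, c^-1 * b]%classic); last first.
  apply/seteqP; split => x; rewrite /= !in_itv/=.
    by rewrite ltr_pdivrMl// ler_pdivlMl.
  by rewrite ltr_pdivrMl// ler_pdivlMl.
rewrite /= !lebesgue_measure_itv/= !lte_fin ltr_pM2l ?invr_gt0//.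
case: ifPn => _; last by rewrite mule0.
by rewrite -!EFinB -EFinM; congr (_%:E); field; rewrite gt_eqF.
Qed.

Lemma nint_lebesgue_scale c (f : R -> \bar R) : 0 < c ->
  measurable_fun setT f -> (forall s, (0 <= f s)%E) ->
  (\int[lebesgue_measure]_s f s =
   c%:E * \int[lebesgue_measure]_s f (c * s)%R)%E.
Proof.
move=> c0 mf f0; have mc := measurable_scale c.
pose c' := NngNum (ltW c0).
rewrite (@eq_measure_integral _ _ _ setT
    (mscale c' (pushforward lebesgue_measure ( *%R c : _ -> measurableTypeR
      R)))); last first.
  by move=> A mA _; exact: lebesgue_measure_scale.
rewrite ge0_integral_mscale//; congr (_ * _)%E.
by rewrite ge0_integral_pushforward.
Qed.

Variable alpha : R.
Hypothesis alpha_gt0 : 0 < alpha.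
Local Notation m := (stable_measure alpha).

(** The density satisfies [rho s = c^(1 + alpha) * rho (c s)], and the change of variable in
    Lebesgue measure divides by [c], leaving [c^alpha]. *)
Lemma stable_measure_scale c A : 0 < c -> measurable A ->
  (m ((fun s => (c * s)%R) @^-1` A) = (c `^ alpha)%:E * m A)%E.
Proof.
move=> c0 mA; have mc := measurable_scale c.
rewrite /stable_measure.
set rho := fun s : R => \1_(`]0, +oo[%classic) s * s `^ (- (1 + alpha)).
have mrho : measurable_fun setT rho.
  apply: measurable_funM; first exact: measurable_indic.
  exact: measurable_powR.
have rho0 s : 0 <= rho s by rewrite /rho mulr_ge0// powR_ge0.
have rhoE s : rho s = c `^ (1 + alpha) * rho (c * s).
  rewrite /rho !indicE; have -> : (c * s \in `]0, +oo[%classic) = (s \in `]0,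
    +oo[%classic).
    by apply/idP/idP; rewrite !inE /= !in_itv/= !andbT pmulr_rgt0.
  case: (boolP (s \in _)) => [|_]; last by rewrite !mul0r mulr0.
  rewrite inE /= in_itv/= andbT => s0; rewrite !mul1r.
  rewrite powRM ?ltW// mulrA -powRD ?subrr ?powRr0 ?mul1r//.
  by apply/implyP => _; rewrite gt_eqF.
have mF : measurable_fun setT (fun s => (rho s * \1_A s)%:E).
  apply/measurable_EFinP; apply: measurable_funM => //; exact: measurable_indic.
have F0 s : (0 <= (rho s * \1_A s)%:E)%E by rewrite lee_fin mulr_ge0.
transitivity (\int[lebesgue_measure]_s ((c `^ (1 + alpha))%:E *
    (rho (c * s) * \1_A (c * s))%:E))%E.
  rewrite integral_mkcond; apply: eq_integral => s _.
  by rewrite epatch_indic -[RHS]EFinM mulrA -rhoE -EFinM.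
rewrite ge0_integralZl//; last 2 first.
- exact: (measurableT_comp mF mc).
- by rewrite lee_fin powR_ge0.
rewrite [in RHS]integral_mkcond.
under [in RHS]eq_integral do rewrite epatch_indic -EFinM.
rewrite (nint_lebesgue_scale c0 mF F0) muleA -EFinM; congr (_%:E * _)%E.
by rewrite addrC powRD ?powRr1 ?ltW//; apply/implyP => _; rewrite gt_eqF.
Qed.

(** For [c = 0] both sides vanish, thanks to [h 0 = 0] on the left and [0 * +oo = 0] on the
    right. *)
Lemma nint_stable_scale c (h : R -> R) : 0 <= c -> measurable_fun setT h ->
  (forall s, 0 <= h s) -> h 0 = 0 ->
  (\int[m]_s (h (s * c))%:E = (c `^ alpha)%:E * \int[m]_s (h s)%:E)%E.
Proof.
move=> c0 mh h0 h00; have mc := measurable_scale c.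
have mhE : measurable_fun setT (EFin \o h) by exact/measurable_EFinP.
have hE0 s : (0 <= (EFin \o h) s)%E by rewrite lee_fin.
move: c0; rewrite le_eqVlt => /predU1P[<-|c0].
  rewrite powR0 ?gt_eqF// mul0e integral0_eq// => s _.
  by rewrite mulr0 h00.
pose c' := NngNum (powR_ge0 c alpha).
transitivity (\int[mscale c' m]_s (h s)%:E)%E; last first.
  by rewrite ge0_integral_mscale// => s _; rewrite lee_fin.
apply: etrans; last first.
  apply: (@eq_measure_integral _ _ _ setT _ (pushforward m (fun s : R => c *
    s))).
  by move=> A mA _; exact: stable_measure_scale.
rewrite ge0_integral_pushforward//; last by move=> s _; rewrite lee_fin.
by apply: eq_integral => s _; rewrite /= mulrC.
Qed.

Lemma stable_measure_gt0 : {ae m, forall s, 0 < s}.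
Proof.
exists `]-oo, 0]%classic; split => //.
  rewrite /stable_measure integral0_eq// => s /=; rewrite in_itv/= => s0.
  by rewrite indicE memNset ?mul0r//= in_itv/= andbT; apply/negP;
    rewrite -leNgt.
by move=> s /= /negP; rewrite -leNgt in_itv.
Qed.

(** For [a <= b] the difference [h (s b) - h (s a)] is nonnegative for every [s > 0], so the
    absolute value disappears and the scaling applies to each term. *)
Lemma nint_stable_dist (h : R -> R) (a b : R) : 0 <= a -> 0 <= b ->
  measurable_fun setT h -> (forall s, 0 <= h s) -> h 0 = 0 ->
  (forall s t : R, 0 <= s -> s <= t -> h s <= h t) ->
  (\int[m]_s (h s)%:E < +oo)%E ->
  (\int[m]_s `|h (s * a) - h (s * b)|%:E =
   `|a `^ alpha - b `^ alpha|%:E * \int[m]_s (h s)%:E)%E.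
Proof.
wlog ab : a b / a <= b => [H a0 b0 mh h0 h00 ndh hoo|a0 b0 mh h0 h00 ndh hoo].
  have [ab|/ltW ba] := leP a b; first exact: H.
  rewrite distrC -(H b a)//.
  by under eq_integral do rewrite distrC.
have mhM (u : R) : measurable_fun setT (fun s : R => h (s * u)).
  by apply: (measurableT_comp mh); exact: measurable_funM.
have hfin : (\int[m]_s (h s)%:E)%E \is a fin_num.
  by rewrite ge0_fin_numE// nint_ge0.
(* Written as a sum, so that the only subtraction of extended reals comes at the end, between finite
   quantities. *)
have : (\int[m]_s (h (s * b))%:E =
    \int[m]_s (h (s * a))%:E + \int[m]_s `|h (s * a) - h (s * b)|%:E)%E.
  rewrite -nintD//; last first.
    by apply: measurableT_comp => //; exact: measurable_funB.
  apply: ae_nint_eq => //.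
    apply: measurable_funD => //.
    by apply: measurableT_comp => //; exact: measurable_funB.
  apply: filterS stable_measure_gt0 => s s0.
  rewrite distrC ger0_norm ?subrKC// subr_ge0; apply: ndh.
    by rewrite mulr_ge0// ltW.
  by rewrite ler_wpM2l// ltW.
rewrite !nint_stable_scale// => E.
have nab : `|a `^ alpha - b `^ alpha| = b `^ alpha - a `^ alpha.
  rewrite distrC ger0_norm// subr_ge0; apply: ge0_ler_powR => //.
  exact: ltW.
rewrite nab EFinB muleBl ?fin_num_adde_defr// E.
by rewrite addeAC subee ?add0e// fin_numM.
Qed.

End stable_measure.

Lemma ae_preimage d1 d2 (X : measurableType d1) (Y : measurableType d2)
    (R : realType) (m1 : {measure set X -> \bar R})
    (m2 : {measure set Y -> \bar R}) (phi : X -> Y) (P : Y -> Prop) :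
  measurable_fun setT phi ->
  (forall A, measurable A -> m2 A = 0%E -> m1 (phi @^-1` A) = 0%E) ->
  {ae m2, forall y, P y} -> {ae m1, forall x, P (phi x)}.
Proof.
move=> mphi h [A [mA A0 PA]]; exists (phi @^-1` A); split.
- exact: measurable_preimageT.
- exact: h.
- by move=> x /= nP; exact: PA.
Qed.

Lemma measurable_fun_powR d (X : measurableType d) (R : realType) (p : R)
    (g : X -> R) : measurable_fun setT g ->
  measurable_fun setT (fun x => g x `^ p).
Proof. exact: (@measurableT_comp _ _ _ _ _ _ (@powR R ^~ p)). Qed.

Lemma measurable_fun_dist d (X : measurableType d) (R : realType)
    (f g : X -> R) : measurable_fun setT f -> measurable_fun setT g ->
  measurable_fun setT (fun x => `|f x - g x|).
Proof.
move=> mf mg; apply: (@measurableT_comp _ _ _ _ _ _ (@Num.norm R R)) => //.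
exact: measurable_funB.
Qed.

(** * Integrals over the product with the stable measure *)

Section product.
Context d (X : measurableType d) (R : realType) (alpha : R).
Hypothesis alpha_gt0 : 0 < alpha.
Variable mu : {sigma_finite_measure set X -> \bar R}.
Local Notation m := (stable_measure alpha).
Local Notation mum := (mu \x m)%E.

Lemma ae_product_fst (P : X -> Prop) :
  {ae mu, forall x, P x} -> {ae mum, forall z, P z.1}.
Proof.
apply: ae_preimage => // A mA A0.
rewrite (_ : fst @^-1` A = A `*` setT); last first.
  by apply/seteqP; split => z //=; case.
transitivity (mu A * m setT)%E; first exact: product_measure1E.
by rewrite A0 mul0e.
Qed.

Lemma ae_product_snd (P : R -> Prop) :
  {ae m, forall x, P x} -> {ae mum, forall z, P z.2}.
Proof.
apply: ae_preimage => // A mA A0.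
rewrite (_ : snd @^-1` A = setT `*` A); last first.
  by apply/seteqP; split => z //=; case.
transitivity (mu setT * m A)%E; first exact: product_measure1E.
by rewrite A0 mule0.
Qed.

Lemma measurable_scaled (h : R -> R) (a : X -> R) :
  measurable_fun setT h -> measurable_fun setT a ->
  measurable_fun setT (fun z : X * R => h (z.2 * a z.1)).
Proof.
move=> mh ma; apply: (measurableT_comp mh); apply: measurable_funM => //.
exact: (measurableT_comp ma).
Qed.

Lemma nint_product_dist (h : R -> R) (a b : X -> R) :
  measurable_fun setT a -> measurable_fun setT b ->
  (forall x, 0 <= a x) -> (forall x, 0 <= b x) ->
  measurable_fun setT h -> (forall s, 0 <= h s) -> h 0 = 0 ->
  (forall s t : R, 0 <= s -> s <= t -> h s <= h t) ->
  (\int[m]_s (h s)%:E < +oo)%E ->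
  (\int[mum]_z `|h (z.2 * a z.1) - h (z.2 * b z.1)|%:E =
   \int[mu]_x `|a x `^ alpha - b x `^ alpha|%:E * \int[m]_s (h s)%:E)%E.
Proof.
move=> ma mb a0 b0 mh h0 h00 ndh hoo.
rewrite fubini_tonelli1; last 2 first.
- apply/measurable_EFinP.
  exact: (measurable_fun_dist (measurable_scaled mh ma) (measurable_scaled mh
    mb)).
- by move=> z; rewrite lee_fin.
rewrite muleC -[X in (X * _)%E]fineK; last by rewrite ge0_fin_numE// nint_ge0.
rewrite -nintZ.
- apply: eq_integral => x _; rewrite /fubini_F /= nint_stable_dist//.
  by rewrite EFinM fineK 1?muleC// ge0_fin_numE// nint_ge0.
- by rewrite fine_ge0// nint_ge0.
- by apply: measurable_fun_dist; exact: measurable_fun_powR.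
- by [].
Qed.

(** Valid also when the integral of [h] is infinite, the case examined in
    [nint_stable_sqr_clip1]. *)
Lemma nint_product (h : R -> R) (a : X -> R) :
  measurable_fun setT a -> (forall x, 0 <= a x) ->
  measurable_fun setT h -> (forall s, 0 <= h s) -> h 0 = 0 ->
  (\int[mum]_z (h (z.2 * a z.1))%:E =
   \int[mu]_x (a x `^ alpha)%:E * \int[m]_s (h s)%:E)%E.
Proof.
move=> ma a0 mh h0 h00.
have mpow : measurable_fun setT (fun x => a x `^ alpha).
  exact: measurable_fun_powR.
rewrite fubini_tonelli1; last 2 first.
- by apply/measurable_EFinP; exact: (measurable_scaled mh ma).
- by move=> z; rewrite lee_fin.
rewrite -ge0_integralZr//; last 3 first.
- exact/measurable_EFinP.
- by move=> x _; rewrite lee_fin powR_ge0.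
- exact: nint_ge0.
by apply: eq_integral => x _; rewrite /fubini_F /= nint_stable_scale.
Qed.

End product.

(** * Iterates of the Maharam extension *)

Section maharam.
Context d (X : measurableType d) (R : realType) (alpha : R).
Hypothesis alpha_gt0 : 0 < alpha.
Variable mu : {sigma_finite_measure set X -> \bar R}.
Variable T : bimeasurable X.
Hypothesis T_ns : nonsingular mu T.
Local Notation m := (stable_measure alpha).
Local Notation mum := (mu \x m)%E.
Local Notation S := (maharam alpha mu T).

Lemma measurable_maharam : measurable_fun setT S.
Proof.
have mT := measurable_bim_fun T.
apply: measurable_fun_pair; first exact: (measurableT_comp mT).
apply: measurable_funM => //.
apply: measurable_fun_powR.
exact: (measurableT_comp (measurable_RN_iter T_ns 1)).
Qed.

(** Null sets are those with almost all sections null. The section of the preimage at [x] is a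
    rescaling, by an almost surely positive factor, of the section of [A] at [T x]. *)
Lemma maharam_null A : measurable A -> mum A = 0%E ->
  mum (S @^-1` A) = 0%E.
Proof.
move=> mA A0.
have mB := measurable_preimageT measurable_maharam mA.
have mx (B : set (X * R)) : measurable B -> measurable_fun setT (m \o xsection
  B).
  by move=> mB'; exact: (measurable_fun_xsection (stable_measure alpha) mB').
have abs (B : set (X * R)) : measurable B ->
    (\int[mu]_x `|(m \o xsection B) x| = mum B)%E.
  by move=> mB'; apply: eq_integral => x _; rewrite gee0_abs.
have sec0 : {ae mu, forall x, m (xsection A x) = 0%E}.
  have /ae_eq_integral_abs : (\int[mu]_x `|(m \o xsection A) x| = 0)%E by
    rewrite abs.
  by move=> /(_ measurableT (mx _ mA)); apply: filterS => x; apply.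
have secT0 : {ae mu, forall x, m (xsection A (T x)) = 0%E}.
  apply: ae_preimage sec0; first exact: measurable_bim_fun.
  by move=> B mB' B0; exact: nonsingular_null.
rewrite -abs//; apply/ae_eq_integral_abs => //; first exact: mx.
apply: filterS2 secT0 (RN_iter_gt0 T_ns) => x A0x w0 _ /=.
have c0 : 0 < RN_iter mu T 1 x `^ alpha^-1 by rewrite powR_gt0.
rewrite (_ : xsection (S @^-1` A) x =
    (fun s => RN_iter mu T 1 x `^ alpha^-1 * s) @^-1` xsection A (T x)).
  rewrite stable_measure_scale// ?A0x ?mule0//.
  exact: measurable_xsection.
by apply/seteqP; split => s; rewrite /= /xsection /= !inE /maharam /= mulrC.
Qed.

Lemma ae_iter_maharam N (P : X * R -> Prop) :
  {ae mum, forall z, P z} -> {ae mum, forall z, P (iter N S z)}.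
Proof.
elim: N P => // N IH P /IH hP.
have := ae_preimage measurable_maharam maharam_null hP.
by apply: filterS => z; rewrite iterSr.
Qed.

Lemma RN_iter0 : {ae mu, forall x, RN_iter mu T 0 x = 1}.
Proof.
apply: (@RN_derivative_unique _ _ _ mu mu).
- exact: sigma_finiteT.
- exact: (RN_iterP T_ns 0).
split => // A mA.
by rewrite integral_cst// mul1e.
Qed.

Lemma iter_maharamE N : {ae mum, forall z,
  iter N S z = (iter N T z.1, z.2 * RN_iter mu T N z.1 `^ alpha^-1)}.
Proof.
elim: N => [|N IH].
  have := ae_product_fst alpha RN_iter0; apply: filterS => -[x s] /= ->.
  by rewrite powR1 mulr1.
have := ae_product_fst alpha (RN_iterS T_ns N).
apply: filterS2 IH => -[x s] /= -> ->.
by rewrite /maharam /= powRM ?RN_iter_ge0// mulrA.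
Qed.

Lemma sqr_powR_half (y : R) : 0 <= y -> (y `^ (alpha / 2)) ^+ 2 = y `^ alpha.
Proof.
by move=> y0; rewrite -powR_mulrn ?powR_ge0// -powRrM divfK// pnatr_eq0.
Qed.

(** Along the orbit the coefficient of [s] is [a = w^(1/alpha) * (g o T^N)], with [w] the derivative
    of order [N]. The scaling raises it to the power [alpha], and [a^alpha = w * (g^alpha o T^N)] is
    the square of the Koopman image of [g^(alpha/2)]. *)
Lemma nint_maharam_dist N (h : R -> R) (g : X -> R) :
  measurable_fun setT g -> (forall x, 0 <= g x) ->
  measurable_fun setT h -> (forall s, 0 <= h s) -> h 0 = 0 ->
  (forall s t : R, 0 <= s -> s <= t -> h s <= h t) ->
  (\int[m]_s (h s)%:E < +oo)%E ->
  let u x := g x `^ (alpha / 2) in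
  (\int[mum]_z `|h ((iter N S z).2 * g (iter N S z).1) - h (z.2 * g z.1)|%:E =
   \int[mu]_x `|koopman mu T N u x ^+ 2 - u x ^+ 2|%:E * \int[m]_s (h s)%:E)%E.
Proof.
move=> mg g0 mh h0 h00 ndh hoo u.
have mI := measurable_iter N measurable_maharam.
have mTI := measurable_iter N (measurable_bim_fun T).
have mS : measurable_fun setT (fun z => h ((iter N S z).2 * g (iter N S z).1)).
  exact: (measurableT_comp (measurable_scaled mh mg) mI).
pose a x := RN_iter mu T N x `^ alpha^-1 * g (iter N T x).
have ma : measurable_fun setT a.
  apply: measurable_funM; last exact: (measurableT_comp mg).
  by apply: measurable_fun_powR; exact: measurable_RN_iter.
have a0 x : 0 <= a x by rewrite mulr_ge0// powR_ge0.
transitivity (\int[mum]_z `|h (z.2 * a z.1) - h (z.2 * g z.1)|%:E)%E.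
  apply: ae_nint_eq.
  - exact: (measurable_fun_dist mS (measurable_scaled mh mg)).
  - exact: (measurable_fun_dist (measurable_scaled mh ma) (measurable_scaled mh
      mg)).
  - by apply: filterS (iter_maharamE N) => z ->; rewrite /a /= mulrA.
rewrite (nint_product_dist alpha_gt0 mu ma mg a0 g0 mh h0 h00 ndh hoo);
  congr (_ * _)%E; apply: eq_integral => x _.
rewrite /a powRM ?powR_ge0// -powRrM mulVf ?gt_eqF// powRr1 ?RN_iter_ge0//.
by rewrite /koopman exprMn sqr_sqrtr ?RN_iter_ge0// /u !sqr_powR_half.
Qed.

End maharam.

(** * Weak and strong convergence in L^2 *)

Section square_integrable.
Context d (X : measurableType d) (R : realType) (m : {measure set X -> \bar R}).
Implicit Types f g : X -> R.

Lemma nint_powR_lty f (p : R) : 0 < p -> f \in Lfun m p%:E ->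
  (\int[m]_x (`|f x| `^ p)%:E < +oo)%E.
Proof.
move=> p0 /andP[_ /[!inE] /=].
rewrite /finite_norm => foo.
rewrite (eq_integral (fun x => `|(EFin \o f) x| `^ p)%E)//.
rewrite -poweR_Lnorm ?gt_eqF//.
exact: poweR_lty.
Qed.

Lemma Lfun2P f : f \in Lfun m 2%:E <-> square_integrable m f.
Proof.
split=> [f2|[mf f2]].
  have mf : measurable_fun setT f.
    by move: f2 => /andP[/[!inE]].
  split => //; have := nint_powR_lty (ltr0n R 2) f2.
  congr (_ < _)%E; apply: eq_integral => x _.
  by rewrite powR_mulrn// real_normK// num_real.
apply/andP; split; first by rewrite inE.
rewrite inE /= /finite_norm unlock.
apply: poweR_lty.
rewrite (eq_integral (fun x => (f x ^+ 2)%:E))// => x _.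
by rewrite /= powR_mulrn// real_normK// num_real.
Qed.

Lemma square_integrable_mul f g : square_integrable m f ->
  square_integrable m g -> m.-integrable setT (fun x => (f x * g x)%:E).
Proof.
move=> [mf f2] [mg g2]; apply/integrableP.
have mfg : measurable_fun setT (fun x => f x * g x) by exact: measurable_funM.
split; first exact/measurable_EFinP.
apply: (@le_lt_trans _ _ (1%:E * \int[m]_x (f x ^+ 2)%:E +
    1%:E * \int[m]_x (g x ^+ 2)%:E)%E); last first.
  by rewrite !mul1e; exact: lte_add_pinfty.
apply: (@nint_le2 _ _ _ _ (fun x => `|f x * g x|)) => //.
- by apply: measurableT_comp.
- exact: measurable_sqr.
- exact: measurable_sqr.
- by move=> x; exact: sqr_ge0.
- by move=> x; exact: sqr_ge0.
- move=> x; rewrite !mul1r normrM -(real_normK (num_real (f x))).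
  rewrite -(real_normK (num_real (g x))).
  by have := sqr_ge0 (`|f x| - `|g x|); have := normr_ge0 (f x);
    have := normr_ge0 (g x); nra.
Qed.

Lemma Rintegral_sqr f : square_integrable m f ->
  (\int[m]_x (f x ^+ 2)%:E = (\int[m]_x (f x ^+ 2))%:E)%E.
Proof.
move=> [mf f2]; rewrite /Rintegral fineK// ge0_fin_numE// nint_ge0//.
by move=> x; exact: sqr_ge0.
Qed.

Lemma nint_sqr_dist f g : square_integrable m f -> square_integrable m g ->
  (\int[m]_x ((f x - g x) ^+ 2)%:E =
   (\int[m]_x (f x ^+ 2) + \int[m]_x (g x ^+ 2) - 2 * \int[m]_x (f x * g
     x))%R%:E)%E.
Proof.
move=> f2 g2; have [[mf _] [mg _]] := (f2, g2).
have if2 : m.-integrable setT (EFin \o (fun x => f x ^+ 2)).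
  by under eq_fun do rewrite expr2; exact: square_integrable_mul.
have ig2 : m.-integrable setT (EFin \o (fun x => g x ^+ 2)).
  by under eq_fun do rewrite expr2; exact: square_integrable_mul.
have ifg : m.-integrable setT (EFin \o (fun x => f x * g x)).
  exact: square_integrable_mul.
have i2fg : m.-integrable setT (EFin \o (fun x => 2 * (f x * g x))).
  exact: (integrableZl _ 2 ifg).
have is2 : m.-integrable setT (EFin \o (fun x => f x ^+ 2 + g x ^+ 2)).
  exact: (integrableD _ if2 ig2).
rewrite -RintegralZl// -RintegralD// -RintegralB// /Rintegral fineK.
  by apply: eq_integral => x _; congr (_%:E); ring.
by apply: integrable_fin_num => //; exact: (integrableB _ is2 i2fg).
Qed.

(** Strong convergence implies weak convergence. Cauchy-Schwarz is used in the weighted form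
    [a b <= a^2 / (2 c) + c b^2 / 2]. *)
Lemma cvg_Rintegral_mul (F : nat -> X -> R) f g :
  (forall k, square_integrable m (F k)) -> square_integrable m f ->
  square_integrable m g ->
  (\int[m]_x ((F k x - f x) ^+ 2)%:E @[k --> \oo] --> 0)%E ->
  \int[m]_x (F k x * g x) @[k --> \oo] --> \int[m]_x (f x * g x).
Proof.
move=> F2 f2 g2.
have Ff0 k : (0 <= \int[m]_x ((F k x - f x) ^+ 2)%:E)%E.
  by apply: nint_ge0 => x; exact: sqr_ge0.
move=> /(cvge0P Ff0) Ff.
have mFf k : measurable_fun setT (fun x => (F k x - f x) ^+ 2).
  apply: measurable_sqr; apply: measurable_funB; first by have [] := F2 k.
  by have [] := f2.
have [mg g2oo] := g2.
apply/cvgrPdist_le => e e0.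
pose G := \int[m]_x (g x ^+ 2).
have G0 : 0 <= G by apply: Rintegral_ge0 => x _; exact: sqr_ge0.
(* With this weight the term in [g^2] is at most [e / 2], and squared distances below [e * c] make
   the other one at most [e / 2]; the [+ 1] covers [G = 0]. *)
pose c := e / (G + 1).
have c0 : 0 < c by rewrite divr_gt0// ltr_wpDl.
have ec0 : 0 < e * c by rewrite mulr_gt0.
have ic0 : 0 <= (2 * c)^-1 by rewrite invr_ge0 mulr_ge0// ltW.
apply: filterS (Ff _ ec0) => k Fk.
have ifg := square_integrable_mul f2 g2.
have iFg := square_integrable_mul (F2 k) g2.
rewrite -RintegralB//.
apply: (le_trans (le_normr_Rintegral _ _)) => //;
  first exact: (integrableB _ ifg iFg).
have mD : measurable_fun setT (fun x => f x * g x - F k x * g x).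
  apply: measurable_funB; apply: measurable_funM => //; first by have [] := f2.
  by have [] := F2 k.
rewrite -lee_fin /Rintegral fineK; last first.
  apply: integrable_fin_num => //; apply: integrable_norm.
  exact: (integrableB _ ifg iFg).
apply: (@le_trans _ _ ((2 * c)^-1%:E * \int[m]_x ((F k x - f x) ^+ 2)%:E +
    (c / 2)%:E * \int[m]_x (g x ^+ 2)%:E)%E).
  apply: nint_le2 => //.
  - by rewrite divr_ge0// ltW.
  - exact: measurableT_comp.
  - exact: measurable_sqr.
  - by move=> x; exact: sqr_ge0.
  - by move=> x; exact: sqr_ge0.
  move=> x; rewrite -mulrBl normrM distrC.
  set a := `|_|; set b := `|_|.
  rewrite -(real_normK (num_real (F k x - f x))) -(real_normK (num_real (g x)))
    -/a -/b.
  rewrite -subr_ge0.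
  have -> : (2 * c)^-1 * a ^+ 2 + c / 2 * b ^+ 2 - a * b = (2 * c)^-1 * (a - c *
    b) ^+ 2.
    by field; rewrite gt_eqF.
  by rewrite mulr_ge0 ?sqr_ge0.
rewrite (Rintegral_sqr g2) -/G.
apply: (@le_trans _ _ ((2 * c)^-1%:E * (e * c)%:E + (c / 2)%:E * G%:E)%E).
  by apply: leeD => //; exact: lee_wpmul2l.
rewrite -!EFinM -EFinD lee_fin.
have -> : (2 * c)^-1 * (e * c) = e / 2 by field; rewrite gt_eqF.
have : c * G <= e.
  by rewrite /c mulrAC ler_pdivrMr ?ltr_wpDl// ler_wpM2l ?ltW// ltrDl.
lra.
Qed.

End square_integrable.

Lemma cvg_EFin0 (R : realType) (u : nat -> R) : u k @[k --> \oo] --> (0 : R) ->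
  (u k)%:E @[k --> \oo] --> 0%E.
Proof. by move=> u0; apply/fine_cvgP; split => //; exact: nearW. Qed.

(** * Rigidity as strong convergence of the Koopman operators *)

Section koopman.
Context d (X : measurableType d) (R : realType).
Variable mu : {sigma_finite_measure set X -> \bar R}.
Variable T : bimeasurable X.
Hypothesis T_ns : nonsingular mu T.
Variable n : nat -> nat.
Implicit Types u : X -> R.

Lemma square_integrable_koopman N u : square_integrable mu u ->
  square_integrable mu (koopman mu T N u).
Proof.
by move=> [m_u u2]; split; [exact: measurable_koopman|rewrite nint_sqr_koopman].
Qed.

(** The operators are isometric, so the squared distance is [2 <u, u> - 2 <U u, u>]; weak
    convergence to the identity makes it vanish. *)
Lemma rigid_strong u : rigid mu T n -> square_integrable mu u ->
  (\int[mu]_x ((koopman mu T (n k) u x - u x) ^+ 2)%:E @[k --> \oo] --> 0)%E.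
Proof.
move=> rT u2; have [m_u _] := u2.
have uL := (Lfun2P mu u).2 u2.
pose I := \int[mu]_x (u x * u x).
rewrite (_ : (fun _ => _) = fun k =>
    ((2 * I - 2 * \int[mu]_x (koopman mu T (n k) u x * u x))%R%:E)).
  apply: cvg_EFin0; rewrite -[X in _ --> X](subrr (2 * I)).
  apply: cvgB; first exact: cvg_cst.
  by apply: cvgM; [exact: cvg_cst|exact: rT].
apply/funext => k; rewrite nint_sqr_dist//; last first.
  exact: square_integrable_koopman.
congr (_%:E); congr (_ - _).
have -> : \int[mu]_x (koopman mu T (n k) u x ^+ 2) = \int[mu]_x (u x ^+ 2).
  by congr fine; exact: nint_sqr_koopman.
by rewrite /I mulr_natl mulr2n; congr (_ + _); apply: eq_Rintegral => x _;
  rewrite expr2.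
Qed.

(** For nonnegative reals [|a - b| <= a + b], hence [(a - b)^2 <= |a^2 - b^2|]. *)
Lemma nint_sqr_koopman_dist N u : square_integrable mu u ->
  (forall x, 0 <= u x) ->
  (\int[mu]_x ((koopman mu T N u x - u x) ^+ 2)%:E <=
   \int[mu]_x `|koopman mu T N u x ^+ 2 - u x ^+ 2|%:E)%E.
Proof.
move=> u2 u0; have [m_u _] := u2.
have mK := measurable_koopman T_ns N m_u.
apply: nint_le.
- by apply: measurable_sqr; exact: measurable_funB.
- by apply: measurable_fun_dist; exact: measurable_sqr.
- by move=> x; exact: sqr_ge0.
move=> x; have : 0 <= koopman mu T N u x by rewrite mulr_ge0// sqrtr_ge0.
move: (koopman _ _ _ _ _) (u x) (u0 x) => a b b0 a0.
rewrite subr_sqr normrM (ger0_norm (addr_ge0 a0 b0)) -real_normK ?num_real//.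
rewrite expr2 ler_wpM2l// ler_norml; apply/andP; split; lra.
Qed.

(** From [|a^2 - b^2| = |a - b| |a + b|] and a weighted Cauchy-Schwarz inequality, the factor
    [a + b] being bounded in [L^2(mu)] by the isometry. *)
Lemma rigid_strong_sqr u : rigid mu T n -> square_integrable mu u ->
  (\int[mu]_x `|koopman mu T (n k) u x ^+ 2 - u x ^+ 2|%:E @[k --> \oo] -->
    0)%E.
Proof.
move=> rT u2; have [m_u u2oo] := u2.
have mK k := measurable_koopman T_ns (n k) m_u.
have mKu k : measurable_fun setT (fun x => (koopman mu T (n k) u x - u x) ^+ 2).
  by apply: measurable_sqr; exact: measurable_funB.
have Ku0 k : (0 <= \int[mu]_x ((koopman mu T (n k) u x - u x) ^+ 2)%:E)%E.
  by apply: nint_ge0 => x; exact: sqr_ge0.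
apply: cvge0_approx => [k|e e0]; first exact: nint_ge0.
pose I := \int[mu]_x (u x ^+ 2).
have I0 : 0 <= I by apply: Rintegral_ge0 => x _; exact: sqr_ge0.
(* The squares of [U u] and [u] integrate to [2 I] together, and [c * (2 I) <= e]. *)
pose c := e / (2 * (I + 1)).
have c0 : 0 < c by rewrite divr_gt0// mulr_gt0// ltr_wpDl.
have ic0 : 0 <= (2 * c)^-1 by rewrite invr_ge0 mulr_ge0// ltW.
exists (2 * c)^-1, (fun k => \int[mu]_x ((koopman mu T (n k) u x - u x) ^+
  2)%:E)%E.
split => //; first exact: rigid_strong.
move=> k.
apply: (@le_trans _ _ ((2 * c)^-1%:E * \int[mu]_x ((koopman mu T (n k) u x - u
  x) ^+ 2)%:E
  + c%:E * \int[mu]_x (koopman mu T (n k) u x ^+ 2 + u x ^+ 2)%:E)%E).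
  apply: nint_le2 => //.
  - exact: ltW.
  - by apply: measurable_fun_dist; exact: measurable_sqr.
  - by apply: measurable_funD; exact: measurable_sqr.
  - by move=> x; exact: sqr_ge0.
  - by move=> x; apply: addr_ge0; exact: sqr_ge0.
  move=> x; move: (koopman _ _ _ _ _) (u x) => a b.
  rewrite subr_sqr normrM.
  have -> : (a - b) ^+ 2 = `|a - b| ^+ 2 by rewrite real_normK ?num_real.
  have h : `|a + b| ^+ 2 <= 2 * (a ^+ 2 + b ^+ 2).
    by rewrite real_normK ?num_real//; have := sqr_ge0 (a - b); nra.
  move: `|_ - _| `|_ + _| h => p q h.
  apply: (@le_trans _ _ ((2 * c)^-1 * p ^+ 2 + c / 2 * q ^+ 2)); last first.
    by rewrite lerD2l; nra.
  rewrite -subr_ge0.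
  have -> : (2 * c)^-1 * p ^+ 2 + c / 2 * q ^+ 2 - p * q = (2 * c)^-1 * (p - c *
    q) ^+ 2.
    by field; rewrite gt_eqF.
  by rewrite mulr_ge0 ?sqr_ge0.
rewrite nintD//; [|exact: measurable_sqr|exact: measurable_sqr|by move=> x;
  exact: sqr_ge0|by move=> x; exact: sqr_ge0].
rewrite nint_sqr_koopman// (Rintegral_sqr u2) -/I leeD2l// -EFinD -EFinM
  lee_fin.
rewrite /c mulrAC ler_pdivrMr ?mulr_gt0 ?ltr_wpDl// ler_wpM2l ?(ltW e0)//.
lra.
Qed.

(** Positive and negative parts reduce the matter to [u >= 0], the only functions that the Maharam
    identity reaches. *)
Lemma strong_rigid :
  (forall u, square_integrable mu u -> (forall x, 0 <= u x) ->
    (\int[mu]_x ((koopman mu T (n k) u x - u x) ^+ 2)%:E @[k --> \oo] --> 0)%E)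
      ->
  rigid mu T n.
Proof.
move=> H f g /Lfun2P f2 /Lfun2P g2.
apply: (@cvg_Rintegral_mul _ _ _ mu (fun k => koopman mu T (n k) f)) => //.
  by move=> k; exact: square_integrable_koopman.
have [mf _] := f2.
pose fp x := Num.max (f x) 0; pose fm x := Num.max (- f x) 0.
have fE x : f x = fp x - fm x.
  by rewrite /fp /fm; case: (leP (f x) 0) => h; case: (leP (- f x) 0) => h';
    lra.
have fp2 : square_integrable mu fp.
  apply: (@square_integrable_le _ _ _ _ _ f 1) => //.
    exact: measurable_maxr.
  move=> x; rewrite /fp mul1r; case: (leP (f x) 0) => // _.
  by rewrite expr0n sqr_ge0.
have fm2 : square_integrable mu fm.
  apply: (@square_integrable_le _ _ _ _ _ f 1) => //.
    by apply: measurable_maxr => //; exact: measurable_funN.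
  move=> x; rewrite /fm mul1r; case: (leP (- f x) 0) => // _.
    by rewrite expr0n sqr_ge0.
  by rewrite sqrrN.
have mK u k : square_integrable mu u ->
    measurable_fun setT (fun x => (koopman mu T (n k) u x - u x) ^+ 2).
  move=> [m_u _]; apply: measurable_sqr; apply: measurable_funB => //.
  exact: measurable_koopman.
have hp : forall x, 0 <= fp x by move=> x; rewrite /fp le_max lexx orbT.
have hm : forall x, 0 <= fm x by move=> x; rewrite /fm le_max lexx orbT.
have s0 u k : (0 <= \int[mu]_x ((koopman mu T (n k) u x - u x) ^+ 2)%:E)%E.
  by apply: nint_ge0 => x; exact: sqr_ge0.
apply: (@cvge0_le _ 2 _ (fun k =>
   \int[mu]_x ((koopman mu T (n k) fp x - fp x) ^+ 2)%:E +
   \int[mu]_x ((koopman mu T (n k) fm x - fm x) ^+ 2)%:E)%E) => //.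
- by move=> k; exact: adde_ge0.
- by rewrite -[0%E]adde0; apply: cvgeD => //; exact: H.
move=> k; rewrite ge0_muleDr//.
apply: nint_le2 => //; try by move=> x; exact: sqr_ge0.
- exact: mK.
- exact: mK.
- exact: mK.
move=> x; rewrite /koopman !fE mulrBr.
move: (_ * fp _) (_ * fm _) (fp x) (fm x) => a b a' b'.
by have := sqr_ge0 ((a - a') + (b - b')); nra.
Qed.

End koopman.

(** * Rigidity of the Levy measure system *)

Section sqr_clip.
Variable R : realType.
Implicit Types (L s t x y : R).

(** A profile [h] for [nint_maharam_dist]. For [L = 1] and [x >= 0] it is [min(x^2, 1)], which links
    it to the integrability condition on [Q]. *)
Definition sqr_clip L x : R := Num.min L (Num.max 0 x) ^+ 2.

Lemma sqr_clip_ge0 L x : 0 <= sqr_clip L x.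
Proof. exact: sqr_ge0. Qed.

Lemma sqr_clip0 L : 0 < L -> sqr_clip L 0 = 0.
Proof. by move=> L0; rewrite /sqr_clip maxxx min_r ?expr0n// ltW. Qed.

Lemma measurable_sqr_clip L : measurable_fun setT (sqr_clip L).
Proof.
by apply: measurable_sqr; apply: measurable_minr => //; exact: measurable_maxr.
Qed.

Lemma sqr_clip_nondecreasing L s t : 0 < L -> 0 <= s -> s <= t ->
  sqr_clip L s <= sqr_clip L t.
Proof.
move=> L0 s0 st; have t0 := le_trans s0 st.
rewrite /sqr_clip !max_r//.
by case: (leP L s) => h; case: (leP L t) => h'; nra.
Qed.

Lemma sqr_clip_le L s : 0 < L -> sqr_clip L s <= (1 + L ^+ 2) * sqr_clip 1 s.
Proof.
move=> L0; rewrite /sqr_clip; case: (leP 0 s) => h.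
  by case: (leP L s) => h1; case: (leP 1 s) => h2; nra.
by rewrite !min_r ?expr0n ?mulr0// ltW.
Qed.

Lemma sqr_clip_scale L s y : 0 <= s ->
  sqr_clip L (s * Num.max y 0) = sqr_clip L (s * y).
Proof.
by move=> s0; rewrite /sqr_clip maxr_pMr// mulr0 [Num.max _ 0]maxC maxA maxxx.
Qed.

(** With [p t = min L (max 0 t)], the truncation is [p t - p (- t)], and
    [(p t - p u)^2 <= |p t ^ 2 - p u ^ 2|] because [p >= 0]. *)
Lemma sqr_clamp_dist L x y : 0 < L -> (clamp L x - clamp L y) ^+ 2 <=
  2 * `|sqr_clip L x - sqr_clip L y| + 2 * `|sqr_clip L (- x) - sqr_clip L (-
    y)|.
Proof.
move=> L0; pose p t : R := Num.min L (Num.max 0 t).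
have p0 t : 0 <= p t by rewrite /p le_min (ltW L0) le_max lexx.
have clampE t : clamp L t = p t - p (- t).
  rewrite /clamp /p; case: (leP 0 t) => h.
    rewrite max_r; last lra.
    by rewrite [Num.max 0 (- t)]max_l ?[Num.min L 0]min_r ?subr0//; lra.
  rewrite [Num.min L 0]min_r ?ltW// sub0r [Num.max 0 (- t)]max_r; last lra.
  by case: (leP (- L) t) => h1; case: (leP L (- t)) => h2; rewrite ?min_r; lra.
have pp t u : (p t - p u) ^+ 2 <= `|p t ^+ 2 - p u ^+ 2|.
  rewrite subr_sqr normrM -real_normK ?num_real// expr2 ler_wpM2l//.
  by rewrite [leRHS]ger0_norm ?addr_ge0// ler_norml; have := p0 t; have := p0 u;
    lra.
rewrite !clampE /sqr_clip -!/(p _).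
have := pp x y; have := pp (- x) (- y).
by have := sqr_ge0 ((p x - p y) + (p (- x) - p (- y))); nra.
Qed.

End sqr_clip.

(** * Transfer between the associated system and the Levy measure *)

Section associated.
Context d (X : measurableType d) (R : realType) (alpha : R).
Hypothesis alpha_gt0 : 0 < alpha.
Variable mu : {sigma_finite_measure set X -> \bar R}.
Variable T : bimeasurable X.
Hypothesis T_ns : nonsingular mu T.
Variable Q : {sigma_finite_measure set (paths R) -> \bar R}.
Hypothesis Q_shift : shift_invariant Q.
Hypothesis Q_zero : Q [set @zero_path R] = 0%E.
Hypothesis Q_levy : (\int[Q]_x (Num.min ((x : paths R) 0 ^+ 2) 1)%:E < +oo)%E.
Hypothesis Q_neq0 : Q setT != 0%E.
Variable f : X -> R.
Hypothesis fL : f \in Lfun mu alpha%:E.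
Local Notation m := (stable_measure alpha).
Local Notation mum := (mu \x m)%E.
Local Notation S := (maharam alpha mu T).
Local Notation Phi := (maharam_process alpha mu T f).
Hypothesis Phi_iso : system_isomorphism mum S Q path_shift Phi.
Variable n : nat -> nat.
Local Notation tau := (fun k => @translate R (n k)%:Z).

Let mPhi : measurable_fun setT Phi.
Proof. by have [[]] := Phi_iso. Qed.

Let PhiQ A : measurable A -> mum (Phi @^-1` A) = Q A.
Proof. by have [[_ h _] _] := Phi_iso; exact: h. Qed.

Let mf : measurable_fun setT f.
Proof. by move: fL => /andP[/[!inE]]. Qed.

Let mcoord (j : int) : measurable_fun setT (fun x : paths R => x j).
Proof. exact: measurable_coordinate. Qed.

Lemma nint_levy (F : paths R -> R) : measurable_fun setT F ->
  (forall x, 0 <= F x) -> (\int[Q]_x (F x)%:E = \int[mum]_z (F (Phi z))%:E)%E.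
Proof.
move=> mF F0.
rewrite (@eq_measure_integral _ _ _ setT (pushforward mum Phi)); last first.
  by move=> A mA _; exact/esym/PhiQ.
rewrite ge0_integral_pushforward//; first exact/measurable_EFinP.
by move=> x _; rewrite lee_fin.
Qed.

Lemma iter_process N : {ae mum, forall z,
  Phi (iter N S z) = iter N path_shift (Phi z)}.
Proof.
elim: N => [|N IH]; first exact: aeW.
have [_ h] := Phi_iso.
have := ae_iter_maharam T_ns N h.
by apply: filterS2 IH => z /= <-.
Qed.

(* Were this integral infinite, the integrability of [min(x_0^2, 1)] would force
   [f = 0], hence [Q = 0]. *)
Lemma nint_stable_sqr_clip1 : (\int[m]_s (sqr_clip 1 s)%:E < +oo)%E.
Proof.
rewrite ltey; apply/eqP => Coo.
have mg : measurable_fun setT (fun x => `|f x|) by exact: measurableT_comp.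
(* Read on the product, [x_0] is [s f], and for [s > 0] the integrand is [sqr_clip 1 (s |f|)]. *)
have E1 : (\int[Q]_x (Num.min ((x : paths R) 0 ^+ 2) 1)%:E =
    \int[mu]_x (`|f x| `^ alpha)%:E * +oo)%E.
  rewrite -Coo -(nint_product alpha_gt0 mu mg)//; last 3 first.
  - exact: measurable_sqr_clip.
  - exact: sqr_clip_ge0.
  - exact: sqr_clip0.
  rewrite nint_levy; last 2 first.
  - by apply: measurable_minr => //; exact: measurable_sqr.
  - by move=> x; rewrite le_min sqr_ge0/=.
  apply: ae_nint_eq.
  - apply: measurable_minr => //; apply: measurable_sqr.
    exact: (measurableT_comp (mcoord 0) mPhi).
  - exact: (measurable_scaled (measurable_sqr_clip 1) mg).
  apply: filterS (ae_product_snd mu (stable_measure_gt0 alpha)) => -[x s] /= s0.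
  rewrite /maharam_process /=.
  have -> : (s * f x) ^+ 2 = (s * `|f x|) ^+ 2.
    by rewrite !exprMn real_normK ?num_real.
  have : 0 <= s * `|f x| by rewrite mulr_ge0// ltW.
  move: (s * `|f x|) => y y0; rewrite /sqr_clip max_r//.
  by case: (leP 1 y) => h; case: (leP (y ^+ 2) 1) => h'; nra.
have F0 : (\int[mu]_x (`|f x| `^ alpha)%:E = 0)%E.
  apply/eqP; rewrite eq_le nint_ge0 ?andbT; last by move=> x; exact: powR_ge0.
  rewrite leNgt; apply/negP => Fgt0.
  by move: Q_levy; rewrite E1 gt0_muley// ltxx.
move: E1; rewrite F0 mul0e => E1.
have ae0 : {ae Q, forall x : paths R, x 0 = 0}.
  have mmin : measurable_fun setT (fun x : paths R => (Num.min (x 0 ^+ 2)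
    1)%:E).
    by apply/measurable_EFinP; apply: measurable_minr => //;
      exact: measurable_sqr.
  have min0 (x : paths R) : 0 <= Num.min (x 0 ^+ 2) 1 by rewrite le_min
    sqr_ge0/=.
  have /ae_eq_integral_abs : (\int[Q]_x `|(Num.min ((x : paths R) 0 ^+ 2) 1)%:E|
    = 0)%E.
    by rewrite -[RHS]E1; apply: eq_integral => x _; rewrite gee0_abs// lee_fin.
  move=> /(_ measurableT mmin); apply: filterS => x /(_ I) [].
  by case: leP => _ /eqP; rewrite ?sqrf_eq0 ?oner_eq0// => /eqP.
have aej (j : int) : {ae Q, forall x : paths R, x j = 0}.
  have : {ae Q, forall x, translate j x 0 = 0}.
    apply: (ae_preimage (measurable_translate (R := R) j) _ ae0) => A mA A0.
    by rewrite -A0; exact: (translate_invariant Q_shift).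
  by apply: filterS => x; rewrite /translate add0r.
(* The countably many coordinates are enumerated by codes, an invalid code carrying a trivial
   condition. *)
have := @ae_foralln _ _ _ Q (fun i x => if unpickle i is Some j then (x : paths
  R) (j : int) = 0 else True).
move=> [|A [mA A0 hA]].
  by move=> i; case: (unpickle i) => [j|]; [exact: aej|exact: aeW].
have Q0 : {ae Q, forall x : paths R, x <> @zero_path R}.
  by exists [set @zero_path R]; split => [|//|x /contrapT ->];
    [exact: measurable_zero_path|].
have [B [mB B0 hB]] : {ae Q, forall x : paths R, False}.
  have hAA : {ae Q, forall x : paths R, forall i,
      if unpickle i is Some j then x (j : int) = 0 else True}.
    by exists A; split.
  apply: filterS2 hAA Q0 => x xj; apply; apply/funext => j.
  by have := xj (pickle j); rewrite pickleK.
have BT : B = setT by apply/seteqP; split => // x _; exact: hB.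
by move/negP : Q_neq0; apply; rewrite -BT B0.
Qed.

Lemma nint_stable_sqr_clip L : 0 < L ->
  (\int[m]_s (sqr_clip L s)%:E < +oo)%E.
Proof.
move=> L0.
have L20 : 0 <= 1 + L ^+ 2 by rewrite addr_ge0// sqr_ge0.
apply: (@le_lt_trans _ _ (\int[m]_s ((1 + L ^+ 2) * sqr_clip 1 s)%:E)%E).
  apply: nint_le.
  - exact: measurable_sqr_clip.
  - by apply: measurable_funM => //; exact: measurable_sqr_clip.
  - exact: sqr_clip_ge0.
  - by move=> s; exact: sqr_clip_le.
rewrite nintZ//; [|exact: measurable_sqr_clip|exact: sqr_clip_ge0].
by apply: lte_mul_pinfty; [rewrite lee_fin| |exact: nint_stable_sqr_clip1].
Qed.

(** The truncated increment of [s f] splits by [sqr_clamp_dist] into its two signs. Each sign is an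
    instance of the Maharam identity with [u b] in [L^2(mu)], because [f] is in [L^alpha(mu)]. *)
Lemma rigid_clamp : rigid mu T n -> forall L, 0 < L ->
  drift Q tau (fun x => clamp L (x 0)) k @[k --> \oo] --> 0%E.
Proof.
move=> rT L L0.
pose g (b : bool) x := Num.max ((-1) ^+ b * f x) 0.
pose u b x := g b x `^ (alpha / 2).
have g0 b x : 0 <= g b x by rewrite /g le_max lexx orbT.
have mg b : measurable_fun setT (g b).
  by apply: measurable_maxr => //; exact: measurable_funM.
have u2 b : square_integrable mu (u b).
  split; first exact: measurable_fun_powR.
  apply: le_lt_trans (nint_powR_lty alpha_gt0 fL).
  apply: nint_le.
  - by apply: measurable_sqr; exact: measurable_fun_powR.
  - by apply: measurable_fun_powR; exact: measurableT_comp.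
  - by move=> x; exact: sqr_ge0.
  move=> x; rewrite /u sqr_powR_half//; apply: ge0_ler_powR; rewrite ?nnegrE//.
    exact: ltW.
  rewrite /g ge_max normr_ge0 andbT.
  by rewrite (le_trans (ler_norm _))// normrMsign.
pose A b k z := `|sqr_clip L ((iter (n k) S z).2 * g b (iter (n k) S z).1) -
                   sqr_clip L (z.2 * g b z.1)|.
have mI k := measurable_iter (n k) (measurable_maharam alpha T_ns).
have mA b k : measurable_fun setT (A b k).
  have mh := measurable_scaled (measurable_sqr_clip L) (mg b).
  exact: (measurable_fun_dist (measurableT_comp mh (mI k)) mh).
have A0 b k z : 0 <= A b k z by exact: normr_ge0.
pose v b k := (\int[mu]_x `|koopman mu T (n k) (u b) x ^+ 2 - u b x ^+ 2|%:E)%E.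
have v0 b k : (0 <= v b k)%E by exact: nint_ge0.
pose C := (\int[m]_s (sqr_clip L s)%:E)%E.
have Coo : (C < +oo)%E by exact: nint_stable_sqr_clip.
have C0 : (0 <= C)%E by apply: nint_ge0; exact: sqr_clip_ge0.
have Cf : C \is a fin_num by rewrite ge0_fin_numE.
have intA b k : (\int[mum]_z (A b k z)%:E = v b k * C)%E.
  apply: nint_maharam_dist => //.
  - exact: measurable_sqr_clip.
  - exact: sqr_clip_ge0.
  - exact: sqr_clip0.
  - by move=> s t; exact: sqr_clip_nondecreasing.
apply: (@cvge0_le _ (2 * fine C) _ (fun k => v false k + v true k)%E).
- by rewrite mulr_ge0// fine_ge0.
- by move=> k; exact: drift_ge0.
- by move=> k; exact: adde_ge0.
- by rewrite -[0%E]adde0; apply: cvgeD => //; exact: rigid_strong_sqr.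
move=> k.
have mcl (j : int) : measurable_fun setT (fun x : paths R => clamp L (x j)).
  exact: measurable_clamp.
have mclP (j : int) : measurable_fun setT (fun z => clamp L (Phi z j)).
  exact: (measurableT_comp (mcl j) mPhi).
have mD : measurable_fun setT (fun x : paths R =>
    (clamp L (x (n k)%:Z) - clamp L (x 0)) ^+ 2).
  by apply: measurable_sqr; exact: measurable_funB.
have -> : drift Q tau (fun x => clamp L (x 0)) k =
    (\int[Q]_x ((clamp L ((x : paths R) (n k)%:Z) - clamp L (x 0)) ^+ 2)%:E)%E.
  by apply: eq_integral => x _; rewrite /translate add0r.
rewrite (nint_levy mD); last by move=> x; exact: sqr_ge0.
apply: (@le_trans _ _ (\int[mum]_z (2 * A false k z + 2 * A true k z)%:E)%E).
  apply: ae_nint_le.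
  - by apply: measurable_sqr; exact: measurable_funB.
  - by apply: measurable_funD; exact: measurable_funM.
  - by move=> z; exact: sqr_ge0.
  - by move=> z; rewrite addr_ge0// mulr_ge0.
  (* The positivity of the second coordinate, before and after iteration, lets the positive part be
     taken of [f] alone instead of [s f]. *)
  apply: filterS2 (ae_product_snd mu (stable_measure_gt0 alpha))
    (iter_maharamE alpha T_ns (n k)) => z s0 zE.
  have y0 : 0 <= (iter (n k) S z).2 by rewrite zE /= mulr_ge0 ?powR_ge0// ltW.
  rewrite /A /g !sqr_clip_scale ?(ltW s0)// expr0 expr1 !mul1r !mulN1r !mulrN.
  exact: sqr_clamp_dist.
rewrite nintD//; last 4 first.
- exact: measurable_funM.
- exact: measurable_funM.
- by move=> z; rewrite mulr_ge0.
- by move=> z; rewrite mulr_ge0.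
rewrite !nintZ// !intA -ge0_muleDr ?mule_ge0// -ge0_muleDl//.
by rewrite EFinM fineK// muleA -[leRHS]muleA [(C * _)%E]muleC muleA.
Qed.

Lemma stable_measure_itv_gt0 : (0 < \int[m]_s (\1_(`]1%R, +oo[) s : R)%:E)%E.
Proof.
rewrite integral_indic// setIT.
have c0 : 0 < (2 : R) `^ (- (1 + alpha)) by rewrite powR_gt0.
apply: (@lt_le_trans _ _
  (\int[lebesgue_measure]_(s in `]1%R, 2%R]) (2 `^ (- (1 + alpha)))%:E)%E).
  rewrite integral_cst//= lebesgue_measure_itv/= lte_fin ltr1n -EFinB -EFinM
    lte_fin.
  by rewrite mulr_gt0//; lra.
apply: (@le_trans _ _ (m `]1, 2]%classic)); last first.
  by apply: le_measure; rewrite ?inE//; exact: subset_itvl.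
rewrite /stable_measure; apply: ge0_le_integral => //.
- apply/measurable_funTS/measurable_EFinP; apply: measurable_funM.
    exact: measurable_indic.
  exact: measurable_powR.
move=> s; rewrite /= in_itv/= => /andP[s1 s2].
have s0 : 0 < s by exact: lt_trans s1.
rewrite lee_fin indicE mem_set/= ?in_itv/= ?s0// mul1r !powRN.
rewrite lef_pV2 ?posrE ?powR_gt0//; apply: ge0_ler_powR; rewrite ?nnegrE//.
  by rewrite ltW// addr_gt0.
exact: ltW.
Qed.

(** The function [u] is encoded by the set [A] where [s * u^(2/alpha) > 1], whose measure is a
    constant times the integral of [u^2]. The displacement of this set under the extension measures
    that of [u^2] under the Koopman operator. *)
Lemma levy_rigid : (forall B, measurable B -> (Q B < +oo)%E ->
    drift Q tau \1_B k @[k --> \oo] --> 0%E) -> rigid mu T n.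
Proof.
move=> QB; apply: strong_rigid => // u u2 u0; have [m_u u2oo] := u2.
pose a x := u x `^ (2 / alpha).
have a0 x : 0 <= a x by exact: powR_ge0.
have ma : measurable_fun setT a by exact: measurable_fun_powR.
have uE : (fun x => a x `^ (alpha / 2)) = u.
  apply/funext => x; rewrite /a -powRrM.
  rewrite (_ : 2 / alpha * (alpha / 2) = 1) ?powRr1//.
  by field; rewrite gt_eqF.
pose h (s : R) : R := \1_(`]1%R, +oo[%classic) s.
have hE (s : R) : h s = (1 < s)%R%:R by rewrite /h indicE; congr (_%:R);
  rewrite mem_setE in_itv/= andbT.
have mh : measurable_fun setT h by exact: measurable_indic.
have h0 (s : R) : 0 <= h s by rewrite hE.
have h00 : h 0 = 0 by rewrite hE ltr10.
have ndh (s t : R) : 0 <= s -> s <= t -> h s <= h t.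
  by move=> _ st; rewrite !hE ler_nat; case: (ltP 1 s) => // s1;
    rewrite (lt_le_trans s1).
pose C := (\int[m]_s (h s)%:E)%E.
have Cgt0 : (0 < C)%E by exact: stable_measure_itv_gt0.
have Coo : (C < +oo)%E.
  apply: le_lt_trans nint_stable_sqr_clip1; apply: nint_le => //.
    exact: measurable_sqr_clip.
  move=> s; rewrite hE; case: (ltP 1 s) => [s1|_]; last exact: sqr_clip_ge0.
  by rewrite /sqr_clip min_l ?expr1n// le_max (ltW s1) orbT.
have Cf : C \is a fin_num by rewrite ge0_fin_numE// ltW.
pose A := [set z : X * R | 1 < z.2 * a z.1].
have mA : measurable A.
  rewrite (_ : A = (fun z : X * R => z.2 * a z.1) @^-1` `]1, +oo[).
    by apply: measurable_preimageT => //; exact: (@measurable_scaled _ _ _ id).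
  by apply/seteqP; split => z; rewrite /A /= in_itv/= andbT.
(* The inverse of the isomorphism makes [A] the preimage under [Phi], up to a null set, of a
   measurable set [B] of paths. *)
have [[_ _ [psi [mpsi psiK _]]] _] := Phi_iso.
have [B mB AB] := mpsi _ mA.
have {}AB : {ae mum, forall z, \1_B (Phi z) = h (z.2 * a z.1)}.
  have H : {ae mum, forall z, A (psi (Phi z)) <-> B (Phi z)}.
    by apply: (ae_preimage mPhi _ AB) => D mD D0; rewrite -D0; exact: PhiQ.
  apply: filterS2 H psiK => z + E; rewrite E hE indicE /A /= => AB'.
  suff -> : (Phi z \in B) = (1 < z.2 * a z.1) by [].
  by apply/idP/idP => [|/AB' BP]; [rewrite inE => /AB'|rewrite inE].
have m1B : measurable_fun setT (fun x : paths R => \1_B x : R).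
  exact: measurable_indic.
have mha := measurable_scaled mh ma.
have QBoo : (Q B < +oo)%E.
  rewrite -[B in Q B]setIT -integral_indic// (nint_levy m1B)//.
  rewrite (@ae_nint_eq _ _ _ _ _ (fun z : X * R => h (z.2 * a z.1)))//;
    last first.
    exact: (measurableT_comp m1B mPhi).
  rewrite nint_product// -/C muleC; apply: lte_mul_pinfty => //;
    first exact: ltW.
  rewrite (eq_integral (fun x => (u x ^+ 2)%:E))// => x _.
  rewrite /a -powRrM (_ : 2 / alpha * alpha = 2); last by field; rewrite gt_eqF.
  by rewrite powR_mulrn.
have driftE k : (drift Q tau \1_B k =
    \int[mu]_x `|koopman mu T (n k) u x ^+ 2 - u x ^+ 2|%:E * C)%E.
  have mI := measurable_iter (n k) (measurable_maharam alpha T_ns).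
  rewrite -uE -nint_maharam_dist//.
  have mD : measurable_fun setT (fun x : paths R =>
      (\1_B (translate (n k)%:Z x) - \1_B x : R) ^+ 2).
    apply: measurable_sqr; apply: measurable_funB => //.
    exact: (measurableT_comp m1B (@measurable_translate R (n k)%:Z)).
  rewrite /drift (nint_levy mD); last by move=> x; exact: sqr_ge0.
  apply: ae_nint_eq.
  - exact: (measurableT_comp mD mPhi).
  - exact: (measurable_fun_dist (measurableT_comp mha mI) mha).
  have E1 := ae_iter_maharam T_ns (n k) AB.
  apply: filterS3 (iter_process (n k)) E1 AB => z.
  rewrite -iter_shiftE => <- -> ->; rewrite !hE.
  by case: (1 < _); case: (1 < _);
    rewrite ?subrr ?subr0 ?sub0r ?normr0 ?normrN ?normr1 ?sqrrN ?expr1n ?expr0n.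
apply: (@cvge0_le _ (fine C)^-1 _ (drift Q tau \1_B)).
- by rewrite invr_ge0 fine_ge0// ltW.
- by move=> k; apply: nint_ge0 => x; exact: sqr_ge0.
- by move=> k; exact: drift_ge0.
- exact: QB.
move=> k; rewrite driftE muleC -muleA -[X in (_ * (X * _))%E]fineK//.
rewrite -EFinM divff ?mule1 ?nint_sqr_koopman_dist//.
by rewrite gt_eqF// fine_gt0// Cgt0.
Qed.

End associated.

(** * Increments and characteristic functions *)

Section trigo.
Variable R : realType.
Implicit Types t x : R.

Lemma sin_mvt t : 0 <= t -> exists2 c, 0 <= c <= t & sin t = cos c * t.
Proof.
move=> t0; have [c] := @MVT_segment R sin cos 0 t t0
  (fun x _ => is_derive_sin x) (continuous_subspaceT (@continuous_sin R)).
by rewrite in_itv/= sin0 !subr0 => c0t ->; exists c.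
Qed.

Lemma sin_le_norm t : `|sin t| <= `|t|.
Proof.
wlog t0 : t / 0 <= t => [H|].
  by case: (leP 0 t) => [/H//|/ltW t0];
    rewrite -normrN -sinN -[leRHS]normrN H// oppr_ge0.
have [c _ ->] := sin_mvt t0.
by rewrite normrM -[leRHS]mul1r ler_wpM2r// cos_max.
Qed.

Lemma onem_cos t : 1 - cos t = 2 * sin (t / 2) ^+ 2.
Proof.
have -> : cos t = cos ((t / 2) *+ 2) by congr cos;
  rewrite -mulr_natr divfK// pnatr_eq0.
rewrite cos_mulr2n; have := cos2Dsin2 (t / 2); lra.
Qed.

Lemma onem_cos_ge0 t : 0 <= 1 - cos t.
Proof. by rewrite onem_cos mulr_ge0// sqr_ge0. Qed.

Lemma onem_cos_le_sqr t : 1 - cos t <= t ^+ 2 / 2.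
Proof.
rewrite onem_cos; have := sin_le_norm (t / 2).
rewrite -[X in X <= _]normr_id -ler_sqr ?nnegrE// !real_normK ?num_real//.
by rewrite expr_div_n; lra.
Qed.

(** By the mean value theorem [sin (|t| / 2) = cos c * |t| / 2] with [c <= 1 / 2], where
    [cos c >= 1 / 2]. So the sine is at least [|t| / 4], and [1 - cos t] is twice its square. *)
Lemma sqr_le_onem_cos t : `|t| <= 1 -> t ^+ 2 <= 8 * (1 - cos t).
Proof.
move=> t1; rewrite onem_cos -[t ^+ 2]real_normK ?num_real//.
have -> : sin (t / 2) ^+ 2 = sin (`|t| / 2) ^+ 2.
  by case: (ger0P t) => // _; rewrite mulNr sinN sqrrN.
move: t1 (normr_ge0 t); move: `|t| => {}t t1 t0.
have t20 : 0 <= t / 2 by rewrite divr_ge0.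
have [c /andP[c0 ct] ->] := sin_mvt t20.
have := onem_cos_le_sqr c; have : c ^+ 2 <= 1 by rewrite expr_le1//; lra.
move=> c1 cc; have {cc}c2 : 1 / 2 <= cos c by lra.
have : (t / 4) <= cos c * (t / 2) by nra.
by move: (cos c * (t / 2)) => y; nra.
Qed.

(** For [t >= 0] the difference is [(cos c - 1) t] with [0 <= c <= t], and
    [1 - cos c = 2 sin(c/2)^2 <= c]. *)
Lemma sin_sub_le_sqr t : `|sin t - t| <= t ^+ 2.
Proof.
wlog t0 : t / 0 <= t => [H|].
  case: (leP 0 t) => [/H//|/ltW t0].
  by rewrite -normrN opprB addrC -sinN -sqrrN; have := H (- t); rewrite opprK;
    apply; rewrite oppr_ge0.
have [c /andP[c0 ct] ->] := sin_mvt t0.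
rewrite -{2}[t]mul1r -mulrBl normrM (ger0_norm t0) distrC (ger0_norm
  (onem_cos_ge0 c)).
rewrite expr2 ler_wpM2r//; apply: le_trans ct.
rewrite onem_cos; have := sin_le_norm (c / 2);
  rewrite [`|c / 2|]ger0_norm ?divr_ge0//.
have := sin_max (c / 2); have := normr_ge0 (sin (c / 2)).
by rewrite -(real_normK (num_real (sin _))); nra.
Qed.

End trigo.

(** * Truncations compared with cosines *)

Section far.
Variable R : realType.
Implicit Types L M x y : R.

Definition far M x : R := (M < `|x|)%R%:R.

Lemma far_ge0 M x : 0 <= far M x.
Proof. by []. Qed.

Lemma measurable_far M : measurable_fun setT (far M).
Proof.
rewrite (_ : far M = \1_((@Num.norm R R) @^-1` `]M, +oo[)).
  apply: measurable_indic; rewrite -[X in measurable X]setTI.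
  by apply: (_ : measurable_fun setT (@Num.norm R R)).
apply/funext => x; rewrite /far indicE.
suff -> : (x \in Num.norm @^-1` `]M, +oo[) = (M < `|x|) by [].
by apply/idP/idP; rewrite inE /= in_itv/= andbT.
Qed.

Lemma far_le M x : 1 <= M -> far M x <= Num.min (x ^+ 2) 1.
Proof.
move=> M1; rewrite /far; case: ltP => Mx; last by rewrite le_min sqr_ge0/=.
rewrite le_min lexx andbT -real_normK ?num_real// expr_ge1//.
by apply: le_trans (ltW Mx).
Qed.

(** If a point lies beyond [K], the trivial bound [(2 L)^2] is used. Otherwise [|x - y| <= 2 K], so
    at frequency [1 / (2 K)] the angle is at most 1, and [sqr_le_onem_cos] gives the constant
    [8 * (2 K)^2]. *)
Lemma sqr_clamp_le_cos L K x y : 0 < L -> 0 < K ->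
  (clamp L x - clamp L y) ^+ 2 <=
  (4 * L ^+ 2) * (far K x + far K y) +
  (32 * K ^+ 2) * (1 - cos ((2 * K)^-1 * (x - y))).
Proof.
move=> L0 K0.
have clampL z : `|clamp L z| <= L.
  rewrite /clamp ler_norml; case: (leP (- L) z) => h.
    by case: (leP L z) => h1; lra.
  by rewrite min_r; lra.
have c0 := onem_cos_ge0 ((2 * K)^-1 * (x - y)).
have K20 : 0 <= K ^+ 2 by exact: sqr_ge0.
have L20 : 0 <= L ^+ 2 by exact: sqr_ge0.
have big : (clamp L x - clamp L y) ^+ 2 <= 4 * L ^+ 2.
  move: (clampL x) (clampL y); rewrite !ler_norml.
  by move: (clamp L x) (clamp L y) => p q /andP[p1 p2] /andP[q1 q2]; nra.
have C0 : 0 <= (32 * K ^+ 2) * (1 - cos ((2 * K)^-1 * (x - y))).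
  by apply: mulr_ge0 => //; exact: mulr_ge0.
have D0 : 0 <= 4 * L ^+ 2 by rewrite mulr_ge0.
rewrite /far; case: ltP => Kx.
  apply: (le_trans big); apply: ler_wpDr; first exact: C0.
  by rewrite mulrDr mulr1 lerDl mulr_ge0.
case: ltP => Ky; first by rewrite add0r mulr1; apply: ler_wpDr; [exact: C0|].
rewrite addr0 mulr0 add0r.
have h1 : (clamp L x - clamp L y) ^+ 2 <= (x - y) ^+ 2.
  rewrite -[leLHS]real_normK ?num_real// -[leRHS]real_normK ?num_real//.
  rewrite lerXn2r ?nnegrE//; apply: ler_norm_clip; lra.
apply: (le_trans h1).
have : `|(2 * K)^-1 * (x - y)| <= 1.
  rewrite normrM ger0_norm ?invr_ge0 ?mulr_ge0 ?(ltW K0)//.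
  rewrite ler_pdivrMl ?mulr_gt0// mulr1 (le_trans (ler_normB _ _))//; lra.
move=> /sqr_le_onem_cos; rewrite exprMn exprVn ler_pdivrMl; last first.
  by rewrite exprn_gt0// mulr_gt0.
by rewrite exprMn; lra.
Qed.

Lemma sqr_le_far L x y : 1 <= L -> Num.min ((x - y) ^+ 2) 1 <=
  far L x + far L y + (clamp L x - clamp L y) ^+ 2.
Proof.
move=> L1; have := sqr_ge0 (clamp L x - clamp L y).
rewrite /far; case: ltP => Lx s0.
  apply: (@le_trans _ _ 1); first by rewrite ge_min lexx orbT.
  by rewrite -addrA lerDl addr_ge0.
case: ltP => Ly.
  apply: (@le_trans _ _ 1); first by rewrite ge_min lexx orbT.
  by rewrite add0r lerDl.
have cE z : `|z| <= L -> clamp L z = z.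
  by rewrite ler_norml => /andP[z1 z2]; rewrite /clamp max_r// min_r.
by rewrite !cE// addr0 add0r ge_min lexx.
Qed.

End far.

(** * Convergence of the increments *)

Section almost_periodic.
Variable R : realType.
Variable nu : {measure set (paths R) -> \bar R}.
Hypothesis nu_shift : shift_invariant nu.
Hypothesis levy_nu : (\int[nu]_x (Num.min ((x : paths R) 0 ^+ 2) 1)%:E < +oo)%E.
Variable n : nat -> nat.
Local Notation tau := (fun k => @translate R (n k)%:Z).

Let mcoord (j : int) : measurable_fun setT (fun x : paths R => x j).
Proof. exact: measurable_coordinate. Qed.

(** For [P], this is one minus the real part of the characteristic function of the increment at [a];
    for [Q], minus the real part of its Levy exponent. *)
Definition cos_dist (a : R) k : \bar R :=
  (\int[nu]_x (1 - cos (a * ((x : paths R) (n k)%:Z - x 0)))%:E)%E.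

Lemma cos_dist_ge0 a k : (0 <= cos_dist a k)%E.
Proof. by apply: nint_ge0 => x; exact: onem_cos_ge0. Qed.

Lemma measurable_increment k : measurable_fun setT (fun x : paths R => x (n
  k)%:Z - x 0).
Proof. exact: measurable_funB. Qed.

Lemma measurable_cos_dist a k : measurable_fun setT
  (fun x : paths R => 1 - cos (a * (x (n k)%:Z - x 0))).
Proof.
apply: measurable_funB => //.
apply: (@measurableT_comp _ _ _ _ _ _ (@cos R)).
  by apply: continuous_measurable_fun; exact: continuous_cos.
by apply: measurable_funM => //; exact: measurable_increment.
Qed.

Lemma measurable_far_coordinate M (j : int) :
  measurable_fun setT (fun x : paths R => far M (x j)).
Proof. exact: (measurableT_comp (measurable_far M) (mcoord j)). Qed.

Lemma nint_far M (j : int) :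
  (\int[nu]_x (far M ((x : paths R) j))%:E = \int[nu]_x (far M ((x : paths R)
    0))%:E)%E.
Proof.
rewrite -(nint_translate nu_shift j (measurable_far_coordinate M 0));
  last first.
  by move=> x; exact: far_ge0.
by apply: eq_integral => x _; rewrite /translate add0r.
Qed.

Lemma nint_far_cvg0 :
  (\int[nu]_x (far i.+1%:R ((x : paths R) 0))%:E @[i --> \oo] --> 0)%E.
Proof.
apply: (@nint_dominated_cvg0 _ _ _ nu (fun i (x : paths R) => far i.+1%:R (x 0))
  (fun x : paths R => Num.min (x 0 ^+ 2) 1)) => //.
- by move=> i; exact: measurable_far_coordinate.
- by apply: measurable_minr => //; exact: measurable_sqr.
- by move=> i x; apply: far_le; rewrite ler1n.
- move=> x; apply: (@cvg_trans _ (cst (0 : R) @ \oo)); last exact: cvg_cst.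
  apply: near_eq_cvg; near=> i.
  rewrite /cst /far ltNge (_ : `|x 0| <= i.+1%:R)//.
  rewrite (le_trans (ltW (truncnS_gt _)))// ler_nat ltnS.
  by near: i; exact: nbhs_infty_ge.
Unshelve. all: by end_near. Qed.

Lemma far_small e : 0 < e -> exists2 M : R, 1 <= M &
  (\int[nu]_x (far M ((x : paths R) 0))%:E <= e%:E)%E.
Proof.
move=> e0.
have far0 i : (0 <= \int[nu]_x (far i.+1%:R ((x : paths R) 0))%:E)%E.
  by apply: nint_ge0 => x; exact: far_ge0.
have [N _ /(_ N (leqnn N)) /= h] := (cvge0P far0).1 nint_far_cvg0 _ e0.
by exists N.+1%:R => //; rewrite ler1n.
Qed.

Lemma measurable_clamp_dist L k : measurable_fun setT
  (fun x : paths R => (clamp L (x (n k)%:Z) - clamp L (x 0)) ^+ 2).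
Proof.
by apply: measurable_sqr; apply: measurable_funB; exact: measurable_clamp.
Qed.

Lemma drift_clampE L k : drift nu tau (fun x => clamp L (x 0)) k =
  (\int[nu]_x ((clamp L ((x : paths R) (n k)%:Z) - clamp L (x 0)) ^+ 2)%:E)%E.
Proof. by apply: eq_integral => x _; rewrite /translate add0r. Qed.

(* The increments [x_{n_k} - x_0] have uniformly small tails by stationarity, so
   that a single frequency controls them up to an arbitrarily small error. *)
Lemma cos_clamp : (forall a, cos_dist a k @[k --> \oo] --> 0%E) ->
  forall L, 0 < L ->
  drift nu tau (fun x => clamp L (x 0)) k @[k --> \oo] --> 0%E.
Proof.
move=> cos0 L L0; apply: cvge0_approx => [k|e e0]; first exact: drift_ge0.
have L20 : 0 < L ^+ 2 by exact: exprn_gt0.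
have eL : 0 < e / (8 * L ^+ 2) by rewrite divr_gt0// mulr_gt0.
have [M M1 hM] := far_small eL.
have M0 : 0 < M by exact: lt_le_trans M1.
exists (32 * M ^+ 2), (cos_dist (2 * M)^-1); split => //.
- by rewrite mulr_ge0// sqr_ge0.
- by move=> k; exact: cos_dist_ge0.
move=> k; rewrite drift_clampE addeC.
apply: (@le_trans _ _ ((4 * L ^+ 2)%:E *
    \int[nu]_x (far M ((x : paths R) (n k)%:Z) + far M (x 0))%:E +
    (32 * M ^+ 2)%:E * cos_dist (2 * M)^-1 k)%E).
  apply: nint_le2.
  - by rewrite mulr_ge0// ltW.
  - by rewrite mulr_ge0// sqr_ge0.
  - exact: measurable_clamp_dist.
  - by apply: measurable_funD; exact: measurable_far_coordinate.
  - exact: measurable_cos_dist.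
  - by move=> x; exact: sqr_ge0.
  - by move=> x; rewrite addr_ge0.
  - by move=> x; exact: onem_cos_ge0.
  - by move=> x; exact: sqr_clamp_le_cos.
rewrite leeD2r// nintD//; [|exact: measurable_far_coordinate..].
rewrite nint_far.
apply: (@le_trans _ _ ((4 * L ^+ 2)%:E * ((e / (8 * L ^+ 2))%:E + (e / (8 * L ^+
  2))%:E))%E).
  by apply: lee_wpmul2l; [rewrite lee_fin mulr_ge0// ltW|exact: leeD].
rewrite -EFinD -EFinM lee_fin.
have -> // : 4 * L ^+ 2 * (e / (8 * L ^+ 2) + e / (8 * L ^+ 2)) = e.
by field; rewrite gt_eqF.
Qed.

Definition min_dist k : \bar R :=
  (\int[nu]_x (Num.min (((x : paths R) (n k)%:Z - x 0) ^+ 2) 1)%:E)%E.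

Lemma min_dist_ge0 k : (0 <= min_dist k)%E.
Proof. by apply: nint_ge0 => x; rewrite le_min sqr_ge0/=. Qed.

Lemma measurable_min_dist k : measurable_fun setT
  (fun x : paths R => Num.min ((x (n k)%:Z - x 0) ^+ 2) 1).
Proof.
by apply: measurable_minr => //; apply: measurable_sqr;
  exact: measurable_increment.
Qed.

(** The tails are again uniformly small: off them the truncation at [M >= 1] is the identity, so the
    truncated coordinates control the increment. *)
Lemma clamp_min_dist : (forall L, 0 < L ->
    drift nu tau (fun x => clamp L (x 0)) k @[k --> \oo] --> 0%E) ->
  min_dist k @[k --> \oo] --> 0%E.
Proof.
move=> cl0; apply: cvge0_approx => [k|e e0]; first exact: min_dist_ge0.
have e20 : 0 < e / 2 by rewrite divr_gt0.
have [M M1 hM] := far_small e20.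
have M0 : 0 < M by exact: lt_le_trans M1.
exists 1, (drift nu tau (fun x => clamp M (x 0))); split => //.
- by move=> k; exact: drift_ge0.
- exact: cl0.
move=> k; rewrite drift_clampE addeC.
apply: (@le_trans _ _ (1%:E *
    \int[nu]_x (far M ((x : paths R) (n k)%:Z) + far M (x 0))%:E +
    1%:E * \int[nu]_x ((clamp M ((x : paths R) (n k)%:Z) - clamp M (x 0)) ^+
      2)%:E)%E).
  apply: nint_le2 => //.
  - exact: measurable_min_dist.
  - by apply: measurable_funD; exact: measurable_far_coordinate.
  - exact: measurable_clamp_dist.
  - by move=> x; rewrite le_min sqr_ge0/=.
  - by move=> x; rewrite addr_ge0.
  - by move=> x; exact: sqr_ge0.
  - by move=> x; rewrite !mul1r; exact: sqr_le_far.
rewrite leeD2r// mul1e nintD//; [|exact: measurable_far_coordinate..].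
rewrite nint_far (splitr e) EFinD; exact: leeD.
Qed.

End almost_periodic.

(** * The Levy exponent of an increment *)

Section levy_integrand.
Variable R : realType.
Implicit Types a x y e : R.

Lemma clipE x : clip x = clamp 1 x.
Proof.
rewrite /clip /clamp; case: (ltP x (-1)) => h; first by rewrite min_r//; lra.
by rewrite minC; case: (leP x 1).
Qed.

(** If both points lie in [[-1, 1]], [clip] is the identity and the error is quadratic;
    [|y - x| <= 2] gives [4 |a|^2]. Otherwise only a first order bound in [p = min(|y - x|, 1)]
    holds: [1 + |a|] from the sine plus [2 |a|] from [clip]. The free parameter [e] trades [p] for
    [p^2 / e + e], and the constant [e] is charged to the paths with a coordinate beyond 1. *)
Lemma levy_imaginary_le a x y e : 0 < e ->
  `|sin (a * (y - x)) - a * (clip y - clip x)| <=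
  (1 + 3 * `|a| + 4 * `|a| ^+ 2) *
    ((1 + e^-1) * Num.min ((y - x) ^+ 2) 1 + e * (far 1 x + far 1 y)).
Proof.
move=> e0; have ie0 : 0 <= e^-1 by rewrite invr_ge0 ltW.
have a0 := normr_ge0 a; have a20 : 0 <= `|a| ^+ 2 by exact: sqr_ge0.
have min0 : 0 <= Num.min ((y - x) ^+ 2) 1 by rewrite le_min sqr_ge0/=.
have far0 : 0 <= e * (far 1 x + far 1 y).
  by apply: mulr_ge0; [exact: ltW|rewrite addr_ge0].
have K1 : 4 * `|a| ^+ 2 <= 1 + 3 * `|a| + 4 * `|a| ^+ 2 by lra.
have K2 : 1 + 3 * `|a| <= 1 + 3 * `|a| + 4 * `|a| ^+ 2 by lra.
have K0 : 0 <= 1 + 3 * `|a| + 4 * `|a| ^+ 2 by lra.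
have minie : 0 <= e^-1 * Num.min ((y - x) ^+ 2) 1 by exact: mulr_ge0.
have [/andP[x1 y1]|xy] := boolP ((`|x| <= 1) && (`|y| <= 1)).
  have cE (z : R) : `|z| <= 1 -> clip z = z.
    by rewrite clipE ler_norml => /andP[z1 z2]; rewrite /clamp max_r// min_r.
  rewrite !cE// (le_trans (sin_sub_le_sqr _))// exprMn -[a ^+ 2]real_normK
    ?num_real//.
  apply: (@le_trans _ _ (4 * `|a| ^+ 2 * Num.min ((y - x) ^+ 2) 1)).
    rewrite -[leRHS]mulrA [leRHS]mulrCA; apply: ler_wpM2l => //.
    move: x1 y1; rewrite !ler_norml => /andP[x1 x2] /andP[y1 y2].
    by have := sqr_ge0 (y - x); case: (leP ((y - x) ^+ 2) 1) => h; nra.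
  apply: ler_pM => //.
  by rewrite mulrDl mul1r -addrA lerDl addr_ge0.
have far1 : 1 <= far 1 x + far 1 y.
  move: xy; rewrite negb_and -!ltNge /far => /orP[|] ->;
    rewrite ?lerDl ?lerDr//.
pose p := Num.min `|y - x| 1.
have p0 : 0 <= p by rewrite le_min normr_ge0 ler01.
have pE : Num.min ((y - x) ^+ 2) 1 = p ^+ 2.
  rewrite /p -real_normK ?num_real//; have := normr_ge0 (y - x).
  move: `|y - x| => d d0.
  by case: (leP d 1) => h; case: (leP (d ^+ 2) 1) => h'; nra.
have sinp : `|sin (a * (y - x))| <= (1 + `|a|) * p.
  rewrite /p; case: (leP `|y - x| 1) => h.
    rewrite (le_trans (sin_le_norm _))// normrM.
    by have := normr_ge0 (y - x); nra.
  by rewrite mulr1 (le_trans (sin_max _))// lerDl.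
have clipp : `|clip y - clip x| <= 2 * p.
  have c1 (z : R) : `|clip z| <= 1.
    rewrite clipE /clamp ler_norml; case: (leP (-1) z) => h.
      by case: (leP 1 z) => h1; lra.
    by rewrite min_r; lra.
  have cd : `|clip y - clip x| <= `|y - x| by rewrite !clipE;
    apply: ler_norm_clip; lra.
  rewrite /p; case: (leP `|y - x| 1) => h; first by have := normr_ge0 (y - x);
    lra.
  by rewrite (le_trans (ler_normB _ _))//; have := c1 x; have := c1 y; lra.
apply: (@le_trans _ _ ((1 + 3 * `|a|) * p)).
  rewrite (le_trans (ler_normB _ _))// normrM.
  have : `|a| * `|clip y - clip x| <= `|a| * (2 * p) by exact: ler_wpM2l.
  by move: (`|a| * `|clip y - clip x|) => q; nra.
apply: ler_pM => //.
rewrite pE.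
have : p <= e^-1 * p ^+ 2 + e.
  rewrite -subr_ge0; have -> : e^-1 * p ^+ 2 + e - p = e^-1 * ((p - e / 2) ^+ 2
    + 3 / 4 * e ^+ 2).
    by field; rewrite gt_eqF.
  by rewrite mulr_ge0// addr_ge0 ?sqr_ge0// mulr_ge0 ?sqr_ge0//; lra.
have : e <= e * (far 1 x + far 1 y) by rewrite ler_pMr.
by have := sqr_ge0 p; lra.
Qed.

(** The successor keeps the last index different from 0, so that the two weights [a] and [- a] do
    not collide. *)
Lemma int_sum_increment (N : nat) a (v : int -> R) :
  int_sum 0 N.+1%:Z (fun k =>
    (if k == N.+1%:Z then a else if k == 0 then - a else 0) * v k) =
  a * (v N.+1%:Z - v 0).
Proof.
rewrite /int_sum subr0 absz_nat big_ord_recr big_ord_recl /= big1 ?addr0;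
  last first.
  by move=> i _; rewrite add0r eqz_nat /bump leq0n add1n eqSS ltn_eqF// mul0r.
by rewrite add0r eqxx mulrBr mulNr addrC.
Qed.

End levy_integrand.

Section levy_khintchine.
Variable R : realType.
Local Open Scope complex_scope.

Lemma cexp_imaginary (t : R) : cexp ('i * t%:C) = Complex (cos t) (sin t).
Proof.
rewrite /cexp /=.
by rewrite !mul0r !mul1r subr0 add0r expR0 !mul1r.
Qed.

(** Real part of the Levy-Khintchine formula for the weights [a] at [N] and [- a] at 0: the real
    part of [exp (u + i v)] is [exp u * cos v]. *)
Lemma levy_khintchine_increment (P : probability (paths R) R)
    (Q : {sigma_finite_measure set (paths R) -> \bar R}) (a : R) (N : nat) :
  levy_khintchine P Q -> (0 < N)%N ->
  \int[P]_x cos (a * ((x : paths R) N%:Z - x 0)) =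
  expR (\int[Q]_x (cos (a * ((x : paths R) N%:Z - x 0)) - 1)) *
  cos (\int[Q]_x (sin (a * ((x : paths R) N%:Z - x 0)) -
                  a * (clip (x N%:Z) - clip (x 0)))).
Proof.
case: N => // N PQ _.
pose c k := if k == N.+1%:Z then a else if k == 0 then - a else 0.
have E1 : (fun x : paths R => cexp ('i * (int_sum 0 N.+1%:Z (fun k => c k * x
  k))%:C)) =
    (fun x => Complex (cos (a * (x N.+1%:Z - x 0))) (sin (a * (x N.+1%:Z - x
      0)))).
  by apply/funext => x; rewrite int_sum_increment cexp_imaginary.
have E2 : (fun x : paths R =>
      cexp ('i * (int_sum 0 N.+1%:Z (fun k => c k * x k))%:C) - 1
      - 'i * (int_sum 0 N.+1%:Z (fun k => c k * clip (x k)))%:C) =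
    (fun x => Complex (cos (a * (x N.+1%:Z - x 0)) - 1)
      (sin (a * (x N.+1%:Z - x 0)) - a * (clip (x N.+1%:Z) - clip (x 0)))).
  apply/funext => x; rewrite !int_sum_increment cexp_imaginary.
  by congr Complex; rewrite /=; ring.
have := PQ 0 N.+1%:Z c isT.
by rewrite E1 E2 /cintegral /= => -[].
Qed.

End levy_khintchine.

Lemma onem_cos_le_min (R : realType) (a d : R) :
  1 - cos (a * d) <= (2 + a ^+ 2) * Num.min (d ^+ 2) 1.
Proof.
have a20 := sqr_ge0 a.
case: (leP (d ^+ 2) 1) => h.
  rewrite (le_trans (onem_cos_le_sqr _))// exprMn.
  by have := mulr_ge0 a20 (sqr_ge0 d); have := sqr_ge0 d; lra.
have : -1 <= cos (a * d) by have := cos_max (a * d);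
  rewrite ler_norml => /andP[].
lra.
Qed.

Lemma sqr_min_dist (R : realType) (x y : R) :
  Num.min ((x - y) ^+ 2) 1 <= 2 * Num.min (x ^+ 2) 1 + 2 * Num.min (y ^+ 2) 1.
Proof.
have := sqr_ge0 (x + y); have := sqr_ge0 x; have := sqr_ge0 y.
case: (leP (x ^+ 2) 1) => hx; case: (leP (y ^+ 2) 1) => hy;
  case: (leP ((x - y) ^+ 2) 1) => h; nra.
Qed.

(** * Modulus and phase of the Levy exponent *)

Section levy_distance.
Variable R : realType.
Variable nu : {measure set (paths R) -> \bar R}.
Hypothesis nu_shift : shift_invariant nu.
Hypothesis levy_nu : (\int[nu]_x (Num.min ((x : paths R) 0 ^+ 2) 1)%:E < +oo)%E.
Variable n : nat -> nat.

Let mcoord (j : int) : measurable_fun setT (fun x : paths R => x j).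
Proof. exact: measurable_coordinate. Qed.

Lemma measurable_min_coordinate (j : int) :
  measurable_fun setT (fun x : paths R => Num.min (x j ^+ 2) 1).
Proof. by apply: measurable_minr => //; exact: measurable_sqr. Qed.

Lemma min_dist_lty k : (min_dist nu n k < +oo)%E.
Proof.
have min0 (j : int) (x : paths R) : 0 <= Num.min (x j ^+ 2) 1.
  by rewrite le_min sqr_ge0/=.
apply: (@le_lt_trans _ _
  (2%:E * \int[nu]_x (Num.min ((x : paths R) (n k)%:Z ^+ 2) 1)%:E +
   2%:E * \int[nu]_x (Num.min ((x : paths R) 0 ^+ 2) 1)%:E)%E).
  apply: nint_le2 => //.
  - exact: measurable_min_dist.
  - exact: measurable_min_coordinate.
  - exact: measurable_min_coordinate.
  - by move=> x; rewrite le_min sqr_ge0/=.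
  - by move=> x; exact: sqr_min_dist.
apply: lte_add_pinfty; apply: lte_mul_pinfty => //.
apply: le_lt_trans levy_nu.
rewrite -(nint_translate nu_shift (n k)%:Z (measurable_min_coordinate 0) (min0
  0)).
rewrite le_eqVlt; apply/orP; left; apply/eqP.
by apply: eq_integral => x _; rewrite /translate add0r.
Qed.

Lemma cos_dist_le a k :
  (cos_dist nu n a k <= (2 + a ^+ 2)%:E * min_dist nu n k)%E.
Proof.
have c0 : 0 <= 2 + a ^+ 2 by rewrite addr_ge0// sqr_ge0.
have min0 (x : paths R) : 0 <= Num.min ((x (n k)%:Z - x 0) ^+ 2) 1.
  by rewrite le_min sqr_ge0/=.
rewrite /min_dist -nintZ//; last exact: measurable_min_dist.
apply: nint_le.
- exact: measurable_cos_dist.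
- by apply: measurable_funM => //; exact: measurable_min_dist.
- by move=> x; exact: onem_cos_ge0.
- by move=> x; exact: onem_cos_le_min.
Qed.

Lemma cos_dist_fin_num a k : cos_dist nu n a k \is a fin_num.
Proof.
rewrite ge0_fin_numE ?cos_dist_ge0//; apply: le_lt_trans (cos_dist_le a k) _.
apply: lte_mul_pinfty => //; last exact: min_dist_lty.
by rewrite lee_fin addr_ge0// sqr_ge0.
Qed.

Lemma min_cos_dist a : min_dist nu n k @[k --> \oo] --> 0%E ->
  cos_dist nu n a k @[k --> \oo] --> 0%E.
Proof.
move=> m0; apply: (@cvge0_le _ (2 + a ^+ 2) _ (min_dist nu n)) => //.
- by rewrite addr_ge0// sqr_ge0.
- by move=> k; exact: cos_dist_ge0.
- by move=> k; exact: min_dist_ge0.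
- by move=> k; exact: cos_dist_le.
Qed.

Lemma Rintegral_cos_sub1 a k :
  \int[nu]_x (cos (a * ((x : paths R) (n k)%:Z - x 0)) - 1) =
  - fine (cos_dist nu n a k).
Proof.
rewrite /Rintegral -fineN; congr fine.
rewrite -integral_ge0N; last by move=> x _; rewrite lee_fin onem_cos_ge0.
by apply: eq_integral => x _; rewrite -EFinN opprB.
Qed.

(** Imaginary part of the Levy-Khintchine integrand of the increment; its integral is the angle
    whose cosine enters [cos_distP]. *)
Definition levy_phase a k (x : paths R) : R :=
  sin (a * (x (n k)%:Z - x 0)) - a * (clip (x (n k)%:Z) - clip (x 0)).

Lemma measurable_levy_phase a k : measurable_fun setT (levy_phase a k).
Proof.
apply: measurable_funB.
  apply: (@measurableT_comp _ _ _ _ _ _ (@sin R)).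
    by apply: continuous_measurable_fun; exact: continuous_sin.
  by apply: measurable_funM => //; exact: measurable_increment.
have mclip j : measurable_fun setT (fun x : paths R => clip (x j)).
  rewrite (_ : (fun _ => _) = (fun x : paths R => clamp 1 (x j))).
    exact: measurable_clamp.
  by apply/funext => x; exact: clipE.
by apply: measurable_funM => //; exact: measurable_funB.
Qed.

Lemma nint_levy_phase_le a k e : 0 < e ->
  (\int[nu]_x `|levy_phase a k x|%:E <=
   ((1 + 3 * `|a| + 4 * `|a| ^+ 2) * (1 + e^-1))%:E * min_dist nu n k +
   ((1 + 3 * `|a| + 4 * `|a| ^+ 2) * e)%:E *
     (2%:E * \int[nu]_x (far 1 ((x : paths R) 0))%:E))%E.
Proof.
move=> e0; have K0 : 0 <= 1 + 3 * `|a| + 4 * `|a| ^+ 2.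
  by have := normr_ge0 a; have := sqr_ge0 `|a|; lra.
have mfar j : measurable_fun setT (fun x : paths R => far 1 (x j)).
  exact: measurable_far_coordinate.
have -> : (2%:E * \int[nu]_x (far 1 ((x : paths R) 0))%:E =
    \int[nu]_x (far 1 ((x : paths R) 0) + far 1 (x (n k)%:Z))%:E)%E.
  by rewrite nintD// (nint_far nu_shift 1 (n k)%:Z) mule_natl mule2n.
apply: nint_le2.
- by rewrite mulr_ge0// addr_ge0// invr_ge0 ltW.
- by rewrite mulr_ge0// ltW.
- by apply: measurableT_comp => //; exact: measurable_levy_phase.
- exact: measurable_min_dist.
- exact: measurable_funD.
- by [].
- by move=> x; rewrite le_min sqr_ge0/=.
- by move=> x; rewrite addr_ge0.
- by move=> x; rewrite -!mulrA -mulrDr; exact: levy_imaginary_le.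
Qed.

Lemma far1_lty : (\int[nu]_x (far 1 ((x : paths R) 0))%:E < +oo)%E.
Proof.
apply: le_lt_trans levy_nu; apply: nint_le => //.
- exact: measurable_far_coordinate.
- exact: measurable_min_coordinate.
- by move=> x; exact: far_le.
Qed.

Lemma integrable_levy_phase a k : nu.-integrable setT (EFin \o levy_phase a k).
Proof.
apply/integrableP; split; first by apply/measurable_EFinP;
  exact: measurable_levy_phase.
apply: (le_lt_trans (nint_levy_phase_le a k (@ltr01 R))).
have K0 : 0 <= 1 + 3 * `|a| + 4 * `|a| ^+ 2.
  by have := normr_ge0 a; have := sqr_ge0 `|a|; lra.
apply: lte_add_pinfty; apply: lte_mul_pinfty => //.
- exact: min_dist_lty.
- by apply: lte_mul_pinfty => //; exact: far1_lty.
Qed.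

(** The parameter of [nint_levy_phase_le] is fixed first, to make the contribution of distant
    coordinates small. Its inverse multiplies [min_dist], which then tends to 0. *)
Lemma levy_phase_cvg0 a : min_dist nu n k @[k --> \oo] --> 0%E ->
  (\int[nu]_x levy_phase a k x) @[k --> \oo] --> (0 : R).
Proof.
move=> m0.
have K0 : 0 < 1 + 3 * `|a| + 4 * `|a| ^+ 2.
  by have := normr_ge0 a; have := sqr_ge0 `|a|; lra.
set K := 1 + 3 * `|a| + 4 * `|a| ^+ 2 in K0.
have int0 k : (0 <= \int[nu]_x `|levy_phase a k x|%:E)%E by exact: nint_ge0.
have : (\int[nu]_x `|levy_phase a k x|%:E @[k --> \oo] --> 0)%E.
  apply: cvge0_approx => // e e0.
  pose F := fine (\int[nu]_x (far 1 ((x : paths R) 0))%:E)%E.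
  have F0 : 0 <= F by rewrite fine_ge0// nint_ge0.
  (* Chosen so that [K * e' * (2 F) <= e], the factor 2 counting the tails of the two
     coordinates. *)
  pose e' := e / (K * 2 * (F + 1)).
  have e'0 : 0 < e' by rewrite divr_gt0// !mulr_gt0// ltr_wpDl.
  exists (K * (1 + e'^-1)), (min_dist nu n); split => //.
  - by rewrite mulr_ge0 ?(ltW K0)// addr_ge0// invr_ge0 ltW.
  - by move=> k; exact: min_dist_ge0.
  move=> k; apply: (le_trans (nint_levy_phase_le a k e'0));
    rewrite -/K leeD2l//.
  rewrite -(fineK (_ : \int[nu]_x (far 1 ((x : paths R) 0))%:E \is a
    fin_num))%E.
    rewrite -/F -!EFinM lee_fin /e'.
    have -> : K * (e / (K * 2 * (F + 1))) * (2 * F) = e * (F / (F + 1)).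
      by field; rewrite !gt_eqF// ltr_wpDl.
    by rewrite ler_piMr ?(ltW e0)// ler_pdivrMr ?ltr_wpDl// mul1r lerDl.
  by rewrite ge0_fin_numE ?far1_lty ?nint_ge0.
move=> /(cvge0P int0) h; apply/cvgrPdist_le => e e0.
apply: filterS (h _ e0) => k hk.
rewrite sub0r normrN -lee_fin; apply: le_trans hk.
have iphi := integrable_levy_phase a k.
rewrite -(fineK (integrable_fin_num measurableT (integrable_norm iphi)))
  lee_fin.
exact: le_normr_Rintegral.
Qed.

End levy_distance.

(** * Increments under the law and under its Levy measure *)

Section infinitely_divisible.
Variable R : realType.
Variables (P : probability (paths R) R)
  (Q : {sigma_finite_measure set (paths R) -> \bar R}).
Hypothesis PQ : stationary_IDp P Q.
Variable n : nat -> nat.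
Hypothesis n_gt0 : forall k, (0 < n k)%N.

Lemma probability_levy :
  (\int[P]_x (Num.min ((x : paths R) 0 ^+ 2) 1)%:E < +oo)%E.
Proof.
apply: (@le_lt_trans _ _ (\int[P]_x (1 : R)%:E)%E).
  apply: nint_le => //.
  - exact: measurable_min_coordinate.
  - by move=> x; rewrite le_min sqr_ge0/=.
  - by move=> x; rewrite ge_min lexx orbT.
rewrite integral_cst// mul1e; apply: (@le_lt_trans _ _ 1%E);
  [exact: probability_le1|exact: ltry].
Qed.

Lemma cos_distP a k : cos_dist P n a k =
  (1 - expR (- fine (cos_dist Q n a k)) * cos (\int[Q]_x levy_phase n a k
    x))%:E.
Proof.
have [sP _ sQ _ lQ lk] := PQ.
have mc : measurable_fun setT (fun x : paths R => cos (a * (x (n k)%:Z - x 0))).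
  apply: (@measurableT_comp _ _ _ _ _ _ (@cos R)).
    by apply: continuous_measurable_fun; exact: continuous_cos.
  by apply: measurable_funM => //; exact: measurable_increment.
have i1 : P.-integrable setT (EFin \o cst (1 : R)).
  by apply: finite_measure_integrable_cst.
have ic : P.-integrable setT (EFin \o (fun x : paths R => cos (a * (x (n k)%:Z -
  x 0)))).
  apply: le_integrable i1 => //; first exact/measurable_EFinP.
  by move=> x _; rewrite /= lee_fin normr1 cos_max.
rewrite -(Rintegral_cos_sub1 Q n a k) /levy_phase -(levy_khintchine_increment a
  lk (n_gt0 k)).
have R1 : \int[P]_x (cst (1 : R) x) = 1.
  transitivity (1 * fine (P setT)); first exact: Rintegral_cst.
  by have -> := probability_setT P; rewrite mulr1.
rewrite -[X in (X - _)%:E]R1 -RintegralB//.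
rewrite /Rintegral fineK//.
apply: integrable_fin_num => //; exact: (integrableB _ i1 ic).
Qed.

(** Bounding the cosine of the phase by 1 gives [1 - exp (- r) <= cos_dist P n a k], with [r] the
    value of [cos_dist] for [Q]. *)
Lemma cos_dist_levy a : cos_dist P n a k @[k --> \oo] --> 0%E ->
  cos_dist Q n a k @[k --> \oo] --> 0%E.
Proof.
have [sP _ sQ _ lQ lk] := PQ.
move=> /(cvge0P (cos_dist_ge0 P n a)) h;
  apply/(cvge0P (cos_dist_ge0 Q n a)) => e e0.
have ee : 0 < 1 - expR (- e) by rewrite subr_gt0 expR_lt1 oppr_lt0.
apply: filterS (h _ ee) => k; rewrite cos_distP lee_fin lerD2l lerN2 => hk.
rewrite -(fineK (cos_dist_fin_num sQ lQ n a k)) lee_fin -lerN2 -ler_expR.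
apply: (le_trans hk); rewrite ler_piMr ?expR_ge0//.
Qed.

(** The hypothesis is on [min_dist] because it controls both the modulus, through [min_cos_dist],
    and the phase. *)
Lemma levy_cos_dist a : min_dist Q n k @[k --> \oo] --> 0%E ->
  cos_dist P n a k @[k --> \oo] --> 0%E.
Proof.
have [sP _ sQ _ lQ lk] := PQ.
move=> m0; rewrite (_ : cos_dist P n a = fun k => (1 - expR (- fine (cos_dist Q
  n a k)) *
    cos (\int[Q]_x levy_phase n a k x))%:E); last by apply/funext => k;
      exact: cos_distP.
apply/fine_cvgP; split; first exact: nearW.
rewrite [X in _ --> X](_ : _ = 1 - expR (- 0) * cos 0 :> R); last first.
  by rewrite oppr0 expR0 cos0 mulr1 subrr.
apply: cvgB; first exact: cvg_cst.
apply: cvgM.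
  apply: (@continuous_cvg _ _ _ _ _ _ (@expR R)); first exact: continuous_expR.
  by apply: cvgN; apply: fine_cvg; exact: min_cos_dist.
apply: (@continuous_cvg _ _ _ _ _ _ (@cos R)); first exact: continuous_cos.
exact: levy_phase_cvg0.
Qed.

End infinitely_divisible.

(** * Rigidity of the process *)

Section stationary_rigid.
Variable R : realType.
Variable P : probability (paths R) R.
Hypothesis P_shift : shift_invariant P.
Variable n : nat -> nat.
Local Notation S := (@path_shift R).
Local Notation tau := (fun k => @translate R (n k)%:Z).

Let mtau k : measurable_fun setT (tau k).
Proof. exact: measurable_translate. Qed.
Let tau_P k A : measurable A -> pushforward P (tau k) A = P A.
Proof. by move=> mA; exact: translate_invariant. Qed.

Lemma shift_nonsingular : nonsingular P S.
Proof.
by split => A A0 B mB BA; have := A0 B mB BA; rewrite P_shift.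
Qed.

Lemma RN_iter_shift N : {ae P, forall x, RN_iter P S N x = 1}.
Proof.
apply: (@RN_derivative_unique _ _ _ P P).
- exact: sigma_finiteT.
- have [mw w0 h] := RN_iterP shift_nonsingular N; split => // A mA.
  rewrite -h// /pushforward.
  have mB : measurable (iter N (bim_inv S) @^-1` A).
    by apply: measurable_preimageT => //; apply: measurable_iter;
      exact: measurable_shift_inv.
  rewrite -(iter_shift_invariant P_shift N mB) /pushforward; congr (P _).
  by apply/funext => x; exact: (congr1 A (esym (iter_bim_funK S N x))).
split => // A mA; rewrite integral_cst// mul1e//.
Qed.

Lemma koopman_shift N (f : paths R -> R) : {ae P, forall x,
  koopman P S N f x = f (translate N%:Z x)}.
Proof.
apply: filterS (RN_iter_shift N) => x wx.
by rewrite /koopman wx sqrtr1 mul1r iter_shiftE.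
Qed.

Lemma bounded_square_integrable (f : paths R -> R) : measurable_fun setT f ->
  (forall x, `|f x| <= 1) -> square_integrable P f.
Proof.
move=> mf f1; split => //; apply: (@le_lt_trans _ _ (\int[P]_x (1 : R)%:E)%E).
  apply: nint_le => //.
  - exact: measurable_sqr.
  - by move=> x; exact: sqr_ge0.
  - by move=> x; rewrite -real_normK ?num_real// expr_le1.
rewrite integral_cst// mul1e.
by apply: (@le_lt_trans _ _ 1%E); [exact: probability_le1|exact: ltry].
Qed.

(** By the addition formula, [cos (a (x_n - x_0))] is a sum of two correlations; rigidity is applied
    to [cos (a x_0)] and [sin (a x_0)], each paired with itself. *)
Lemma rigid_cos_dist : rigid P S n -> forall a, cos_dist P n a k @[k --> \oo]
  --> 0%E.
Proof.
move=> rP a.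
have mcoord (j : int) : measurable_fun setT (fun x : paths R => a * x j).
  by apply: measurable_funM => //; exact: measurable_coordinate.
have mcos (j : int) : measurable_fun setT (fun x : paths R => cos (a * x j)).
  apply: (@measurableT_comp _ _ _ _ _ _ (@cos R)) => //.
  by apply: continuous_measurable_fun; exact: continuous_cos.
have msin (j : int) : measurable_fun setT (fun x : paths R => sin (a * x j)).
  apply: (@measurableT_comp _ _ _ _ _ _ (@sin R)) => //.
  by apply: continuous_measurable_fun; exact: continuous_sin.
have cos2 j : square_integrable P (fun x : paths R => cos (a * x j)).
  by apply: bounded_square_integrable => // x; exact: cos_max.
have sin2 j : square_integrable P (fun x : paths R => sin (a * x j)).
  by apply: bounded_square_integrable => // x; exact: sin_max.
have lim (g : int -> paths R -> R) : (forall j, square_integrable P (g j)) ->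
    (forall j N x, g j (translate N x) = g (j + N) x) ->
    \int[P]_x (g (n k)%:Z x * g 0 x) @[k --> \oo] --> \int[P]_x (g 0 x * g 0 x).
  move=> g2 gT.
  rewrite (_ : (fun _ => _) = fun k => \int[P]_x (koopman P S (n k) (g 0) x * g
    0 x)).
    by apply: rP; apply/Lfun2P.
  have mg j : measurable_fun setT (g j) by have [] := g2 j.
  apply/funext => k; congr fine; apply: ae_nint_eq.
  - exact: measurable_funM.
  - by apply: measurable_funM => //;
      exact: (measurable_koopman shift_nonsingular).
  - by apply: filterS (koopman_shift (n k) (g 0)) => x ->; rewrite gT add0r.
have := cvgD (lim _ cos2 (fun _ _ _ => erefl)) (lim _ sin2 (fun _ _ _ =>
  erefl)).
have mC k : measurable_fun setT (fun x : paths R => cos (a * (x (n k)%:Z - x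
  0))).
  apply: (@measurableT_comp _ _ _ _ _ _ (@cos R)).
    by apply: continuous_measurable_fun; exact: continuous_cos.
  by apply: measurable_funM => //; exact: measurable_increment.
have i1 : P.-integrable setT (EFin \o cst (1 : R)).
  by apply: finite_measure_integrable_cst.
have R1 : \int[P]_x (cst (1 : R) x) = 1.
  transitivity (1 * fine (P setT)); first exact: Rintegral_cst.
  by have -> := probability_setT P; rewrite mulr1.
have iC k : P.-integrable setT
    (EFin \o (fun x : paths R => cos (a * (x (n k)%:Z - x 0)))).
  apply: le_integrable i1 => //; first exact/measurable_EFinP.
  by move=> x _; rewrite /= lee_fin normr1 cos_max.
have icc (j : int) : P.-integrable setT
    (EFin \o (fun x : paths R => cos (a * x j) * cos (a * x 0))).
  by apply: square_integrable_mul.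
have iss (j : int) : P.-integrable setT
    (EFin \o (fun x : paths R => sin (a * x j) * sin (a * x 0))).
  by apply: square_integrable_mul.
have Rint2 k : \int[P]_x (cos (a * (x : paths R) (n k)%:Z) * cos (a * x 0)) +
    \int[P]_x (sin (a * (x : paths R) (n k)%:Z) * sin (a * x 0)) =
    1 - fine (cos_dist P n a k).
  rewrite -Rintegral_cos_sub1 -RintegralD// -[X in X + _]R1 -RintegralD//;
    last first.
    exact: (integrableB _ (iC k) i1).
  by apply: eq_Rintegral => x _; rewrite mulrBr cosB /= [RHS]addrC subrK.
have Rint1 : \int[P]_x (cos (a * (x : paths R) 0) * cos (a * x 0)) +
    \int[P]_x (sin (a * (x : paths R) 0) * sin (a * x 0)) = 1.
  rewrite -RintegralD// -[RHS]R1.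
  by apply: eq_Rintegral => x _; rewrite -!expr2 cos2Dsin2.
rewrite Rint1 => lim1; apply/fine_cvgP; split.
  apply: nearW => k; exact: (cos_dist_fin_num P_shift (probability_levy P)).
rewrite -[X in _ --> X](subrr (1 : R)).
rewrite (_ : fine \o _ = fun k => 1 - (1 - fine (cos_dist P n a k)));
  last first.
  by apply/funext => k; rewrite /= subKr.
apply: cvgB; first exact: cvg_cst.
by under eq_fun do rewrite -Rint2; exact: lim1.
Qed.

Lemma almost_invariant_sum (I : Type) (s : seq I) (F : I -> paths R -> R) :
  (forall i, almost_invariant P tau (F i)) ->
  almost_invariant P tau (fun x => \sum_(i <- s) F i x).
Proof.
move=> aF; elim: s => [|i s IH].
  apply: (@eq_almost_invariant _ _ _ _ _ (fun=> 0)).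
    by move=> x; rewrite big_nil.
  split; first by apply: bounded_square_integrable => // x; rewrite normr0.
  rewrite (_ : drift _ _ _ = fun=> 0%E); first exact: cvg_cst.
  apply/funext => k; rewrite /drift integral0_eq// => x _.
  by rewrite subrr expr0n.
have := almost_invariantD mtau (aF i) IH.
by apply: eq_almost_invariant => x; rewrite big_cons.
Qed.

(** For a probability the constant 1 is almost invariant, so every measurable set, being a
    multiplier, has an almost invariant indicator. Simple functions and monotone limits then reach
    all nonnegative [u] in [L^2(P)]. *)
Lemma cos_dist_rigid : (forall a, cos_dist P n a k @[k --> \oo] --> 0%E) ->
  rigid P S n.
Proof.
move=> cosP.
have cl := cos_clamp P_shift (probability_levy P) cosP.
have ai1 : almost_invariant P tau (fun=> 1).
  split; first by apply: bounded_square_integrable => // x; rewrite normr1.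
  rewrite (_ : drift _ _ _ = fun=> 0%E); first exact: cvg_cst.
  apply/funext => k; rewrite /drift integral0_eq// => x _.
  by rewrite subrr expr0n.
have aiB B (c : R) : measurable B -> almost_invariant P tau (fun x => c * \1_B
  x).
  move=> mB; have [_ hB] := multiplier_measurable P_shift cl mB.
  apply: eq_almost_invariant (almost_invariantZ mtau c (hB _ ai1)) => x.
  by rewrite mulr1.
apply: strong_rigid; first exact: shift_nonsingular.
move=> u u2 u0; have [m_u _] := u2.
have mu_E : measurable_fun setT (EFin \o u) by exact/measurable_EFinP.
pose h := nnsfun_approx measurableT mu_E.
have hu x : (h i x)%:E @[i --> \oo] --> (u x)%:E.
  by apply: cvg_nnsfun_approx => // y _; rewrite lee_fin.
have ai_u : almost_invariant P tau u.
  apply: (@almost_invariant_lim _ _ _ P tau mtau tau_P u (fun i => h i)) => //.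
  - move=> i.
    apply: (@eq_almost_invariant _ _ _ _ _ (fun x => \sum_(y <- finmap.enum_fset
      (fset_set (range (h i)))) y * \1_(h i @^-1` [set y]) x)).
      by move=> x; rewrite fimfunE fsbig_finite.
    by apply: almost_invariant_sum => y; apply: aiB; exact: measurable_sfunP.
  - move=> i x; rewrite !ger0_norm// -lee_fin nnsfun_approxE.
    by apply: le_approx => // y _; rewrite lee_fin.
  - by move=> x; have /fine_cvg := hu x.
rewrite (_ : (fun _ => _) = drift P tau u); first by case: ai_u.
apply/funext => k; apply: ae_nint_eq.
- apply: measurable_sqr; apply: measurable_funB => //.
  exact: (measurable_koopman shift_nonsingular).
- exact: (measurable_drift mtau).
- by apply: filterS (koopman_shift (n k) u) => x ->.
Qed.

End stationary_rigid.

Theorem theorem18 (R : realType) (alpha : R) (n : nat -> nat)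
    (P : probability (paths R) R)
    (Q : {sigma_finite_measure set (paths R) -> \bar R})
    (d : measure_display) (Omega : measurableType d)
    (mu : {sigma_finite_measure set Omega -> \bar R}) (T : bimeasurable Omega)
    (alpha_gt0 : 0 < alpha) (alpha_lt2 : alpha < 2)
    (n_gt0 : forall k, (0 < n k)%N)
    (n_incr : forall j k, (j < k)%N -> (n j < n k)%N)
    (P_stable : stationary_stable alpha P Q)
    (mu_lebesgue : lebesgue_space mu)
    (T_nonsingular : nonsingular mu T)
    (T_associated : associated alpha mu T Q) :
  rigid P path_shift n <-> rigid mu T n.
Proof.
have [PQ Q0 _] := P_stable; have [P_shift _ Q_shift Q_zero Q_levy _] := PQ.
have [f fL Phi_iso] := T_associated.
split=> [rP|rT].
  (* Read backwards: rigidity of [P] gives the cosines for [P], those for [Q], the truncated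
     coordinates under [Q], and finally the sets of finite [Q]-measure. *)
  apply: (levy_rigid alpha_gt0 T_nonsingular Q_shift Q_zero Q_levy Q0 fL
    Phi_iso).
  move=> B mB Boo; apply: (almost_invariant_indic_paths Q_shift _ Q_levy Q_zero
    mB Boo).2.
  apply: cos_clamp => // a; apply: (cos_dist_levy PQ n_gt0).
  exact: rigid_cos_dist.
(* Here [min_dist] replaces the cosines on the side of [Q], since the phase has to be controlled as
   well. *)
apply: cos_dist_rigid => // a; apply: (levy_cos_dist PQ n_gt0).
apply: clamp_min_dist => //.
exact: (rigid_clamp alpha_gt0 T_nonsingular Q_shift Q_zero Q_levy Q0 fL
  Phi_iso).
Qed.
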